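(* Let $h\colon S\to R$ be a flat ring homomorphism and $M$ an $S$-flat coherent $R$-module. Suppose $S$ is noetherian, $R$ is coherent and $n>1$. Assume $M$ is $n$-stably reflexive with respect to $h$. (i) For any ring homomorphism $S\to S'$ the base change $M'=M\otimes_S S'$ is $n$-stably reflexive with respect to $h'=h\otimes_S S'\colon S'\to R'=R\otimes_S S'$, and is $n$-stably reflexive as an $R'$-module. (ii) The dual $M^*=\operatorname{Hom}_R(M,R)$ is $n$-stably reflexive with respect to $h$. (iii) For any ring homomorphism $S\to S'$ and any $S'$-module $I'$, with $R'=R\otimes_SS'$ and $M'=M\otimes_SS'$, the base change map $M^*\otimes_S I'\to \operatorname{Hom}_{R'}(M',R'\otimes_{S'}I')$ is an isomorphism, and $$\operatorname{Ext}^i_{R'}(M',R'\otimes_{S'}I')=0\quad\text{for all }0<i<n.$$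
   Context: All rings are commutative and unital. A module is coherent if it is finitely generated and all its finitely generated submodules are finitely presented; a ring is coherent if it is coherent as a module over itself. For a ring $A$ and an $A$-module $M$ put $M^*=\operatorname{Hom}_A(M,A)$; $M$ is reflexive if the evaluation map $M\to M^{**}$ is an isomorphism. For a positive integer $n$, $M$ is $n$-stably reflexive (as an $A$-module) if $M$ is reflexive and $\operatorname{Ext}^i_A(M,A)=0=\operatorname{Ext}^i_A(M^*,A)$ for all $0<i<n$. Let $h\colon S\to R$ be a flat ring homomorphism. An $R$-module $M$ is $n$-stably reflexive with respect to $h$ if $M$ is $S$-flat and, for every $s$ in the image of the closed points of $\operatorname{Spec}R$ under $\operatorname{Spec}R\to\operatorname{Spec}S$, the fibre $M_s=M\otimes_S k(s)$ is $n$-stably reflexive as an $R_s=R\otimes_S k(s)$-module ($k(s)$ is the residue field of $s$). The base change map in (iii) is the natural map sending $\xi\otimes u$ to the $R'$-linear map $M'\to R'\otimes_{S'}I'\cong R\otimes_S I'$ given by $m\otimes a\mapsto \xi(m)\otimes au$. *)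

(* Defs.v *)
From HB Require Import structures.
From mathcomp Require Import all_boot all_order all_algebra.
From mathcomp Require Import fraction generic_quotient ring_quotient.
From mathcomp Require Import boolp classical_sets functions.
From mathcomp Require Import finmap monalg.

Set Implicit Arguments.
Unset Strict Implicit.
Unset Printing Implicit Defensive.

Import GRing.Theory.

Local Open Scope ring_scope.
Local Open Scope quotient_scope.

(* Rings are comPzRingType, so the zero ring is allowed: a base change or a   *)
(* tensor product of nonzero rings may vanish.                                *)

(* The library quotient of a zmodType, with the projection sealed: otherwise  *)
(* conversion tries to evaluate the choice of canonical representatives.      *)
Definition zquot (V : zmodType) (W : zmodClosed V) : Type := {ideal_quot W}.

HB.instance Definition _ (V : zmodType) (W : zmodClosed V) :=
  Choice.on (zquot W).

HB.lock Definition zproj (V : zmodType) (W : zmodClosed V) (v : V) : zquot W :=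
  \pi_({ideal_quot W}) v.

HB.lock Definition zrepr (V : zmodType) (W : zmodClosed V) (x : zquot W) : V :=
  repr (x : {ideal_quot W}).

Section Zquot.
Variables (V : zmodType) (W : zmodClosed V).
Implicit Types (x y : zquot W) (u v : V).
Local Notation zproj := (@zproj V W).

Lemma zreprK x : zproj (zrepr x) = x.
Proof. by rewrite zproj.unlock zrepr.unlock reprK. Qed.

Lemma zproj_eqP u v : zproj u = zproj v <-> u - v \in W.
Proof.
rewrite zproj.unlock Quotient.idealrBE; split=> [->|/eqP //].
exact: eqxx.
Qed.

Definition zquot_add x y := zproj (zrepr x + zrepr y).
Definition zquot_opp x := zproj (- zrepr x).

Lemma zquot_addE u v : zquot_add (zproj u) (zproj v) = zproj (u + v).
Proof.
apply/zproj_eqP; rewrite opprD addrACA.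
by apply: rpredD; apply/zproj_eqP; rewrite zreprK.
Qed.

Lemma zquot_oppE u : zquot_opp (zproj u) = zproj (- u).
Proof.
apply/zproj_eqP; rewrite -opprD; apply: rpredNr.
by apply/zproj_eqP; rewrite zreprK.
Qed.

Fact zquot_addA : associative zquot_add.
Proof.
by move=> x y z; rewrite -[x]zreprK -[y]zreprK -[z]zreprK !zquot_addE addrA.
Qed.

Fact zquot_addC : commutative zquot_add.
Proof. by move=> x y; rewrite /zquot_add addrC. Qed.

Fact zquot_add0 : left_id (zproj 0) zquot_add.
Proof. by move=> x; rewrite -[x]zreprK zquot_addE add0r. Qed.

Fact zquot_addN : left_inverse (zproj 0) zquot_opp zquot_add.
Proof. by move=> x; rewrite -[x]zreprK zquot_oppE zquot_addE addNr. Qed.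

HB.instance Definition _ := GRing.isZmodule.Build (zquot W)
  zquot_addA zquot_addC zquot_add0 zquot_addN.

Fact zproj_additive : zmod_morphism zproj.
Proof.
move=> u v; rewrite -[zproj u - _]/(zquot_add _ (zquot_opp _)).
by rewrite zquot_oppE zquot_addE.
Qed.

HB.instance Definition _ :=
  GRing.isZmodMorphism.Build V (zquot W) zproj zproj_additive.

End Zquot.

Section Submodules.
Variables (A : comPzRingType) (V : lmodType A).

Record submodule := Submodule {
  submodule_pred :> {pred V};
  submoduleP : submod_closed submodule_pred }.

HB.instance Definition _ (W : submodule) :=
  GRing.isZmodClosed.Build V (submodule_pred W)
    (GRing.submod_closedB (submoduleP W)).
HB.instance Definition _ (W : submodule) :=
  GRing.isSubmodClosed.Build A V (submodule_pred W) (submoduleP W).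

Definition submod (W : submodule) : Type := {x : V | x \in submodule_pred W}.

HB.instance Definition _ (W : submodule) := SubChoice.on (submod W).
HB.instance Definition _ (W : submodule) :=
  [SubChoice_isSubLmodule of submod W by <:].

Definition quotmod (W : submodule) : Type := zquot (submodule_pred W).

HB.instance Definition _ (W : submodule) := GRing.Zmodule.on (quotmod W).

End Submodules.

Section QuotientModule.
Variables (A : comPzRingType) (V : lmodType A) (W : submodule V).

Definition quot_proj (v : V) : quotmod W := zproj (submodule_pred W) v.

Lemma quot_proj_eqP u v : quot_proj u = quot_proj v <-> u - v \in W.
Proof. exact: zproj_eqP. Qed.

Lemma quot_projP (x : quotmod W) : exists v, x = quot_proj v.
Proof. by exists (zrepr (x : zquot (submodule_pred W))); rewrite /quot_proj zreprK. Qed.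

Lemma quot_projD u v : quot_proj (u + v) = quot_proj u + quot_proj v.
Proof. exact: (raddfD (zproj (submodule_pred W))). Qed.

Definition quotmod_scale (a : A) (x : quotmod W) : quotmod W :=
  quot_proj (a *: zrepr (x : zquot (submodule_pred W))).

Lemma quotmod_scaleE a v :
  quotmod_scale a (quot_proj v) = quot_proj (a *: v).
Proof.
apply/quot_proj_eqP; rewrite -scalerBr; apply: rpredZ.
by apply/quot_proj_eqP; rewrite /quot_proj zreprK.
Qed.

Fact quotmod_scaleA a b x :
  quotmod_scale a (quotmod_scale b x) = quotmod_scale (a * b) x.
Proof. by have [v ->] := quot_projP x; rewrite !quotmod_scaleE scalerA. Qed.

Fact quotmod_scale1 : left_id 1 quotmod_scale.
Proof.
by move=> x; have [v ->] := quot_projP x; rewrite quotmod_scaleE scale1r.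
Qed.

Fact quotmod_scaleDr : right_distributive quotmod_scale +%R.
Proof.
move=> a x y; have [u ->] := quot_projP x; have [v ->] := quot_projP y.
by rewrite -quot_projD !quotmod_scaleE scalerDr quot_projD.
Qed.

Fact quotmod_scaleDl x :
  {morph (fun a => quotmod_scale a x) : a b / a + b}.
Proof.
by move=> a b; have [v ->] := quot_projP x;
  rewrite !quotmod_scaleE scalerDl quot_projD.
Qed.

HB.instance Definition _ := GRing.Zmodule_isLmodule.Build A (quotmod W)
  quotmod_scaleA quotmod_scale1 quotmod_scaleDr quotmod_scaleDl.

Fact quot_proj_linear : linear quot_proj.
Proof. by move=> a u v; rewrite quot_projD -quotmod_scaleE. Qed.

HB.instance Definition _ :=
  GRing.isLinear.Build A V (quotmod W) *:%R quot_proj quot_proj_linear.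

End QuotientModule.

Section Hom.
Variables (A : comPzRingType) (U V : lmodType A).
Implicit Types f g h : {linear U -> V}.

Lemma linear_ext f g : f =1 g -> f = g.
Proof.
case: f g => f [[fa] [fb]] [g [[ga] [gb]]] /= /funext fg.
by case: _ / fg ga gb => ga gb; congr GRing.Linear.Pack; congr GRing.Linear.Class;
  congr (_ _); apply: Prop_irrelevance.
Qed.

(* Hom_A(U, V) as an A-module is {linear U -> V} itself. *)
HB.instance Definition _ := gen_eqMixin {linear U -> V}.
HB.instance Definition _ := gen_choiceMixin {linear U -> V}.

Definition hom_zero : {linear U -> V} := \0.
Definition hom_add f g : {linear U -> V} := f \+ g.
Definition hom_opp f : {linear U -> V} := \- f.
Definition hom_scale (a : A) f : {linear U -> V} := a \*: f.


Fact hom_addA : associative hom_add.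
Proof. by move=> f g h; apply: linear_ext => x /=; rewrite addrA. Qed.

Fact hom_addC : commutative hom_add.
Proof. by move=> f g; apply: linear_ext => x /=; rewrite addrC. Qed.

Fact hom_add0 : left_id hom_zero hom_add.
Proof. by move=> f; apply: linear_ext => x /=; rewrite add0r. Qed.

Fact hom_addN : left_inverse hom_zero hom_opp hom_add.
Proof. by move=> f; apply: linear_ext => x /=; rewrite addNr. Qed.

HB.instance Definition _ := GRing.isZmodule.Build {linear U -> V}
  hom_addA hom_addC hom_add0 hom_addN.

Fact hom_scaleA a b f : hom_scale a (hom_scale b f) = hom_scale (a * b) f.
Proof. by apply: linear_ext => x /=; rewrite scalerA. Qed.

Fact hom_scale1 : left_id 1 hom_scale.
Proof. by move=> f; apply: linear_ext => x /=; rewrite scale1r. Qed.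

Fact hom_scaleDr : right_distributive hom_scale +%R.
Proof. by move=> a f g; apply: linear_ext => x /=; rewrite scalerDr. Qed.

Fact hom_scaleDl f : {morph (fun a => hom_scale a f) : a b / a + b}.
Proof. by move=> a b; apply: linear_ext => x /=; rewrite scalerDl. Qed.

HB.instance Definition _ := GRing.Zmodule_isLmodule.Build A {linear U -> V}
  hom_scaleA hom_scale1 hom_scaleDr hom_scaleDl.

End Hom.

Section Reflexive.
Variables (A : comPzRingType).

Definition dual (M : lmodType A) : lmodType A := {linear M -> A^o}.

Section Bidual.
Variables (M : lmodType A) (m : M).

Definition bidual_fun (f : dual M) : A^o := (f : {linear M -> A^o}) m.

Fact bidual_fun_linear : linear bidual_fun.
Proof. by []. Qed.

HB.instance Definition _ :=
  GRing.isLinear.Build A (dual M) A^o *:%R bidual_fun bidual_fun_linear.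

Definition bidual_eval : dual (dual M) := (bidual_fun : {linear dual M -> A^o}).

End Bidual.

Definition reflexive_module (M : lmodType A) := bijective (@bidual_eval M).

End Reflexive.

Section Coherence.
Variable A : comPzRingType.

Definition fin_gen (M : lmodType A) :=
  exists n (v : 'I_n -> M), forall x, exists c : 'I_n -> A,
    x = \sum_(i < n) c i *: v i.

Definition ker_pred (M N : lmodType A) (f : {linear M -> N}) : {pred M} :=
  [pred x | f x == 0].

Fact ker_pred_closed (M N : lmodType A) (f : {linear M -> N}) :
  submod_closed (ker_pred f).
Proof.
split=> [|a x y]; rewrite !inE ?linear0 // => /eqP fx /eqP fy.
by rewrite linearP fx fy scaler0 addr0.
Qed.

Definition ker (M N : lmodType A) (f : {linear M -> N}) : submodule M :=
  Submodule (ker_pred_closed f).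

Definition fin_pres (M : lmodType A) :=
  exists n (f : {linear 'rV[A]_n -> M}),
    (forall y, exists x, f x = y) /\ fin_gen (submod (ker f)).

Definition coherent_module (M : lmodType A) :=
  fin_gen M /\
  forall W : submodule M, fin_gen (submod W) -> fin_pres (submod W).

Definition coherent_ring := coherent_module A^o.

Definition noetherian_ring :=
  forall I : submodule (A^o : lmodType A), fin_gen (submod I).

End Coherence.

Section MalgLift.
Variables (K : choiceType) (G V : zmodType) (F : K -> {additive G -> V}).

Definition malg_lift (g : {malg G[K]}) : V := \sum_(k <- msupp g) F k g@_k.

Lemma malg_liftEw (D : {fset K}) (g : {malg G[K]}) :
  (msupp g `<=` D)%fset -> malg_lift g = \sum_(k <- D) F k g@_k.
Proof.
move=> leD; rewrite /malg_lift (big_fset_incl _ leD) // => k _ kNg.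
by rewrite (mcoeff_outdom kNg) raddf0.
Qed.

Fact malg_lift_additive : zmod_morphism malg_lift.
Proof.
move=> g h; pose D := (msupp g `|` msupp h)%fset.
rewrite (@malg_liftEw D (g - h)) ?msuppB_le // (@malg_liftEw D g) ?fsubsetUl //.
rewrite (@malg_liftEw D h) ?fsubsetUr // -sumrB.
by apply: eq_bigr => k _; rewrite mcoeffB raddfB.
Qed.

HB.instance Definition _ :=
  GRing.isZmodMorphism.Build {malg G[K]} V malg_lift malg_lift_additive.

Lemma malg_liftU k c : malg_lift << c *g k >> = F k c.
Proof.
by rewrite (malg_liftEw msuppU_le) big_seq_fset1 mcoeffUU.
Qed.

End MalgLift.

Section FreeModule.
Variables (A : comPzRingType) (X : choiceType).

(* monalg only makes {malg A[X]} a module when A is a nonzero ring. *)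
Definition freemod : Type := {malg A[X]}.

HB.instance Definition _ := GRing.Zmodule.on freemod.

Definition freemod_scale (a : A) (g : freemod) : freemod :=
  [malg k in msupp g => a * g@_k].

Lemma mcoeff_scale a g k : (freemod_scale a g)@_k = a * g@_k.
Proof. by rewrite mcoeffE; case: msuppP => // _; rewrite mulr0. Qed.

Fact freemod_scaleA a b g :
  freemod_scale a (freemod_scale b g) = freemod_scale (a * b) g.
Proof. by apply/malgP => k; rewrite !mcoeff_scale mulrA. Qed.

Fact freemod_scale1 : left_id 1 freemod_scale.
Proof. by move=> g; apply/malgP => k; rewrite mcoeff_scale mul1r. Qed.

Fact freemod_scaleDr : right_distributive freemod_scale +%R.
Proof.
by move=> a g h; apply/malgP => k; rewrite mcoeffD !mcoeff_scale mcoeffD mulrDr.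
Qed.

Fact freemod_scaleDl g : {morph (fun a => freemod_scale a g) : a b / a + b}.
Proof.
by move=> a b; apply/malgP => k; rewrite mcoeffD !mcoeff_scale mulrDl.
Qed.

HB.instance Definition _ := GRing.Zmodule_isLmodule.Build A freemod
  freemod_scaleA freemod_scale1 freemod_scaleDr freemod_scaleDl.

Section Lift.
Variables (V : lmodType A) (f : X -> V).

Definition scale_at (v : V) (a : A) : V := a *: v.

Fact scale_at_additive v : zmod_morphism (scale_at v).
Proof. by move=> a b; rewrite /scale_at scalerBl. Qed.

HB.instance Definition _ v :=
  GRing.isZmodMorphism.Build A V (scale_at v) (scale_at_additive v).

Definition freemod_lift : freemod -> V := malg_lift (fun x => scale_at (f x)).

Fact freemod_lift_linear : linear freemod_lift.
Proof.
move=> a g h.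
transitivity (freemod_lift (freemod_scale a g) + freemod_lift h).
  exact: (raddfD (malg_lift (fun x => scale_at (f x)))).
congr (_ + _); rewrite [in LHS]/freemod_lift.
rewrite (@malg_liftEw _ _ _ _ (msupp g)).
  rewrite /freemod_lift /malg_lift scaler_sumr.
  by apply: eq_bigr => x _; rewrite /= /scale_at mcoeff_scale scalerA.
apply/fsubsetP => x; rewrite -!mcoeff_neq0 mcoeff_scale.
by apply: contraNneq => ->; rewrite mulr0.
Qed.

HB.instance Definition _ :=
  GRing.isLinear.Build A freemod V *:%R freemod_lift freemod_lift_linear.

End Lift.
End FreeModule.

Section Tensor.
Variables (A : comPzRingType) (M N : lmodType A).

(* The subgroup of Z[M x N] generated by the bilinearity relators; M (x) N is *)
(* the quotient of Z[M x N] by it.                                            *)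
Inductive tens_rel : {malg int[(M * N)%type]} -> Prop :=
| TensRel0 : tens_rel 0
| TensRelB x y : tens_rel x -> tens_rel y -> tens_rel (x - y)
| TensRelDl m m' n :
    tens_rel (<< (m + m', n) >> - << (m, n) >> - << (m', n) >>)
| TensRelDr m n n' :
    tens_rel (<< (m, n + n') >> - << (m, n) >> - << (m, n') >>)
| TensRelZ a m n : tens_rel (<< (a *: m, n) >> - << (m, a *: n) >>).

Definition tens_rel_pred : {pred {malg int[(M * N)%type]}} :=
  [pred x | `[< tens_rel x >]].

Fact tens_rel_closed : zmod_closed tens_rel_pred.
Proof.
split=> [|x y]; rewrite !inE; first exact/asboolP/TensRel0.
by move=> /asboolP xP /asboolP yP; apply/asboolP/TensRelB.
Qed.

HB.instance Definition _ :=
  GRing.isZmodClosed.Build {malg int[(M * N)%type]} tens_rel_pred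
    tens_rel_closed.

Definition tens : Type := zquot tens_rel_pred.

HB.instance Definition _ := GRing.Zmodule.on tens.

Definition tens_proj (x : {malg int[(M * N)%type]}) : tens :=
  zproj tens_rel_pred x.

End Tensor.

HB.lock Definition tpure (A : comPzRingType) (M N : lmodType A)
    (m : M) (n : N) : tens M N := tens_proj << (m, n) >>.

Notation "m \ox n" := (tpure m n) (at level 40, left associativity) : ring_scope.

Section TensorTheory.
Variables (A : comPzRingType) (M N : lmodType A).

Fact tens_proj_additive : zmod_morphism (@tens_proj A M N).
Proof. exact: zproj_additive. Qed.

HB.instance Definition _ := GRing.isZmodMorphism.Build
  {malg int[(M * N)%type]} (tens M N) (@tens_proj A M N) tens_proj_additive.

Lemma tens_proj_eq (x y : {malg int[(M * N)%type]}) :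
  (tens_proj x = tens_proj y) <-> tens_rel (x - y).
Proof.
split=> [/zproj_eqP|xy]; first by rewrite inE => /asboolP.
by apply/zproj_eqP; rewrite inE; apply/asboolP.
Qed.

Lemma tens_projP (t : tens M N) : exists x, t = tens_proj x.
Proof.
by exists (zrepr (t : zquot (@tens_rel_pred A M N))); rewrite /tens_proj zreprK.
Qed.

Lemma tpureDl m m' (n : N) : (m + m') \ox n = m \ox n + m' \ox n :> tens M N.
Proof.
rewrite tpure.unlock -raddfD; apply/tens_proj_eq; rewrite opprD addrA.
exact: TensRelDl.
Qed.

Lemma tpureDr (m : M) n n' : m \ox (n + n') = m \ox n + m \ox n' :> tens M N.
Proof.
rewrite tpure.unlock -raddfD; apply/tens_proj_eq; rewrite opprD addrA.
exact: TensRelDr.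
Qed.

Lemma tpureZ a (m : M) (n : N) : (a *: m) \ox n = m \ox (a *: n) :> tens M N.
Proof. by rewrite tpure.unlock; apply/tens_proj_eq; apply: TensRelZ. Qed.

Lemma tpure0l (n : N) : 0 \ox n = 0 :> tens M N.
Proof. by apply: (addrI (0 \ox n)); rewrite -tpureDl !addr0. Qed.

Lemma tpure0r (m : M) : m \ox 0 = 0 :> tens M N.
Proof. by apply: (addrI (m \ox 0)); rewrite -tpureDr !addr0. Qed.

Lemma tpureNl (m : M) (n : N) : (- m) \ox n = - (m \ox n) :> tens M N.
Proof. by apply: (addrI (m \ox n)); rewrite -tpureDl !subrr tpure0l. Qed.

Lemma tens_ind (P : tens M N -> Prop) :
  P 0 -> (forall m n, P (m \ox n)) -> (forall x y, P x -> P y -> P (x + y)) ->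
  forall t, P t.
Proof.
move=> P0 Pp PD t; have [x ->] := tens_projP t.
have Pn m n k : P ((m \ox n) *+ k).
  by elim: k => // k IH; rewrite mulrS; apply: PD.
rewrite [x]monalgE raddf_sum /=; elim/big_rec: _ => // -[m n] y _; apply: PD.
rewrite -[x@_ _]intz raddfMz raddfMz /=.
have -> : tens_proj << (m, n) >> = m \ox n by rewrite tpure.unlock.
case: (x@_ _) => k; first exact: Pn.
by rewrite NegzE mulrNz -mulNrz -tpureNl; exact: Pn.
Qed.

End TensorTheory.

Section TensorLift.
Variables (A : comPzRingType) (M N : lmodType A) (V : zmodType).

Record balanced_map := BalancedMap {
  balanced_fun :> M -> N -> V;
  balancedDl : forall m m' n,
    balanced_fun (m + m') n = balanced_fun m n + balanced_fun m' n;
  balancedDr : forall m n n',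
    balanced_fun m (n + n') = balanced_fun m n + balanced_fun m n';
  balancedZ : forall a m n, balanced_fun (a *: m) n = balanced_fun m (a *: n) }.

Variable f : balanced_map.

Definition intmul_at (v : V) (k : int) : V := v *~ k.

Fact intmul_at_additive v : zmod_morphism (intmul_at v).
Proof. by move=> a b; rewrite /intmul_at mulrzBr. Qed.

HB.instance Definition _ v :=
  GRing.isZmodMorphism.Build int V (intmul_at v) (intmul_at_additive v).

Definition pretens_lift : {malg int[(M * N)%type]} -> V :=
  malg_lift (fun p => intmul_at (f p.1 p.2)).

Lemma pretens_lift_rel x : tens_rel x -> pretens_lift x = 0.
Proof.
rewrite /pretens_lift.
elim=> [|{}x y _ fx _ fy|m m' n|m n n'|a m n];
  rewrite ?raddf0 ?raddfB /= ?malg_liftU /intmul_at /= ?mulr1z //.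
- by rewrite fx fy subrr.
- by rewrite balancedDl -addrA -opprD subrr.
- by rewrite balancedDr -addrA -opprD subrr.
- by rewrite balancedZ subrr.
Qed.

End TensorLift.

HB.lock Definition tens_lift (A : comPzRingType) (M N : lmodType A)
    (V : zmodType) (f : balanced_map M N V) (t : tens M N) : V :=
  pretens_lift f (zrepr (t : zquot (@tens_rel_pred A M N))).

Section TensorLiftTheory.
Variables (A : comPzRingType) (M N : lmodType A) (V : zmodType).
Variable f : balanced_map M N V.
Local Notation tens_lift := (tens_lift f).
Local Notation pretens_lift := (pretens_lift f).

Lemma tens_lift_proj x : tens_lift (tens_proj x) = pretens_lift x.
Proof.
apply/eqP; rewrite -subr_eq0 tens_lift.unlock.
rewrite -(raddfB (malg_lift (fun p => intmul_at (f p.1 p.2)))); apply/eqP.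
by apply: pretens_lift_rel; apply/tens_proj_eq; rewrite /tens_proj zreprK.
Qed.

Fact tens_lift_additive : zmod_morphism tens_lift.
Proof.
move=> s t; have [x ->] := tens_projP s; have [y ->] := tens_projP t.
by rewrite -raddfB !tens_lift_proj /pretens_lift raddfB.
Qed.

HB.instance Definition _ :=
  GRing.isZmodMorphism.Build (tens M N) V tens_lift tens_lift_additive.

Lemma tens_liftE m n : tens_lift (m \ox n) = f m n.
Proof. by rewrite tpure.unlock tens_lift_proj /pretens_lift malg_liftU; exact: mulr1z. Qed.

End TensorLiftTheory.

Lemma tens_additive_eq (A : comPzRingType) (M N : lmodType A) (V : zmodType)
    (f g : {additive tens M N -> V}) :
  (forall m n, f (m \ox n) = g (m \ox n)) -> f =1 g.
Proof.
move=> fg; elim/tens_ind => [|//|x y fx fy]; first by rewrite !raddf0.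
by rewrite !raddfD fx fy.
Qed.

Section TensorMap.
Variables (A : comPzRingType) (M M' N N' : lmodType A).
Variables (f : {linear M -> M'}) (g : {linear N -> N'}).

Fact tens_map_balanced_Dl m m' n :
  f (m + m') \ox g n = f m \ox g n + f m' \ox g n :> tens M' N'.
Proof. by rewrite linearD tpureDl. Qed.

Fact tens_map_balanced_Dr m n n' :
  f m \ox g (n + n') = f m \ox g n + f m \ox g n' :> tens M' N'.
Proof. by rewrite linearD tpureDr. Qed.

Fact tens_map_balanced_Z a m n :
  f (a *: m) \ox g n = f m \ox g (a *: n) :> tens M' N'.
Proof. by rewrite !linearZ /= tpureZ. Qed.

Definition tens_map : tens M N -> tens M' N' :=
  tens_lift (BalancedMap tens_map_balanced_Dl tens_map_balanced_Dr
    tens_map_balanced_Z).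

HB.instance Definition _ := GRing.Additive.on tens_map.

Lemma tens_mapE m n : tens_map (m \ox n) = f m \ox g n.
Proof. exact: tens_liftE. Qed.

End TensorMap.

Section TensorScale.
Variables (A : comPzRingType) (M N : lmodType A).

Definition tens_scale (a : A) : tens M N -> tens M N :=
  tens_map (a \*: (idfun : {linear M -> M})) (idfun : {linear N -> N}).

HB.instance Definition _ a := GRing.Additive.on (tens_scale a).

Lemma tens_scaleE a m n : tens_scale a (m \ox n) = (a *: m) \ox n.
Proof. exact: tens_mapE. Qed.

Fact tens_scaleDr : right_distributive tens_scale +%R.
Proof. by move=> a; exact: raddfD. Qed.

Fact tens_scale0 a : tens_scale a 0 = 0.
Proof. exact: raddf0. Qed.

Fact tens_scaleA a b t : tens_scale a (tens_scale b t) = tens_scale (a * b) t.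
Proof.
elim/tens_ind: t => [|m n|x y IHx IHy]; first by rewrite !tens_scale0.
  by rewrite !tens_scaleE scalerA.
by rewrite !tens_scaleDr IHx IHy.
Qed.

Fact tens_scale1 : left_id 1 tens_scale.
Proof.
elim/tens_ind => [|m n|x y IHx IHy]; first by rewrite !tens_scale0.
  by rewrite !tens_scaleE scale1r.
by rewrite !tens_scaleDr IHx IHy.
Qed.

Fact tens_scaleDl t : {morph tens_scale^~ t : a b / a + b}.
Proof.
move=> a b; elim/tens_ind: t => [|m n|x y IHx IHy].
- by rewrite !tens_scale0 addr0.
- by rewrite !tens_scaleE scalerDl tpureDl.
- by rewrite !tens_scaleDr IHx IHy addrACA.
Qed.

HB.instance Definition _ := GRing.Zmodule_isLmodule.Build A (tens M N)
  tens_scaleA tens_scale1 tens_scaleDr tens_scaleDl.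

Lemma tpureZl a (m : M) (n : N) : (a *: m) \ox n = a *: (m \ox n) :> tens M N.
Proof. exact/esym/tens_scaleE. Qed.

Lemma tpureZr a (m : M) (n : N) : m \ox (a *: n) = a *: (m \ox n) :> tens M N.
Proof. by rewrite -tpureZ tpureZl. Qed.

End TensorScale.

Definition flat_module (A : comPzRingType) (M : lmodType A) :=
  forall (U V : lmodType A) (f : {linear U -> V}), injective f ->
    injective (tens_map (idfun : {linear M -> M}) f).

(* The B-module M seen as an A-module along k. *)
Definition restr (A B : comPzRingType) (k : {rmorphism A -> B})
  (M : lmodType B) : Type := M.

Section Restriction.
Variables (A B : comPzRingType) (k : {rmorphism A -> B}) (M : lmodType B).

HB.instance Definition _ := GRing.Zmodule.on (restr k M).

Definition restr_scale (a : A) (m : restr k M) : restr k M := k a *: (m : M).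

Fact restr_scaleA a b m : restr_scale a (restr_scale b m) = restr_scale (a * b) m.
Proof. by rewrite /restr_scale scalerA -rmorphM. Qed.

Fact restr_scale1 : left_id 1 restr_scale.
Proof. by move=> m; rewrite /restr_scale rmorph1 scale1r. Qed.

Fact restr_scaleDr : right_distributive restr_scale +%R.
Proof. by move=> a m m'; rewrite /restr_scale scalerDr. Qed.

Fact restr_scaleDl m : {morph restr_scale^~ m : a b / a + b}.
Proof. by move=> a b; rewrite /restr_scale rmorphD scalerDl. Qed.

HB.instance Definition _ := GRing.Zmodule_isLmodule.Build A (restr k M)
  restr_scaleA restr_scale1 restr_scaleDr restr_scaleDl.

End Restriction.

Section RestrictionMul.
Variables (A B : comPzRingType) (k : {rmorphism A -> B}) (M : lmodType B).

Definition restr_mul (b : B) (m : restr k M) : restr k M := b *: (m : M).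

Fact restr_mul_linear b : linear (restr_mul b).
Proof.
move=> a m m'; transitivity (b *: (k a *: (m : M) + m') : M) => //.
by rewrite scalerDr scalerA mulrC -scalerA.
Qed.

HB.instance Definition _ b := GRing.isLinear.Build A (restr k M) (restr k M)
  *:%R (restr_mul b) (restr_mul_linear b).

End RestrictionMul.

Section BaseChange.
Variables (S R S' : comPzRingType).
Variables (h : {rmorphism S -> R}) (g : {rmorphism S -> S'}).

(* bc_mod M N is M (x)_S N, which is a module over R (x)_S S', written bc_ring, *)
(* through (r (x) u)(m (x) n) = rm (x) un; the product of bc_ring is the case  *)
(* M = R, N = S'.                                                             *)
Definition bc_mod (M : lmodType R) (N : lmodType S') : Type :=
  tens (restr h M) (restr g N).

HB.instance Definition _ M N := GRing.Zmodule.on (bc_mod M N).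

Definition bc_ring : Type := bc_mod R^o S'^o.

HB.instance Definition _ := GRing.Zmodule.on bc_ring.

Definition bc_pure (M : lmodType R) (N : lmodType S') (m : M) (n : N) :
  bc_mod M N := (m : restr h M) \ox (n : restr g N).

Section Scale.
Variables (M : lmodType R) (N : lmodType S').

Lemma bc_ind (P : bc_mod M N -> Prop) :
  P 0 -> (forall m n, P (bc_pure m n)) ->
  (forall x y, P x -> P y -> P (x + y)) -> forall t, P t.
Proof. exact: (@tens_ind _ (restr h M) (restr g N) P). Qed.

Lemma bc_pureDl m m' n : bc_pure (m + m') n = bc_pure m n + bc_pure m' n :> bc_mod M N.
Proof. exact: tpureDl. Qed.

Lemma bc_pureDr m n n' : bc_pure m (n + n') = bc_pure m n + bc_pure m n' :> bc_mod M N.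
Proof. exact: tpureDr. Qed.

Lemma bc_pureZ a m n : bc_pure (h a *: m) n = bc_pure m (g a *: n) :> bc_mod M N.
Proof. exact: (@tpureZ _ (restr h M) (restr g N)). Qed.

Definition bc_scale_fun (x : bc_mod M N) (r : R) (u : S') : bc_mod M N :=
  tens_map (@restr_mul _ _ h M r : {linear restr h M -> restr h M})
    (@restr_mul _ _ g N u : {linear restr g N -> restr g N}) x.

Lemma bc_scale_funE r u m n :
  bc_scale_fun (bc_pure m n) r u = bc_pure (r *: m) (u *: n).
Proof. exact: tens_mapE. Qed.

Lemma bc_scale_fun0 r u : bc_scale_fun 0 r u = 0.
Proof. exact: (raddf0 (tens_map _ _)). Qed.

Lemma bc_scale_funD r u x y :
  bc_scale_fun (x + y) r u = bc_scale_fun x r u + bc_scale_fun y r u.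
Proof. exact: (raddfD (tens_map _ _)). Qed.

Fact bc_scale_balancedDl x r r' u :
  bc_scale_fun x (r + r') u = bc_scale_fun x r u + bc_scale_fun x r' u.
Proof.
elim/bc_ind: x => [|m n|x y IHx IHy]; rewrite ?bc_scale_fun0 ?addr0 //.
  by rewrite !bc_scale_funE scalerDl bc_pureDl.
by rewrite !bc_scale_funD IHx IHy addrACA.
Qed.

Fact bc_scale_balancedDr x r u u' :
  bc_scale_fun x r (u + u') = bc_scale_fun x r u + bc_scale_fun x r u'.
Proof.
elim/bc_ind: x => [|m n|x y IHx IHy]; rewrite ?bc_scale_fun0 ?addr0 //.
  by rewrite !bc_scale_funE scalerDl bc_pureDr.
by rewrite !bc_scale_funD IHx IHy addrACA.
Qed.

Fact bc_scale_balancedZ x (a : S) (r : restr h R^o) (u : restr g S'^o) :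
  bc_scale_fun x (a *: r) u = bc_scale_fun x r (a *: u).
Proof.
elim/bc_ind: x => [|m n|x y IHx IHy]; rewrite ?bc_scale_fun0 //.
  rewrite -[a *: r]/(h a * r) -[a *: u]/(g a * u).
  by rewrite !bc_scale_funE -!scalerA bc_pureZ.
by rewrite !bc_scale_funD IHx IHy.
Qed.

Definition bc_scale_bal (x : bc_mod M N) :
  balanced_map (restr h R^o) (restr g S'^o) (bc_mod M N) :=
  @BalancedMap S (restr h R^o) (restr g S'^o) (bc_mod M N) (bc_scale_fun x)
    (bc_scale_balancedDl x) (bc_scale_balancedDr x) (bc_scale_balancedZ x).

End Scale.
End BaseChange.

HB.lock Definition bc_scale (S R S' : comPzRingType) (h : {rmorphism S -> R})
    (g : {rmorphism S -> S'}) (M : lmodType R) (N : lmodType S')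
    (t : bc_ring h g) (x : bc_mod h g M N) : bc_mod h g M N :=
  tens_lift (bc_scale_bal x) t.

Section BaseChangeTheory.
Variables (S R S' : comPzRingType).
Variables (h : {rmorphism S -> R}) (g : {rmorphism S -> S'}).
Local Notation bc_mod := (bc_mod h g).
Local Notation bc_ring := (bc_ring h g).
Local Notation "r :x: u" := (bc_pure h g (r : R^o) (u : S'^o) : bc_ring)
  (at level 40).

Section Scale.
Variables (M : lmodType R) (N : lmodType S').
Local Notation bc_scale := (@bc_scale S R S' h g M N).
Implicit Types (m : M) (n : N) (x : bc_mod M N) (s t : bc_ring).

Lemma bc_scale_fun_pure r u x :
  bc_scale (r :x: u) x = bc_scale_fun x r u.
Proof. by rewrite bc_scale.unlock; exact: tens_liftE. Qed.

Lemma bc_scaleE r u m n :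
  bc_scale (r :x: u) (bc_pure h g m n)
  = bc_pure h g (r *: m) (u *: n).
Proof. by rewrite bc_scale_fun_pure bc_scale_funE. Qed.

Lemma bc_scale0l x : bc_scale 0 x = 0.
Proof. by rewrite bc_scale.unlock; exact: raddf0. Qed.

Lemma bc_scaleDl x : {morph bc_scale^~ x : s t / s + t}.
Proof. by rewrite bc_scale.unlock; exact: raddfD. Qed.

Lemma bc_ring_ind (P : bc_ring -> Prop) :
  P 0 -> (forall r u, P (r :x: u)) ->
  (forall s t, P s -> P t -> P (s + t)) -> forall t, P t.
Proof. exact: (@tens_ind _ (restr h R^o) (restr g S'^o) P). Qed.

Lemma bc_scale0r t : bc_scale t 0 = 0.
Proof.
elim/bc_ring_ind: t => [|r u|s t IHs IHt].
- exact: bc_scale0l.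
- by rewrite bc_scale_fun_pure bc_scale_fun0.
- by rewrite bc_scaleDl IHs IHt addr0.
Qed.

Lemma bc_scaleDr : right_distributive bc_scale +%R.
Proof.
elim/bc_ring_ind => [|r u|s t IHs IHt] x y.
- by rewrite !bc_scale0l addr0.
- by rewrite !bc_scale_fun_pure bc_scale_funD.
- by rewrite !bc_scaleDl IHs IHt addrACA.
Qed.

Lemma bc_scale1 : left_id (1 :x: 1) bc_scale.
Proof.
elim/bc_ind => [|m n|x y IHx IHy].
- exact: bc_scale0r.
- by rewrite bc_scaleE !scale1r.
- by rewrite bc_scaleDr IHx IHy.
Qed.

End Scale.

Definition bc_one : bc_ring := 1 :x: 1.
Definition bc_mul (s t : bc_ring) : bc_ring := @bc_scale S R S' h g R^o S'^o s t.

Lemma bc_mulE r u r' u' :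
  bc_mul (r :x: u) (r' :x: u')
  = (r * r') :x: (u * u').
Proof. exact: bc_scaleE. Qed.

Lemma bc_mul0l t : bc_mul 0 t = 0.
Proof. exact: bc_scale0l. Qed.

Lemma bc_mul0r t : bc_mul t 0 = 0.
Proof. exact: bc_scale0r. Qed.

Fact bc_mulDl : left_distributive bc_mul +%R.
Proof. by move=> s t x; exact: bc_scaleDl. Qed.

Fact bc_mulDr : right_distributive bc_mul +%R.
Proof. by move=> s t x; exact: bc_scaleDr. Qed.

Lemma bc_scaleA (M : lmodType R) (N : lmodType S') (s t : bc_ring)
    (x : bc_mod M N) :
  bc_scale s (bc_scale t x) = bc_scale (bc_mul s t) x.
Proof.
elim/bc_ring_ind: s => [|r u|s s' IHs IHs'].
- by rewrite bc_scale0l bc_mul0l bc_scale0l.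
- elim/bc_ring_ind: t => [|r' u'|t t' IHt IHt'].
  + by rewrite bc_scale0l bc_scale0r bc_mul0r bc_scale0l.
  + elim/bc_ind: x => [|m n|x y IHx IHy].
    * by rewrite !bc_scale0r.
    * by rewrite bc_mulE !bc_scaleE !scalerA.
    * by rewrite !bc_scaleDr IHx IHy.
  + by rewrite bc_scaleDl bc_scaleDr bc_mulDr bc_scaleDl IHt IHt'.
- by rewrite bc_scaleDl bc_mulDl bc_scaleDl IHs IHs'.
Qed.

Fact bc_mulA : associative bc_mul.
Proof. by move=> s t x; exact: bc_scaleA. Qed.

Fact bc_mulC : commutative bc_mul.
Proof.
move=> s t; elim/bc_ring_ind: s => [|r u|s s' IHs IHs'].
- by rewrite bc_mul0l bc_mul0r.
- elim/bc_ring_ind: t => [|r' u'|t t' IHt IHt'].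
  + by rewrite bc_mul0l bc_mul0r.
  + by rewrite !bc_mulE [r * _]mulrC [u * _]mulrC.
  + by rewrite bc_mulDl bc_mulDr IHt IHt'.
- by rewrite bc_mulDl bc_mulDr IHs IHs'.
Qed.

Fact bc_mul1 : left_id bc_one bc_mul.
Proof. exact: bc_scale1. Qed.

HB.instance Definition _ := GRing.Zmodule_isComPzRing.Build bc_ring
  bc_mulA bc_mulC bc_mul1 bc_mulDl.

HB.instance Definition _ (M : lmodType R) (N : lmodType S') :=
  GRing.Zmodule_isLmodule.Build bc_ring (bc_mod M N)
    (@bc_scaleA M N) (@bc_scale1 M N) (@bc_scaleDr M N) (@bc_scaleDl M N).

Lemma bc_pureZZ (M : lmodType R) (N : lmodType S') r u (m : M) (n : N) :
  (r :x: u) *: bc_pure h g m n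
  = bc_pure h g (r *: m) (u *: n).
Proof. exact: bc_scaleE. Qed.

Definition bc_inl_fun (r : R) : bc_ring := r :x: 1.
Definition bc_inr_fun (u : S') : bc_ring := 1 :x: u.

Fact bc_inl_additive : zmod_morphism bc_inl_fun.
Proof.
move=> r r'; apply: (addIr (bc_inl_fun r')).
by rewrite addrNK -[LHS]bc_pureDl subrK.
Qed.

Fact bc_inl_multiplicative : monoid_morphism bc_inl_fun.
Proof.
by split=> // r r'; rewrite -[RHS]/(bc_mul _ _) bc_mulE mulr1.
Qed.

HB.instance Definition _ :=
  GRing.isZmodMorphism.Build R bc_ring bc_inl_fun bc_inl_additive.
HB.instance Definition _ :=
  GRing.isMonoidMorphism.Build R bc_ring bc_inl_fun bc_inl_multiplicative.

Fact bc_inr_additive : zmod_morphism bc_inr_fun.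
Proof.
move=> u u'; apply: (addIr (bc_inr_fun u')).
by rewrite addrNK -[LHS]bc_pureDr subrK.
Qed.

Fact bc_inr_multiplicative : monoid_morphism bc_inr_fun.
Proof.
by split=> // u u'; rewrite -[RHS]/(bc_mul _ _) bc_mulE mulr1.
Qed.

HB.instance Definition _ :=
  GRing.isZmodMorphism.Build S' bc_ring bc_inr_fun bc_inr_additive.
HB.instance Definition _ :=
  GRing.isMonoidMorphism.Build S' bc_ring bc_inr_fun bc_inr_multiplicative.

(* r |-> r (x) 1 and u |-> 1 (x) u; the latter is the base change h (x)_S S'. *)
Definition bc_inl : {rmorphism R -> bc_ring} := bc_inl_fun.
Definition bc_inr : {rmorphism S' -> bc_ring} := bc_inr_fun.

Lemma bc_inl_inr (s : S) : bc_inl (h s) = bc_inr (g s).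
Proof.
rewrite /bc_inl /bc_inr /= /bc_inl_fun /bc_inr_fun -[h s]mulr1 -[g s]mulr1.
exact: (@bc_pureZ _ _ _ h g R^o S'^o s 1 1).
Qed.

Lemma bc_pureE (r : R) (u : S') : r :x: u = bc_inr u * bc_inl r.
Proof. by rewrite -[RHS]/(bc_mul _ _) bc_mulE mul1r mulr1. Qed.

End BaseChangeTheory.

Section ExtendScalars.
Variables (A B : comPzRingType) (k : {rmorphism A -> B}) (N : lmodType A).

(* B (x)_A N as a B-module. *)
Definition extend : Type := tens (restr k B^o) N.

HB.instance Definition _ := GRing.Zmodule.on extend.

Definition extend_pure (b : B) (n : N) : extend := (b : restr k B^o) \ox n.

Lemma extend_ind (P : extend -> Prop) :
  P 0 -> (forall b n, P (extend_pure b n)) ->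
  (forall x y, P x -> P y -> P (x + y)) -> forall x, P x.
Proof. exact: (@tens_ind _ (restr k B^o) N P). Qed.

Lemma extend_pureDl b b' n :
  extend_pure (b + b') n = extend_pure b n + extend_pure b' n.
Proof. exact: tpureDl. Qed.

Lemma extend_pureDr b n n' :
  extend_pure b (n + n') = extend_pure b n + extend_pure b n'.
Proof. exact: tpureDr. Qed.

Lemma extend_pureZ a b n : extend_pure (k a * b) n = extend_pure b (a *: n).
Proof. exact: (@tpureZ _ (restr k B^o) N). Qed.

Definition extend_scale (b : B) : extend -> extend :=
  tens_map (@restr_mul _ _ k B^o b : {linear restr k B^o -> restr k B^o})
    (idfun : {linear N -> N}).

Lemma extend_scaleE b b' n :
  extend_scale b (extend_pure b' n) = extend_pure (b * b') n.
Proof. exact: tens_mapE. Qed.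

Lemma extend_scale0 b : extend_scale b 0 = 0.
Proof. exact: (raddf0 (tens_map _ _)). Qed.

Fact extend_scaleDr : right_distributive extend_scale +%R.
Proof. by move=> b; exact: (raddfD (tens_map _ _)). Qed.

Fact extend_scaleA b b' x :
  extend_scale b (extend_scale b' x) = extend_scale (b * b') x.
Proof.
elim/extend_ind: x => [|c n|x y IHx IHy]; first by rewrite !extend_scale0.
  by rewrite !extend_scaleE mulrA.
by rewrite !extend_scaleDr IHx IHy.
Qed.

Fact extend_scale1 : left_id 1 extend_scale.
Proof.
elim/extend_ind => [|c n|x y IHx IHy]; first by rewrite extend_scale0.
  by rewrite extend_scaleE mul1r.
by rewrite extend_scaleDr IHx IHy.
Qed.

Fact extend_scaleDl x : {morph extend_scale^~ x : b b' / b + b'}.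
Proof.
move=> b b'; elim/extend_ind: x => [|c n|x y IHx IHy].
- by rewrite !extend_scale0 addr0.
- by rewrite !extend_scaleE mulrDl extend_pureDl.
- by rewrite !extend_scaleDr IHx IHy addrACA.
Qed.

HB.instance Definition _ := GRing.Zmodule_isLmodule.Build B extend
  extend_scaleA extend_scale1 extend_scaleDr extend_scaleDl.

End ExtendScalars.

(* bc_map sends xi (x) u to m (x) a |-> (xi(m) (x) 1) (x) au, an element of    *)
(* R' (x)_S' I; this is xi(m) (x) au under R' (x)_S' I = R (x)_S I. It is      *)
(* determined by these values, see bc_mapE.                                   *)
Section BaseChangeMap.
Variables (S R S' : comPzRingType).
Variables (h : {rmorphism S -> R}) (g : {rmorphism S -> S'}).
Variables (M : lmodType R) (I : lmodType S').
Local Notation R' := (bc_ring h g).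
Local Notation M' := (bc_mod h g M S'^o).
Local Notation RI := (extend (bc_inr h g) I).

Section Pure.
Variables (xi : {linear M -> R^o}) (u : I).

Definition bc_hom_fun (m : M) (a : S') : RI :=
  extend_pure (bc_inr h g) (bc_inl h g (xi m)) (a *: u).

Fact bc_hom_funDl m m' a :
  bc_hom_fun (m + m') a = bc_hom_fun m a + bc_hom_fun m' a.
Proof. by rewrite /bc_hom_fun linearD raddfD extend_pureDl. Qed.

Fact bc_hom_funDr m a a' :
  bc_hom_fun m (a + a') = bc_hom_fun m a + bc_hom_fun m a'.
Proof. by rewrite /bc_hom_fun scalerDl extend_pureDr. Qed.

Lemma bc_inlZ r m : bc_inl h g (xi (r *: m)) = bc_inl h g r * bc_inl h g (xi m).
Proof. by rewrite linearZ; exact: (rmorphM (bc_inl h g)). Qed.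

Fact bc_hom_funZ (s : S) (m : restr h M) (a : restr g S'^o) :
  bc_hom_fun (s *: m) a = bc_hom_fun m (s *: a).
Proof.
rewrite -[s *: m]/(h s *: (m : M)) -[s *: a]/(g s * (a : S')).
rewrite /bc_hom_fun bc_inlZ bc_inl_inr extend_pureZ.
by rewrite scalerA.
Qed.

Definition bc_hom : M' -> RI :=
  tens_lift (@BalancedMap S (restr h M) (restr g S'^o) RI bc_hom_fun
    bc_hom_funDl bc_hom_funDr bc_hom_funZ).

Lemma bc_homE m a : bc_hom (bc_pure h g m (a : S'^o)) = bc_hom_fun m a.
Proof. exact: tens_liftE. Qed.

Lemma bc_homD x y : bc_hom (x + y) = bc_hom x + bc_hom y.
Proof. exact: (raddfD (tens_lift _)). Qed.

Lemma bc_hom0 : bc_hom 0 = 0.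
Proof. exact: (raddf0 (tens_lift _)). Qed.

Lemma bc_homZ (t : R') x : bc_hom (t *: x) = t *: bc_hom x.
Proof.
elim/bc_ind: x => [|m a|x y IHx IHy].
- by rewrite !(bc_hom0, scaler0).
- elim/bc_ring_ind: t => [|r b|s t IHs IHt].
  + by rewrite !scale0r bc_hom0.
  + rewrite bc_pureZZ !bc_homE /bc_hom_fun bc_inlZ.
    rewrite -[RHS]/(extend_scale _ _) extend_scaleE bc_pureE.
    by rewrite -mulrA extend_pureZ scalerA.
  + by rewrite !scalerDl bc_homD IHs IHt.
- by rewrite !(bc_homD, scalerDr) IHx IHy.
Qed.

Fact bc_hom_linear : linear bc_hom.
Proof. by move=> t x y; rewrite bc_homD bc_homZ. Qed.

HB.instance Definition _ :=
  GRing.isLinear.Build R' M' RI *:%R bc_hom bc_hom_linear.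

End Pure.

Lemma bc_hom_ext (f f' : {linear M' -> RI}) :
  (forall m (a : S'), f (bc_pure h g m (a : S'^o)) = f' (bc_pure h g m (a : S'^o))) ->
  f = f'.
Proof.
move=> ff'; apply: linear_ext; elim/bc_ind => [|m a|x y IHx IHy].
- by rewrite !linear0.
- exact: ff'.
- by rewrite !linearD IHx IHy.
Qed.

Definition bc_map_fun (xi : dual M) (u : I) : {linear M' -> RI} := bc_hom xi u.

Lemma bc_map_funE xi u m (a : S') :
  bc_map_fun xi u (bc_pure h g m (a : S'^o))
  = extend_pure (bc_inr h g) (bc_inl h g ((xi : {linear M -> R^o}) m)) (a *: u).
Proof. exact: bc_homE. Qed.

Fact bc_map_funDl xi xi' u :
  bc_map_fun (xi + xi') u = bc_map_fun xi u + bc_map_fun xi' u.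
Proof.
apply: bc_hom_ext => m a; rewrite -[RHS]/(bc_map_fun xi u _ + bc_map_fun xi' u _).
by rewrite !bc_map_funE -extend_pureDl -raddfD.
Qed.

Fact bc_map_funDr xi u u' :
  bc_map_fun xi (u + u') = bc_map_fun xi u + bc_map_fun xi u'.
Proof.
apply: bc_hom_ext => m a; rewrite -[RHS]/(bc_map_fun xi u _ + bc_map_fun xi u' _).
by rewrite !bc_map_funE -extend_pureDr -scalerDr.
Qed.

Fact bc_map_funZ (s : S) (xi : restr h (dual M)) (u : restr g I) :
  bc_map_fun (s *: xi) u = bc_map_fun xi (s *: u).
Proof.
apply: bc_hom_ext => m a; rewrite !bc_map_funE.
rewrite -[s *: u]/(g s *: (u : I)) [in RHS]scalerA [a * _]mulrC -[in RHS]scalerA.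
by rewrite -[in RHS]extend_pureZ -bc_inl_inr -rmorphM.
Qed.

Definition bc_map : bc_mod h g (dual M) I -> {linear M' -> RI} :=
  tens_lift (@BalancedMap S (restr h (dual M)) (restr g I) {linear M' -> RI}
    bc_map_fun bc_map_funDl bc_map_funDr bc_map_funZ).

Lemma bc_mapE xi u m (a : S') :
  bc_map (bc_pure h g xi u) (bc_pure h g m (a : S'^o))
  = extend_pure (bc_inr h g) (bc_inl h g ((xi : {linear M -> R^o}) m)) (a *: u).
Proof. by rewrite -bc_map_funE /bc_map tens_liftE. Qed.

Lemma bc_mapD x y : bc_map (x + y) = bc_map x + bc_map y.
Proof. exact: (raddfD (tens_lift _)). Qed.

Lemma bc_map0 : bc_map 0 = 0.
Proof. exact: (raddf0 (tens_lift _)). Qed.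

Fact bc_map_linear : linear bc_map.
Proof.
move=> t x y; rewrite bc_mapD; congr (_ + _).
elim/bc_ind: x => [|xi u|x x' IHx IHx'].
- by rewrite !(bc_map0, scaler0).
- elim/bc_ring_ind: t => [|r b|s t IHs IHt].
  + by rewrite !scale0r bc_map0.
  + apply: bc_hom_ext => m a; rewrite bc_pureZZ.
    rewrite -[RHS]/(_ *: bc_map _ _) !bc_mapE.
    rewrite -[RHS]/(extend_scale _ _) extend_scaleE bc_pureE -mulrA extend_pureZ.
    by rewrite -rmorphM !scalerA mulrC.
  + by rewrite !scalerDl bc_mapD IHs IHt.
- by rewrite !(bc_mapD, scalerDr) IHx IHx'.
Qed.

HB.instance Definition _ := GRing.isLinear.Build R' (bc_mod h g (dual M) I)
  {linear M' -> RI} *:%R bc_map bc_map_linear.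

End BaseChangeMap.

Arguments bc_map {S R S'} h g M I.

Section Ext.
Variable A : comPzRingType.

(* The standard free resolution of M: its n-th term is the free module on the *)
(* underlying set of the n-th syzygy, syzygy n.+1 being the kernel of the map *)
(* from that free module onto syzygy n. Ext is the cohomology of Hom(-, N).   *)
Definition free_cover (M : lmodType A) : {linear freemod A M -> M} :=
  freemod_lift (fun m : M => m).

Fixpoint syzygy (M : lmodType A) (n : nat) : lmodType A :=
  if n is m.+1 then submod (ker (free_cover (syzygy M m))) else M.

Definition resolution (M : lmodType A) (n : nat) : lmodType A :=
  freemod A (syzygy M n).

Definition resolution_diff (M : lmodType A) (n : nat) :
    {linear resolution M n.+1 -> resolution M n} :=
  (\val : {linear submod (ker (free_cover (syzygy M n))) -> resolution M n})
    \o free_cover (syzygy M n.+1).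

Section Precomp.
Variables (U V N : lmodType A) (d : {linear U -> V}).

Definition precomp_fun (f : {linear V -> N}) : {linear U -> N} := f \o d.

Fact precomp_linear : linear precomp_fun.
Proof. by move=> a f g; apply: linear_ext. Qed.

HB.instance Definition _ := GRing.isLinear.Build A
  {linear V -> N} {linear U -> N} *:%R precomp_fun precomp_linear.

Definition precomp : {linear {linear V -> N} -> {linear U -> N}} := precomp_fun.

End Precomp.

Variables M N : lmodType A.

Definition cochain (n : nat) : lmodType A := {linear resolution M n -> N}.

Definition cochain_diff (n : nat) : {linear cochain n -> cochain n.+1} :=
  precomp N (resolution_diff M n).

Definition cocycles (n : nat) : submodule (cochain n) := ker (cochain_diff n).

Definition coboundary_pred (n : nat) : {pred submod (cocycles n)} :=
  match n with
  | 0 => [pred z | \val z == 0]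
  | m.+1 => [pred z | `[< exists f : cochain m, cochain_diff m f = \val z >]]
  end.

Fact coboundary_closed n : submod_closed (@coboundary_pred n).
Proof.
case: n => [|n]; rewrite /coboundary_pred; split=> [|a x y]; rewrite !inE.
- by rewrite linear0.
- by move=> /eqP x0 /eqP y0; rewrite linearP /= x0 y0 scaler0 addr0.
- by apply/asboolP; exists 0; rewrite !linear0.
- move=> /asboolP[f fx] /asboolP[f' fy]; apply/asboolP.
  by exists (a *: f + f'); rewrite !linearP /= fx fy.
Qed.

Definition coboundaries (n : nat) : submodule (submod (cocycles n)) :=
  Submodule (@coboundary_closed n).

Definition Ext (n : nat) : lmodType A := quotmod (coboundaries n).

End Ext.

Definition zero_module (A : comPzRingType) (M : lmodType A) :=
  forall x : M, x = 0.

Definition stably_reflexive (A : comPzRingType) (n : nat) (M : lmodType A) :=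
  reflexive_module M /\
  forall i, (0 < i < n)%N ->
    zero_module (Ext M A^o i) /\ zero_module (Ext (dual M) A^o i).

Section QuotientRing.
Variables (A : comPzRingType) (J : submodule (A^o : lmodType A)).

Definition quot_ring : Type := quotmod J.

HB.instance Definition _ := GRing.Zmodule.on quot_ring.

Definition quot_ring_proj_fun (a : A) : quot_ring := quot_proj J a.

Definition quot_ring_mul (x y : quot_ring) : quot_ring :=
  quot_proj J ((zrepr (x : zquot (submodule_pred J)) : A)
    * (zrepr (y : zquot (submodule_pred J)) : A)).

Lemma quot_ring_projP x : exists a, x = quot_ring_proj_fun a.
Proof. exact: (@quot_projP A A^o J x). Qed.

Lemma quot_ring_mulE a b :
  quot_ring_mul (quot_ring_proj_fun a) (quot_ring_proj_fun b)
  = quot_ring_proj_fun (a * b).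
Proof.
have projP c : (zrepr (quot_ring_proj_fun c : zquot _) : A) - c \in J.
  by apply/quot_proj_eqP; rewrite /quot_proj zreprK.
apply/quot_proj_eqP.
set a' := zrepr _; set b' := zrepr _.
have -> : a' * b' - a * b = (a' : A) *: (b' - b : A^o) + (b : A) *: (a' - a : A^o).
  by rewrite -[RHS]/(a' * (b' - b) + b * (a' - a)) !mulrBr addrA [b * a']mulrC
    addrNK [b * a]mulrC.
by apply: rpredD; apply: rpredZ; exact: projP.
Qed.

Fact quot_ring_mulA : associative quot_ring_mul.
Proof.
move=> x y z; have [a ->] := quot_ring_projP x; have [b ->] := quot_ring_projP y.
by have [c ->] := quot_ring_projP z; rewrite !quot_ring_mulE mulrA.
Qed.

Fact quot_ring_mulC : commutative quot_ring_mul.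
Proof.
move=> x y; have [a ->] := quot_ring_projP x; have [b ->] := quot_ring_projP y.
by rewrite !quot_ring_mulE mulrC.
Qed.

Fact quot_ring_mul1 : left_id (quot_ring_proj_fun 1) quot_ring_mul.
Proof.
by move=> x; have [a ->] := quot_ring_projP x; rewrite quot_ring_mulE mul1r.
Qed.

Lemma quot_ring_projD a b : quot_ring_proj_fun (a + b) =
  quot_ring_proj_fun a + quot_ring_proj_fun b.
Proof. exact: (@quot_projD A A^o J). Qed.

Fact quot_ring_mulDl : left_distributive quot_ring_mul +%R.
Proof.
move=> x y z; have [a ->] := quot_ring_projP x; have [b ->] := quot_ring_projP y.
have [c ->] := quot_ring_projP z.
by rewrite -quot_ring_projD !quot_ring_mulE mulrDl quot_ring_projD.
Qed.

HB.instance Definition _ := GRing.Zmodule_isComPzRing.Build quot_ring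
  quot_ring_mulA quot_ring_mulC quot_ring_mul1 quot_ring_mulDl.

Fact quot_ring_proj_additive : zmod_morphism quot_ring_proj_fun.
Proof. exact: (raddfB (quot_proj J)). Qed.

Fact quot_ring_proj_multiplicative : monoid_morphism quot_ring_proj_fun.
Proof. by split=> // a b; exact/esym/quot_ring_mulE. Qed.

HB.instance Definition _ := GRing.isZmodMorphism.Build A quot_ring
  quot_ring_proj_fun quot_ring_proj_additive.
HB.instance Definition _ := GRing.isMonoidMorphism.Build A quot_ring
  quot_ring_proj_fun quot_ring_proj_multiplicative.

Definition quot_ring_proj : {rmorphism A -> quot_ring} := quot_ring_proj_fun.

Lemma quot_ring_proj_eq0 a : quot_ring_proj a = 0 <-> a \in J.
Proof.
rewrite -(rmorph0 quot_ring_proj); rewrite -{2}[a]subr0; exact: (@quot_proj_eqP A A^o J).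
Qed.

End QuotientRing.

Record spec (A : comPzRingType) := Spec {
  prime_of : submodule (A^o : lmodType A);
  prime_proper : (1 : A) \notin prime_of;
  prime_mem : forall a b : A,
    a * b \in prime_of -> a \in prime_of \/ b \in prime_of }.

Definition zariski_closed (A : comPzRingType) (Z : set (spec A)) :=
  exists E : set A, Z = [set p | E `<=` [set a | a \in prime_of p]]%classic.

Definition closed_point (A : comPzRingType) (p : spec A) :=
  zariski_closed [set p]%classic.

Section SpecMap.
Variables (A B : comPzRingType) (k : {rmorphism A -> B}) (q : spec B).

Definition comap_pred : {pred A^o} := [pred a : A | k a \in prime_of q].

Fact comap_closed : submod_closed comap_pred.
Proof.
have [q0 qD] := submoduleP (prime_of q).
split=> [|a x y]; rewrite !inE; first by rewrite rmorph0.
by move=> xq yq; rewrite rmorphD rmorphM; exact: qD.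
Qed.

Fact comap_proper : (1 : A) \notin comap_pred.
Proof. by rewrite inE rmorph1 prime_proper. Qed.

Fact comap_prime (a b : A) :
  a * b \in comap_pred -> a \in comap_pred \/ b \in comap_pred.
Proof. by rewrite !inE rmorphM; exact: prime_mem. Qed.

Definition spec_map : spec A :=
  @Spec A (Submodule comap_closed) comap_proper comap_prime.

End SpecMap.

Section ResidueField.
Variables (A : comPzRingType) (p : spec A).

Definition residue_domain : Type := quot_ring (prime_of p).

HB.instance Definition _ := GRing.ComPzRing.on residue_domain.

Fact residue_domain_nonzero : 1 != 0 :> residue_domain.
Proof.
apply/negP => /eqP e; move: (prime_proper p) => /negP; apply.
by apply/quot_ring_proj_eq0; rewrite -[RHS]e; exact: rmorph1.
Qed.

HB.instance Definition _ :=
  GRing.PzSemiRing_isNonZero.Build residue_domain residue_domain_nonzero.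

Definition residue_domain_unit : {pred residue_domain} :=
  [pred x | `[< exists y : residue_domain, y * x == 1 >]].

Definition residue_domain_inv (x : residue_domain) : residue_domain :=
  if pselect (exists y : residue_domain, y * x == 1) is left e then xchoose e
  else x.

Fact residue_domain_mulVx :
  {in residue_domain_unit, left_inverse 1 residue_domain_inv *%R}.
Proof.
move=> x; rewrite inE => /asboolP xU; rewrite /residue_domain_inv.
by case: pselect => // e; apply/eqP/(xchooseP e).
Qed.

Fact residue_domain_unitPl (x y : residue_domain) :
  y * x = 1 -> residue_domain_unit x.
Proof. by move=> yx; apply/asboolP; exists y; apply/eqP. Qed.

Fact residue_domain_invr_out :
  {in [predC residue_domain_unit], residue_domain_inv =1 id}.
Proof.
move=> x; rewrite inE /= inE => /asboolP xU; rewrite /residue_domain_inv.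
by case: pselect.
Qed.

HB.instance Definition _ :=
  GRing.ComNzRing_hasMulInverse.Build residue_domain
    residue_domain_mulVx residue_domain_unitPl residue_domain_invr_out.

Fact residue_domain_integral : GRing.integral_domain_axiom residue_domain.
Proof.
move=> x y; have [a ->] := quot_ring_projP x; have [b ->] := quot_ring_projP y.
rewrite -[LHS]/(quot_ring_mul _ _) quot_ring_mulE => /quot_ring_proj_eq0.
by move=> /prime_mem[|] /quot_ring_proj_eq0 /eqP ->; rewrite ?orbT.
Qed.

HB.instance Definition _ :=
  GRing.ComUnitRing_isIntegral.Build residue_domain residue_domain_integral.

Definition residue_field : fieldType := {fraction residue_domain}.

Definition residue_map : {rmorphism A -> residue_field} :=
  (@tofrac residue_domain : {rmorphism residue_domain -> {fraction residue_domain}})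
    \o (quot_ring_proj (prime_of p) : {rmorphism A -> residue_domain}).

End ResidueField.

Definition flat_hom (A B : comPzRingType) (k : {rmorphism A -> B}) :=
  flat_module (restr k B^o).

Definition base_change (S R S' : comPzRingType) (h : {rmorphism S -> R})
    (g : {rmorphism S -> S'}) (M : lmodType R) : lmodType (bc_ring h g) :=
  bc_mod h g M S'^o.

(* The notion is only defined for flat h, hence the first clause. *)
Definition stably_reflexive_wrt (S R : comPzRingType) (h : {rmorphism S -> R})
    (n : nat) (M : lmodType R) :=
  [/\ flat_hom h, flat_module (restr h M) &
    forall s : spec S, (spec_map h @` @closed_point R)%classic s ->
      stably_reflexive n (base_change h (residue_map s) M)].

(* Main.v *)
Require Import Defs.
From HB Require Import structures.
From mathcomp Require Import all_boot all_order all_algebra.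
From mathcomp Require Import fraction.
From mathcomp Require Import boolp classical_sets functions.
From mathcomp Require Import finmap monalg.

(* Resolve M and its dual by finite free R-modules (R is coherent) and glue    *)
(* the two resolutions along P_0 -> M -> M^** -> Q_0^*. Stable reflexivity of M  *)
(* over a base change R' of R means precisely that the glued complex and its   *)
(* dual, tensored with R', are exact in a range of degrees. So everything      *)
(* reduces to this: a complex of finite free R-modules that is exact at some   *)
(* spot after base change to k(s), for every s lying under a closed point of   *)
(* Spec R, is exact there after tensoring with any S-module I. By flatness of  *)
(* R and noetherian induction one may take I = S/p with p prime and assume     *)
(* that every a outside p acts surjectively on the cohomology H, a finitely    *)
(* generated R-module. If H were not 0, a maximal ideal of R in the support of *)
(* H would contract to p, and the vanishing of H over k(p) would give an       *)
(* element outside p killing H at that maximal ideal, a contradiction.         *)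
(* Exactness over S spreads from one spot of a flat complex to the preceding   *)
(* one, which gives the universal exactness of the remaining maps.             *)

Set Implicit Arguments.
Unset Strict Implicit.
Unset Printing Implicit Defensive.

Import GRing.Theory.

Local Open Scope ring_scope.

(** A complex of finite free [R]-modules is kept as a list of matrices, so that its exactness makes
    sense with coefficients in any [R]-module ([exact_at]). Let [D] resolve [M], let [E] resolve its
    dual, and let [C] join the two. By [Ext_glued], [Ext_dual_glued] and [reflexive_glued], stable
    reflexivity is exactness of the glued complex and of its transpose in a range of spots
    ([stably_reflexive_glued]). A base change of [M] only changes the coefficients to [R] tensored
    over [S] with an [S]-module. Hence (i) and (iii) follow once these exactness statements hold for
    the coefficients [R] tensored with every [S]-module [I]. The criterion is symmetric under
    [swap], which gives (ii).

    Two tools produce exactness for all [I]. [exact_at_shift_flat] moves it to the preceding spot of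
    a complex that is exact over [R]; for [D] the start is flatness of [M]
    ([exact_at_flat_presented]). [fibrewise_exact] deduces it from the fibres over the images of
    closed points; after a reduction to [I] cyclic with prime annihilator, it rests on
    [cocycle_mem], a form of the Nakayama lemma.

    The order of use is forced. First [D] stays exact by flatness. Then Ext of the fibres of [M] can
    be computed from [D], and the fibre criterion makes the transposes of [D] exact. Since [n > 1],
    this includes the spot next to [C], and shifting from there makes [C] and all of [E] stay exact.
    Only now does [E] resolve the duals of the fibres, so that reflexivity of the fibres and Ext of
    their duals can be read off, and the fibre criterion yields the remaining spots. *)

Lemma inj_surj_bijective (T U : Type) (f : T -> U) :
  injective f -> (forall y, exists x, y = f x) -> bijective f.
Proof.
move=> f_inj f_surj; pose g y := projT1 (cid (f_surj y)).
have gK : cancel g f by move=> y; rewrite /g; case: cid.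
by exists g => // x; apply: f_inj; rewrite gK.
Qed.

Lemma raddf_inj0 (U V : zmodType) (f : {additive U -> V}) :
  (forall x, f x = 0 -> x = 0) -> injective f.
Proof.
move=> f0 x y /eqP; rewrite -subr_eq0 -raddfB => /eqP /f0 /eqP.
by rewrite subr_eq0 => /eqP.
Qed.

Lemma inj_raddf0 (U V : zmodType) (f : {additive U -> V}) x :
  injective f -> f x = 0 -> x = 0.
Proof. by move=> f_inj fx; apply: f_inj; rewrite fx raddf0. Qed.

Definition linear_pack (A : comPzRingType) (U V : lmodType A) (f : U -> V)
    (f_lin : linear f) : {linear U -> V} :=
  HB.pack f (GRing.isLinear.Build A U V *:%R f f_lin).

(** * Matrices acting on families of module elements *)

Section Families.
Variable A : comPzRingType.

Definition delta (m : nat) (j : 'I_m) : 'I_m -> A^o := fun i => (i == j)%:R.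

Section Vectors.
Variable V : lmodType A.

Definition mxact (m k : nat) (D : 'M[A]_(m, k)) (v : 'I_k -> V) : 'I_m -> V :=
  fun i => \sum_j D i j *: v j.

Lemma mxact_is_linear m k (D : 'M[A]_(m, k)) : linear (mxact D).
Proof.
move=> a v w; apply/funext => i; rewrite /mxact.
rewrite -[RHS]/(a *: (\sum_j D i j *: v j) + \sum_j D i j *: w j).
rewrite scaler_sumr -big_split /=; apply: eq_bigr => j _.
by rewrite -[(_ + _) j]/(a *: v j + w j) scalerDr !scalerA mulrC.
Qed.

HB.instance Definition _ m k (D : 'M[A]_(m, k)) :=
  GRing.isLinear.Build A ('I_k -> V) ('I_m -> V) *:%R (mxact D)
    (mxact_is_linear D).

Lemma mxactM m k l (D : 'M[A]_(m, k)) (E : 'M[A]_(k, l)) v :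
  mxact (D *m E) v = mxact D (mxact E v).
Proof.
apply/funext => i; rewrite /mxact.
under eq_bigr do rewrite mxE scaler_suml.
under [RHS]eq_bigr do rewrite scaler_sumr.
rewrite exchange_big; apply: eq_bigr => j _; apply: eq_bigr => k' _.
by rewrite scalerA.
Qed.

Lemma mxact0 m k (v : 'I_k -> V) : mxact (0 : 'M[A]_(m, k)) v = 0.
Proof. by apply/funext => i; rewrite /mxact big1 // => j _; rewrite mxE scale0r. Qed.

Lemma mulmx0_mxact m k l (D : 'M[A]_(m, k)) (E : 'M[A]_(k, l)) v :
  D *m E = 0 -> mxact D (mxact E v) = 0.
Proof. by move=> DE0; rewrite -mxactM DE0 mxact0. Qed.

Definition lincomb (k : nat) (v : 'I_k -> V) (c : 'I_k -> A^o) : V :=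
  \sum_j (c j : A) *: v j.

Lemma lincomb_is_linear k (v : 'I_k -> V) : linear (lincomb v).
Proof.
move=> a c d; rewrite /lincomb scaler_sumr -big_split /=.
by apply: eq_bigr => j _; rewrite scalerA -scalerDl.
Qed.

HB.instance Definition _ k (v : 'I_k -> V) :=
  GRing.isLinear.Build A ('I_k -> A^o) V *:%R (lincomb v)
    (lincomb_is_linear v).

Lemma lincomb_delta k (v : 'I_k -> V) j : lincomb v (delta j) = v j.
Proof.
rewrite /lincomb (bigD1 j) //= /delta eqxx scale1r big1 ?addr0 // => i /negbTE ->.
by rewrite scale0r.
Qed.

(* Only the inclusion of the kernel in the image: that the composite vanishes   *)
(* is always a separate hypothesis.                                           *)
Definition exact_at (m k l : nat) (D : 'M[A]_(m, k)) (E : 'M[A]_(l, m)) :=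
  forall v : 'I_m -> V, mxact E v = 0 -> exists w, v = mxact D w.

End Vectors.

Lemma lincomb_mxact (V : lmodType A) m k (D : 'M[A]_(m, k)) (v : 'I_m -> V) (w : 'I_k -> A^o) :
  lincomb v (mxact D w) = lincomb (mxact D^T v) w.
Proof.
rewrite /lincomb /mxact.
under eq_bigr do rewrite scaler_suml.
under [RHS]eq_bigr do rewrite scaler_sumr.
rewrite exchange_big; apply: eq_bigr => j _; apply: eq_bigr => i _.
by rewrite !mxE scalerA mulrC.
Qed.

Lemma family_delta k (c : 'I_k -> A^o) : c = lincomb (@delta k) c.
Proof.
apply/funext => i; rewrite /lincomb fct_sumE (bigD1 i) //= big1.
  by rewrite addr0 -[RHS]/(c i * (i == i)%:R) eqxx mulr1.
by move=> j ji; rewrite -[LHS]/(c j * (i == j)%:R) eq_sym (negbTE ji) mulr0.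
Qed.

Lemma linear_lincomb k (U V : lmodType A) (f : {linear U -> V}) (v : 'I_k -> U) c :
  f (lincomb v c) = lincomb (f \o v) c.
Proof. by rewrite /lincomb linear_sum; apply: eq_bigr => j _; rewrite linearZ. Qed.

Lemma linear_mxact m k (U V : lmodType A) (f : {linear U -> V})
    (D : 'M[A]_(m, k)) (v : 'I_k -> U) :
  f \o mxact D v = mxact D (f \o v).
Proof.
apply/funext => i; rewrite /mxact /= linear_sum.
by apply: eq_bigr => j _; rewrite linearZ.
Qed.

Lemma free_linear_ext k (V : lmodType A) (f g : {linear ('I_k -> A^o) -> V}) :
  (forall j, f (delta j) = g (delta j)) -> f =1 g.
Proof.
move=> fg c; rewrite [c]family_delta !linear_lincomb.
by apply: eq_bigr => j _ /=; rewrite fg.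
Qed.

Lemma exact_at_iso (U V : lmodType A) (f : {linear U -> V}) m k l
    (D : 'M[A]_(m, k)) (E : 'M[A]_(l, m)) :
  bijective f -> exact_at U D E -> exact_at V D E.
Proof.
move=> [g fK gK] UDE v Ev; have [|w vw] := UDE (g \o v).
  apply/funext => i; apply: (can_inj fK).
  have := linear_mxact f E (g \o v).
  have -> : f \o (g \o v) = v by apply/funext => j /=; exact: gK.
  by rewrite Ev => /(congr1 (fun h => h i)) /= ->; rewrite linear0.
exists (f \o w); rewrite -linear_mxact -vw; apply/funext => j /=.
by rewrite gK.
Qed.

(* The image of D is the whole module of relations between the generators e. *)
Definition presented (N : lmodType A) (p q : nat) (e : 'I_p -> N)
    (D : 'M[A]_(p, q)) :=
  (forall x, exists c, x = lincomb e c) /\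
  (forall c, lincomb e c = 0 <-> exists w, c = mxact D w).

Lemma presented_rel (N : lmodType A) p q (e : 'I_p -> N) (D : 'M[A]_(p, q)) :
  presented e D -> mxact D^T e = 0.
Proof.
move=> [_ rel]; apply/funext => j.
have : lincomb e (mxact D (delta j)) = 0 by apply/rel; exists (delta j).
by rewrite lincomb_mxact lincomb_delta.
Qed.

Lemma presented_ext (N V : lmodType A) p q (e : 'I_p -> N) (D : 'M[A]_(p, q))
    (f g : {linear N -> V}) :
  presented e D -> (forall j, f (e j) = g (e j)) -> f = g.
Proof.
move=> [gen _] fg; apply: linear_ext => x; have [c ->] := gen x.
by rewrite !linear_lincomb; apply: eq_bigr => j _ /=; rewrite fg.
Qed.

(** Universal property of a cokernel: two coefficient vectors of the same element differ by an
    element of the image of [D], on which [v] vanishes. *)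
Lemma presented_hom (N V : lmodType A) p q (e : 'I_p -> N) (D : 'M[A]_(p, q))
    (v : 'I_p -> V) :
  presented e D -> mxact D^T v = 0 ->
  exists f : {linear N -> V}, forall j, f (e j) = v j.
Proof.
move=> [gen rel] Dv.
pose coord x := projT1 (cid (gen x)).
have coordP x : x = lincomb e (coord x) by rewrite /coord; case: cid.
have wd c c' : lincomb e c = lincomb e c' -> lincomb v c = lincomb v c'.
  move=> /eqP; rewrite -subr_eq0 -linearB => /eqP /rel [w cw].
  apply/eqP; rewrite -subr_eq0 -linearB cw /= lincomb_mxact Dv /lincomb big1 //.
  by move=> j _; rewrite -[X in _ *: X]/(0 : V) scaler0.
pose f x := lincomb v (coord x).
have f_lin : linear f.
  move=> a x y; rewrite /f -linearP; apply: wd.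
  by rewrite -coordP [RHS]linearP /= -!coordP.
pose F : {linear N -> V} :=
  HB.pack f (GRing.isLinear.Build A N V *:%R f f_lin).
exists F => j; rewrite -[LHS]/(lincomb v (coord (e j))) -(lincomb_delta v j).
by apply: wd; rewrite -coordP lincomb_delta.
Qed.

End Families.

Arguments exact_at {A} V {m k l} D E.
Arguments delta {A m} j.

(** * Comparison of resolutions *)

(** The type varies with the stage because the components of chain maps and homotopies do. *)
Lemma dependent_choice (T : nat -> Type) (R : forall i, T i -> T i.+1 -> Prop)
    (t0 : T 0%N) :
  (forall i t, exists t', R i t t') ->
  exists t : forall i, T i, t 0%N = t0 /\ forall i, R i (t i) (t i.+1).
Proof.
move=> total; pose next i t := projT1 (cid (total i t)).
exists (nat_rect T t0 next); split=> // i.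
by rewrite /= /next; case: cid.
Qed.

Section Resolutions.
Variable A : comPzRingType.

(** Projectivity phrased elementwise: [f] has values in the image of [p], so [p] can be a
    differential of an exact complex. *)
Definition liftable (P : lmodType A) :=
  forall (U V : lmodType A) (p : {linear U -> V}) (f : {linear P -> V}),
    (forall x, exists u, f x = p u) ->
    exists f' : {linear P -> U}, forall x, f x = p (f' x).

Lemma liftable_free k : liftable ('I_k -> A^o).
Proof.
move=> U V p f fp; pose u j := projT1 (cid (fp (delta j))).
exists (lincomb u : {linear _ -> U}); apply: (free_linear_ext (g := p \o lincomb u)) => j /=.
by rewrite lincomb_delta /u; case: cid.
Qed.

Lemma freemodE (X : choiceType) (g : freemod A X) :
  g = \sum_(k <- msupp g) (g@_k : A) *: (<< 1 *g k >> : freemod A X).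
Proof.
have scaleU c k :
    << c *g k >> = c *: (<< 1 *g k >> : freemod A X) :> freemod A X.
  apply/malgP => l; rewrite [RHS]mcoeff_scale !mcoeffU.
  by case: eqP => _; [exact/esym/mulr1 | exact/esym/mulr0].
by apply: etrans (monalgE g) _; refine (eq_bigr _ (fun k _ => scaleU _ _)).
Qed.

Lemma freemod_linear_ext (X : choiceType) (V : lmodType A)
    (f f' : {linear freemod A X -> V}) :
  (forall k, f << 1 *g k >> = f' << 1 *g k >>) -> f =1 f'.
Proof.
move=> ff' g; rewrite [g]freemodE !linear_sum; apply: eq_bigr => k _.
by rewrite !linearZ /= ff'.
Qed.

Lemma freemod_liftU (X : choiceType) (V : lmodType A) (f : X -> V) x :
  freemod_lift f << 1 *g x >> = f x.
Proof. by rewrite /freemod_lift malg_liftU /= /scale_at scale1r. Qed.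

Lemma liftable_freemod (X : choiceType) : liftable (freemod A X).
Proof.
move=> U V p f fp; pose u (x : X) := projT1 (cid (fp << 1 *g x >>)).
exists (freemod_lift u : {linear freemod A X -> U}).
apply: (freemod_linear_ext (f' := p \o freemod_lift u)) => k /=.
by rewrite freemod_liftU /u; case: cid.
Qed.

(** The resolved module sits in degree 0 and [diff 0] is the augmentation; the projective terms
    start in degree 1. *)
Record diff_seq := DiffSeq {
  term :> nat -> lmodType A;
  diff : forall i, {linear term i.+1 -> term i} }.

Definition is_resolution (Q : diff_seq) :=
  [/\ forall x, exists y, x = diff Q 0 y,
    forall i x, diff Q i x = 0 <-> exists y, x = diff Q i.+1 y &
    forall i, liftable (Q i.+1)].

(** With the module itself in degree 0, index [i] concerns Ext in degree [i + 1]. *)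
Definition cohomology_vanishes (Q : diff_seq) (V : lmodType A) (i : nat) :=
  forall c : {linear Q i.+2 -> V}, (forall x, c (diff Q i.+2 x) = 0) ->
  exists b : {linear Q i.+1 -> V}, forall x, c x = b (diff Q i.+1 x).

Lemma resolution_dd Q :
  is_resolution Q -> forall i x, diff Q i (diff Q i.+1 x) = 0.
Proof. by case=> _ ex _ i x; apply/ex; exists x. Qed.

Lemma chain_map (Q Q' : diff_seq) (phi : {linear Q 0%N -> Q' 0%N}) :
  is_resolution Q -> is_resolution Q' ->
  exists f : forall i, {linear Q i -> Q' i},
    (forall x, f 0%N x = phi x) /\ forall i x, diff Q' i (f i.+1 x) = f i (diff Q i x).
Proof.
move=> resQ [surj' ex' _]; have [_ _ liftQ] := resQ.
(* Carried through the recursion: this is what allows [f] to be lifted one degree further. *)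
pose inv i (f : {linear Q i -> Q' i}) := forall x, exists y, f (diff Q i x) = diff Q' i y.
have inv0 : inv 0%N phi by move=> x; exact: surj'.
have [|f [f0 fS]] := @dependent_choice (fun i => {f | inv i f})
  (fun i f f' => forall x, diff Q' i (sval f' x) = sval f (diff Q i x)) (exist _ phi inv0).
  move=> i [f invf]; have [f' f'P] := liftQ i _ _ (diff Q' i) (f \o diff Q i) invf.
  have invf' : inv i.+1 f'.
    by move=> x; apply/ex'; rewrite -f'P /= (resolution_dd resQ) linear0.
  by exists (exist _ f' invf') => x /=; rewrite -f'P.
by exists (fun i => sval (f i)); split=> // x; rewrite f0.
Qed.

Lemma chain_homotopy (Q : diff_seq) (k : forall i, {linear Q i -> Q i}) :
  is_resolution Q -> (forall x, k 0%N x = x) ->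
  (forall i x, diff Q i (k i.+1 x) = k i (diff Q i x)) ->
  exists s : forall i, {linear Q i -> Q i.+1},
    forall i x, x - k i.+1 x = diff Q i.+1 (s i.+1 x) + s i (diff Q i x).
Proof.
move=> resQ k0 kd; have [_ ex lift] := resQ.
(* [inv] makes [x - k x - s (d x)] a cycle in the next degree, hence liftable through the next
   differential. *)
pose inv i (s : {linear Q i -> Q i.+1}) :=
  forall x, diff Q i x - k i (diff Q i x) = diff Q i (s (diff Q i x)).
have inv0 : inv 0%N (\0 : {linear _ -> _}).
  by move=> x; rewrite k0 subrr /= linear0.
have [|s [_ sS]] := @dependent_choice (fun i => {s | inv i s})
  (fun i s s' => forall x, x - k i.+1 x = diff Q i.+1 (sval s' x) + sval s (diff Q i x))
  (exist _ _ inv0).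
  move=> i [s invs].
  pose f : {linear Q i.+1 -> Q i.+1} := (idfun \- k i.+1) \- (s \o diff Q i).
  have fE x : f x = x - k i.+1 x - s (diff Q i x) by [].
  have [|s' s'P] := lift i _ _ (diff Q i.+1) f.
    by move=> x; apply/ex; rewrite fE !linearB /= kd invs subrr.
  have s'E x : x - k i.+1 x = diff Q i.+1 (s' x) + s (diff Q i x) by rewrite -s'P fE subrK.
  suff invs' : inv i.+1 s' by exists (exist _ s' invs').
  by move=> x; rewrite s'E (resolution_dd resQ) linear0 addr0.
by exists (fun i => sval (s i)).
Qed.

(** Lift [phi] and [psi] to chain maps [f] and [g]. Then [c] is the sum of [c g f], a coboundary
    because [c g] is one on [Q'], and of [c (1 - g f)], a coboundary because [g f] is homotopic to
    the identity. *)
Lemma cohomology_comparison (Q Q' : diff_seq) (phi : {linear Q 0%N -> Q' 0%N})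
    (psi : {linear Q' 0%N -> Q 0%N}) V i :
  is_resolution Q -> is_resolution Q' -> cancel phi psi ->
  cohomology_vanishes Q' V i -> cohomology_vanishes Q V i.
Proof.
move=> resQ resQ' phiK van' c cd.
have [f [f0 fS]] := chain_map phi resQ resQ'.
have [g [g0 gS]] := chain_map psi resQ' resQ.
have [s sP] := @chain_homotopy Q (fun j => g j \o f j) resQ
  (fun x => etrans (g0 _) (etrans (congr1 psi (f0 x)) (phiK x)))
  (fun j x => etrans (gS j _) (congr1 (g j) (fS j x))).
have [|b bP] := van' (c \o g i.+2).
  by move=> x /=; rewrite -gS cd.
exists ((b \o f i.+1) \+ (c \o s i.+1)) => x /=.
have -> : c x = c (g i.+2 (f i.+2 x)) + c (x - g i.+2 (f i.+2 x)).
  by rewrite -linearD subrKC.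
by rewrite -[c (g _ _)]/((c \o g _) _) bP fS sP linearD cd add0r.
Qed.

Definition standard_term (M : lmodType A) (i : nat) : lmodType A :=
  if i is j.+1 then resolution M j else M.

Definition standard_diff (M : lmodType A) (i : nat) :
    {linear standard_term M i.+1 -> standard_term M i} :=
  match i with
  | 0 => free_cover M
  | j.+1 => resolution_diff M j
  end.

Definition standard_seq (M : lmodType A) := DiffSeq (standard_diff M).

Lemma free_coverU (M : lmodType A) (m : M) : free_cover M << 1 *g m >> = m.
Proof. exact: freemod_liftU. Qed.

Lemma standard_resolution (M : lmodType A) : is_resolution (standard_seq M).
Proof.
have cover_ex (N : lmodType A) (x : freemod A N) : free_cover N x = 0 <->
    exists y, x = \val (free_cover (submod (ker (free_cover N))) y).
  split=> [/eqP x0|[y ->]]; last first.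
    exact/eqP/(valP (free_cover (submod (ker (free_cover N))) y)).
  exists << 1 *g Sub x x0 : submod (ker (free_cover N)) >>.
  by rewrite free_coverU SubK.
split=> [x||i]; last exact: liftable_freemod.
  by exists << 1 *g x >>; rewrite /= free_coverU.
move=> [|i] x; first exact: cover_ex.
split=> [/= dx0|[y ->]].
  by apply/cover_ex; apply: val_inj; rewrite linear0.
have y0 : free_cover (syzygy M i.+1) (\val (free_cover (syzygy M i.+2) y)) = 0.
  by apply/cover_ex; exists y.
exact: (congr1 \val y0).
Qed.

Lemma Ext_standardP (M V : lmodType A) i :
  zero_module (Ext M V i.+1) <-> cohomology_vanishes (standard_seq M) V i.
Proof.
split=> [ext0 c cd|van z].
  have cP : c \in ker_pred (cochain_diff M V i.+1).
    by rewrite inE; apply/eqP/linear_ext => x; exact: cd.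
  have /quot_proj_eqP : quot_proj (coboundaries M V i.+1) (Sub c cP)
      = quot_proj _ 0 by rewrite [LHS]ext0 [RHS]ext0.
  rewrite subr0 inE => /asboolP[b]; rewrite SubK => bc.
  by exists b => x; rewrite -bc.
have [c ->] := quot_projP z.
rewrite -[RHS](linear0 (quot_proj (coboundaries M V i.+1))).
apply/quot_proj_eqP; rewrite subr0 inE; apply/asboolP.
have [|b bP] := van (\val c).
  move=> x; have /eqP cP := valP c.
  exact: (congr1 (fun f : {linear _ -> V} => f x) cP).
by exists b; apply: linear_ext => x; rewrite bP.
Qed.

Section Presentation.
Variables (N : lmodType A) (p : nat -> nat) (e : 'I_(p 0%N) -> N).
Variable D : forall i, 'M[A]_(p i, p i.+1).

Definition matrix_term (i : nat) : lmodType A :=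
  if i is j.+1 then 'I_(p j) -> A^o else N.

Definition matrix_diff (i : nat) :
    {linear matrix_term i.+1 -> matrix_term i} :=
  match i with
  | 0 => lincomb e
  | j.+1 => mxact (D j) : {linear ('I_(p j.+1) -> A^o) -> ('I_(p j) -> A^o)}
  end.

Definition matrix_seq := DiffSeq matrix_diff.

Hypothesis N_pres : presented e (D 0%N).
Hypothesis D_ex : forall i, exact_at A^o (D i.+1) (D i).
Hypothesis D_comp : forall i, D i *m D i.+1 = 0.

Lemma matrix_resolution : is_resolution matrix_seq.
Proof.
have [gen rel] := N_pres.
split=> [//||i]; last exact: liftable_free.
move=> [|i] x; first exact: rel.
split=> [/D_ex //|[w ->]]; exact: mulmx0_mxact.
Qed.

(** A cochain on a free module is the family of its values on the basis, and precomposition with [D]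
    acts on such families by the transpose. *)
Lemma Ext_matrixP (V : lmodType A) i :
  zero_module (Ext N V i.+1) <-> exact_at V (D i)^T (D i.+1)^T.
Proof.
have -> : zero_module (Ext N V i.+1) <-> cohomology_vanishes matrix_seq V i.
  rewrite Ext_standardP.
  pose id_N : {linear N -> N} := idfun.
  have resN := standard_resolution N; have resD := matrix_resolution.
  split.
    exact: (@cohomology_comparison matrix_seq (standard_seq N) id_N id_N).
  exact: (@cohomology_comparison (standard_seq N) matrix_seq id_N id_N).
split=> [van v Dv|ex c cd].
  have [|b bP] := van (lincomb v : {linear ('I_(p i.+1) -> A^o) -> V}).
    move=> x /=; rewrite lincomb_mxact Dv /lincomb big1 // => j _.
    exact: scaler0.
  exists (b \o @delta A _); apply/funext => j.
  rewrite -(lincomb_delta v j) [LHS]bP /=.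
  rewrite [X in b X](_ : _ = lincomb (@delta A _) (mxact (D i) (delta j))).
    by rewrite lincomb_mxact linear_lincomb -linear_mxact lincomb_delta.
  exact: family_delta.
pose v : 'I_(p i.+1) -> V := c \o @delta A _.
have cE x : c x = lincomb v x by rewrite {1}[x]family_delta linear_lincomb.
have [|w vw] := ex v.
  apply/funext => j; have := cd (delta j).
  by rewrite /= cE lincomb_mxact lincomb_delta.
exists (lincomb w : {linear ('I_(p i) -> A^o) -> V}) => x.
by rewrite cE vw /= lincomb_mxact.
Qed.

End Presentation.
End Resolutions.

(** * Gluing the resolutions of a module and of its dual *)

Section DualPresentation.
Variables (A : comPzRingType) (N : lmodType A) (p p1 q q1 : nat).
Variables (e : 'I_p -> N) (D : 'M[A]_(p, p1)) (C : 'M[A]_(p, q)).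
Variable E : 'M[A]_(q, q1).
Hypothesis N_pres : presented e D.

Lemma dual_lincomb (c : 'I_q -> dual N) (w : 'I_q -> A^o) :
  (forall l k, (c l : {linear N -> A^o}) (e k) = C k l) ->
  forall k, (lincomb c w : {linear N -> A^o}) (e k) = mxact C w k.
Proof.
move=> cC k; transitivity (lincomb (bidual_eval (e k) \o c) w).
  exact: (linear_lincomb (bidual_eval (e k))).
by apply: eq_bigr => l _; rewrite /= /bidual_fun cC; exact: mulrC.
Qed.

(** The dual of [N] is the kernel of the transpose of [D]. By exactness the columns of [C] generate
    this kernel, with the image of [E] as relations. *)
Lemma presented_dual :
  D^T *m C = 0 -> C *m E = 0 -> exact_at A^o C D^T -> exact_at A^o E C ->
  exists c : 'I_q -> dual N,
    (forall l k, (c l : {linear N -> A^o}) (e k) = C k l) /\ presented c E.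
Proof.
move=> DC CE exC exE.
have c_ex l : exists f : {linear N -> A^o}, forall k, f (e k) = C k l.
  apply: (presented_hom N_pres).
  have -> : (fun k => C k l : A^o) = mxact C (delta l).
    apply/funext => k; rewrite /mxact (bigD1 l) //= /delta eqxx big1.
      by rewrite addr0; exact/esym/mulr1.
    by move=> j /negbTE ->; exact: mulr0.
  exact: mulmx0_mxact.
pose c l : dual N := projT1 (cid (c_ex l)).
have cC l k : (c l : {linear N -> A^o}) (e k) = C k l by rewrite /c; case: cid.
exists c; split=> //; split=> [f|w].
  have [|w fw] := exC ((f : {linear N -> A^o}) \o e).
    rewrite -linear_mxact presented_rel //.
    by apply/funext => j; exact: (linear0 (f : {linear N -> A^o})).
  exists w; apply: (presented_ext N_pres) => k; rewrite (dual_lincomb w cC).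
  exact: (congr1 (fun g => g k) fw).
have -> : lincomb c w = 0 <-> mxact C w = 0.
  split=> [w0|Cw0]; last first.
    by apply: (presented_ext N_pres) => k; rewrite (dual_lincomb w cC) Cw0.
  by apply/funext => k; rewrite -(dual_lincomb w cC) w0.
by split=> [/exE //|[v ->]]; exact: mulmx0_mxact.
Qed.

End DualPresentation.

(* Data of the free resolutions of a module and of its dual, glued into the     *)
(* doubly infinite complex ... D1 -> D0 -> C^T -> E0^T -> E1^T ... whose dual is  *)
(* ... E1 -> E0 -> C -> D0^T -> D1^T ... .                                        *)
Record glued (A : comPzRingType) := Glued {
  gp : nat -> nat;
  gq : nat -> nat;
  gD : forall i, 'M[A]_(gp i, gp i.+1);
  gE : forall i, 'M[A]_(gq i, gq i.+1);
  gC : 'M[A]_(gp 0, gq 0) }.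

Definition swap (A : comPzRingType) (T : glued A) : glued A :=
  Glued (gE T) (gD T) (gC T)^T.

Definition map_glued (A B : comPzRingType) (k : {rmorphism A -> B})
    (T : glued A) : glued B :=
  Glued (fun i => map_mx k (gD T i)) (fun i => map_mx k (gE T i))
    (map_mx k (gC T)).

Section Criterion.
Variable A : comPzRingType.
Implicit Type T : glued A.

Definition is_complex T :=
  [/\ forall i, gD T i *m gD T i.+1 = 0, forall i, gE T i *m gE T i.+1 = 0,
      gC T *m gE T 0 = 0 & (gD T 0)^T *m gC T = 0].

(** For [V] the ring, these conditions make [D] and [E] resolve a module and its dual. The four
    conditions of [coresolving] then express vanishing of Ext of the module, vanishing of Ext of the
    dual, surjectivity of the evaluation into the bidual, and its injectivity. *)
Definition resolving (V : lmodType A) T :=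
  [/\ forall i, exact_at V (gD T i.+1) (gD T i),
      forall i, exact_at V (gE T i.+1) (gE T i),
      exact_at V (gE T 0) (gC T) & exact_at V (gC T) (gD T 0)^T].

Definition coresolving (n : nat) (V : lmodType A) T :=
  [/\ forall i, (i.+1 < n)%N -> exact_at V (gD T i)^T (gD T i.+1)^T,
      forall i, (i.+1 < n)%N -> exact_at V (gE T i)^T (gE T i.+1)^T,
      exact_at V (gC T)^T (gE T 0)^T & exact_at V (gD T 0) (gC T)^T].

Lemma is_complex_swap T : is_complex T -> is_complex (swap T).
Proof.
move=> [DD EE CE DC]; split=> //=.
  by rewrite -[gD T 0]trmxK -trmx_mul DC trmx0.
by rewrite -trmx_mul CE trmx0.
Qed.

Lemma resolving_swap n V T :
  resolving V T -> coresolving n V T -> resolving V (swap T).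
Proof. by move=> [? ? ? ?] [? ? ? ?]; split. Qed.

Lemma coresolving_swap n V T :
  resolving V T -> coresolving n V T -> coresolving n V (swap T).
Proof. by move=> [? ? ? ?] [? ? ? ?]; split; rewrite //= ?trmxK. Qed.

Variables (N : lmodType A) (T : glued A) (e : 'I_(gp T 0) -> N).
Hypotheses (N_pres : presented e (gD T 0)) (T_complex : is_complex T).
Hypothesis T_res : resolving A^o T.

Lemma glued_dual : exists c : 'I_(gq T 0) -> dual N,
  (forall l k, (c l : {linear N -> A^o}) (e k) = gC T k l) /\
  presented c (gE T 0).
Proof.
have [_ _ CE DC] := T_complex; have [_ _ exE exC] := T_res.
exact: (presented_dual N_pres DC CE exC exE).
Qed.

Lemma Ext_glued (V : lmodType A) i :
  zero_module (Ext N V i.+1) <-> exact_at V (gD T i)^T (gD T i.+1)^T.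
Proof.
have [DD _ _ _] := T_complex; have [exD _ _ _] := T_res.
exact: (Ext_matrixP N_pres).
Qed.

Lemma Ext_dual_glued (V : lmodType A) i :
  zero_module (Ext (dual N) V i.+1) <-> exact_at V (gE T i)^T (gE T i.+1)^T.
Proof.
have [_ EE _ _] := T_complex; have [_ exE _ _] := T_res.
by have [c [_ c_pres]] := glued_dual; exact: (Ext_matrixP c_pres).
Qed.

(** In coordinates the evaluation is the map induced by the transpose of [C], from the cokernel of
    [gD T 0] to the kernel of the transpose of [gE T 0], which is the bidual. *)
Lemma reflexive_glued : reflexive_module N <->
  exact_at A^o (gC T)^T (gE T 0)^T /\ exact_at A^o (gD T 0) (gC T)^T.
Proof.
have [c [cC c_pres]] := glued_dual; have [gen rel] := N_pres.
have evalE a : (fun l => (c l : {linear N -> A^o}) (lincomb e a)) =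
    mxact (gC T)^T a.
  apply/funext => l; rewrite linear_lincomb; apply: eq_bigr => k _ /=.
  by rewrite cC mxE; exact: mulrC.
have eval_c (phi : dual (dual N)) (x : N) :
    (forall l, (phi : {linear _ -> A^o}) (c l) = (c l : {linear N -> A^o}) x) ->
    phi = bidual_eval x.
  by move=> phix; apply: (presented_ext c_pres).
split=> [N_refl|[exC exD]].
  have eval_inj := bij_inj N_refl; have [inv _ invK] := N_refl.
  split=> [y Ey|a Ca].
    have [phi phiy] := presented_hom c_pres Ey.
    have [a xa] := gen (inv phi); exists a.
    rewrite -evalE -xa; apply/funext => l; rewrite -phiy.
    exact: (congr1 (fun f : {linear dual N -> A^o} => f (c l)) (esym (invK phi))).
  apply/rel/eval_inj/(presented_ext c_pres) => l.
  rewrite -[RHS]/((c l : {linear N -> A^o}) 0) linear0.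
  exact: (congr1 (fun g => g l) (etrans (evalE a) Ca)).
apply: inj_surj_bijective.
  move=> x y xy; apply/eqP; rewrite -subr_eq0; apply/eqP.
  have [a xya] := gen (x - y); rewrite xya; apply/rel/exD.
  rewrite -evalE -xya; apply/funext => l; rewrite linearB.
  apply/eqP; rewrite -[_ == _]/(_ - _ == 0) subr_eq0; apply/eqP.
  exact: (congr1 (fun phi : {linear dual N -> A^o} => phi (c l)) xy).
move=> phi; have [|a ya] := exC ((phi : {linear dual N -> A^o}) \o c).
  rewrite -linear_mxact presented_rel //.
  by apply/funext => j; exact: (linear0 (phi : {linear dual N -> A^o})).
exists (lincomb e a); apply: eval_c => l.
by rewrite -[RHS](congr1 (fun g => g l) (esym (evalE a))) -ya.
Qed.

Lemma stably_reflexive_glued n :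
  stably_reflexive n N <-> coresolving n A^o T.
Proof.
split=> [[/reflexive_glued[exC exD] ext]|[exD exE exC exD0]].
  by split=> // i lt_in; have [] := ext i.+1 lt_in;
    rewrite ?Ext_glued ?Ext_dual_glued.
split; first exact/reflexive_glued.
move=> [//|i] lt_in; split; first exact/Ext_glued/exD.
exact/Ext_dual_glued/exE.
Qed.

End Criterion.

(** * Tensor products *)

Section InverseLinear.
Variables (A : comPzRingType) (U V : lmodType A).

Lemma linear_inverse (f : {linear U -> V}) : bijective f ->
  exists2 g : {linear V -> U}, cancel f g & cancel g f.
Proof.
move=> [g fK gK]; have g_lin : linear g.
  by move=> a x y; apply: (can_inj fK); rewrite linearP !gK.
by exists (HB.pack g (GRing.isLinear.Build A V U *:%R g g_lin) : {linear V -> U}).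
Qed.

Lemma exact_at_isoE (f : {linear U -> V}) m k l (D : 'M[A]_(m, k))
    (E : 'M[A]_(l, m)) :
  bijective f -> exact_at U D E <-> exact_at V D E.
Proof.
move=> f_bij; split; first exact: exact_at_iso f_bij.
have [g fK gK] := linear_inverse f_bij.
by apply: (@exact_at_iso _ _ _ g); exists f.
Qed.

End InverseLinear.

Lemma exact_at_restr (A B : comPzRingType) (k : {rmorphism A -> B})
    (V : lmodType B) m n l (D : 'M[A]_(m, n)) (E : 'M[A]_(l, m)) :
  exact_at (restr k V) D E <-> exact_at V (map_mx k D) (map_mx k E).
Proof.
have act m' n' (F : 'M[A]_(m', n')) (v : 'I_n' -> V) :
    mxact (map_mx k F) v = mxact F (v : 'I_n' -> restr k V).
  by apply/funext => i; apply: eq_bigr => j _; rewrite mxE -[RHS]/(k (F i j) *: v j).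
by split=> ex v; [rewrite act|rewrite -act] => /ex[w vw]; exists w;
  rewrite vw act.
Qed.

Lemma tens_map_comp (A : comPzRingType) (L M N U V W : lmodType A)
    (f : {linear L -> M}) (f' : {linear M -> N}) (g : {linear U -> V})
    (g' : {linear V -> W}) t :
  tens_map f' g' (tens_map f g t) = tens_map (f' \o f) (g' \o g) t.
Proof.
elim/tens_ind: t => [|x y|x y IHx IHy]; first by rewrite !raddf0.
  by rewrite !tens_mapE.
by rewrite !raddfD /= IHx IHy.
Qed.

Lemma tens_map_ext (A : comPzRingType) (M M' N N' : lmodType A)
    (f f' : {linear M -> M'}) (g g' : {linear N -> N'}) :
  f =1 f' -> g =1 g' -> tens_map f g =1 tens_map f' g'.
Proof.
move=> ff' gg'; elim/tens_ind => [|x y|x y IHx IHy]; first by rewrite !raddf0.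
  by rewrite !tens_mapE ff' gg'.
by rewrite !raddfD /= IHx IHy.
Qed.

Lemma tens_map_id (A : comPzRingType) (M N : lmodType A) (f : {linear M -> M})
    (g : {linear N -> N}) : f =1 id -> g =1 id -> tens_map f g =1 id.
Proof.
move=> f1 g1; elim/tens_ind => [|x y|x y IHx IHy]; first by rewrite raddf0.
  by rewrite tens_mapE f1 g1.
by rewrite raddfD /= IHx IHy.
Qed.

Section Image.
Variables (A : comPzRingType) (U V : lmodType A) (f : {linear U -> V}).

Definition im_pred : {pred V} := [pred y | `[< exists x, y = f x >]].

Fact im_closed : submod_closed im_pred.
Proof.
split=> [|a x y]; rewrite !inE; first by apply/asboolP; exists 0; rewrite linear0.
move=> /asboolP[u ->] /asboolP[v ->]; apply/asboolP.
by exists (a *: u + v); rewrite linearP.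
Qed.

Definition im : submodule V := Submodule im_closed.

Lemma imP y : (y \in im) <-> exists x, y = f x.
Proof. by rewrite inE; split=> /asboolP. Qed.

End Image.

Section RightExact.
Variables (A : comPzRingType) (M U V W : lmodType A).
Variables (f : {linear U -> V}) (g : {linear V -> W}).
Hypothesis g_surj : forall w, exists v, w = g v.
Hypothesis fg_ex : forall v, g v = 0 -> exists u, v = f u.

(** The class of [m \ox v] modulo the image of [f] depends only on [m] and [g v]. This gives a map
    back from the tensor product with [W] to the cokernel, so an element killed by [g] has class
    zero. *)
Lemma tens_right_exact (t : tens M V) :
  tens_map (idfun : {linear M -> M}) g t = 0 ->
  exists t', t = tens_map (idfun : {linear M -> M}) f t'.
Proof.
pose Mf := tens_map (idfun : {linear M -> M}) f.
have MfD x y : Mf (x + y) = Mf x + Mf y by exact: (raddfD (tens_map _ _)).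
have Mf0 : Mf 0 = 0 by exact: (raddf0 (tens_map _ _)).
have Mf_lin : linear Mf.
  move=> a; have MfZ x : Mf (a *: x) = a *: Mf x.
    elim/tens_ind: x => [|m u|x y IHx IHy]; first by rewrite scaler0 Mf0 scaler0.
      by rewrite -tpureZl /Mf !tens_mapE tpureZl.
    by rewrite scalerDr !MfD scalerDr IHx IHy.
  by move=> x y; rewrite MfD MfZ.
pose MF : {linear tens M U -> tens M V} :=
  HB.pack Mf (GRing.isLinear.Build _ _ _ *:%R Mf Mf_lin).
pose lift w := projT1 (cid (g_surj w)).
have liftP w : g (lift w) = w by rewrite /lift; case: cid.
pose b m w := quot_proj (im MF) (m \ox lift w).
have bE m v w : g v = w -> b m w = quot_proj (im MF) (m \ox v).
  move=> gv; have [|u uP] := @fg_ex (lift w - v).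
    by rewrite linearB liftP gv subrr.
  apply/quot_proj_eqP; apply/imP; exists (m \ox u).
  rewrite -[RHS]/(Mf _) /Mf tens_mapE /= -uP tpureDr; congr (_ + _).
  by apply: (addrI (m \ox v)); rewrite -tpureDr !subrr tpure0r.
have bDl m m' w : b (m + m') w = b m w + b m' w.
  by rewrite /b tpureDl linearD.
have bDr m w w' : b m (w + w') = b m w + b m w'.
  rewrite (bE m (lift w + lift w')); last by rewrite linearD !liftP.
  by rewrite tpureDr linearD.
have bZ a m w : b (a *: m) w = b m (a *: w).
  rewrite (bE m (a *: lift w)); last by rewrite linearZ /= liftP.
  by rewrite /b tpureZ.
pose L := tens_lift (BalancedMap bDl bDr bZ).
have LE x : L (tens_map (idfun : {linear M -> M}) g x) = quot_proj (im MF) x.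
  elim/tens_ind: x => [|m v|x y IHx IHy].
  - by rewrite raddf0 linear0; exact: (raddf0 (tens_lift _)).
  - by rewrite tens_mapE /L tens_liftE /=; exact: bE.
  - by rewrite raddfD [RHS]linearD /= -IHx -IHy; exact: (raddfD (tens_lift _)).
move=> gt0; have /quot_proj_eqP : quot_proj (im MF) t = quot_proj (im MF) 0.
  by rewrite -LE gt0 linear0; exact: (raddf0 (tens_lift _)).
by rewrite subr0 => /imP.
Qed.

End RightExact.

Section Extend.
Variables (S R : comPzRingType) (h : {rmorphism S -> R}).

Section ExtendMap.
Variables (U V : lmodType S) (f : {linear U -> V}).

Definition extend_map (t : extend h U) : extend h V :=
  tens_map (idfun : {linear restr h R^o -> restr h R^o}) f t.

Lemma extend_mapE r u : extend_map (extend_pure h r u) = extend_pure h r (f u).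
Proof. exact: tens_mapE. Qed.

Lemma extend_map_is_linear : linear extend_map.
Proof.
move=> a x y; rewrite [LHS](raddfD (tens_map _ _)); congr (_ + _).
elim/extend_ind: x => [|r u|x x' IHx IHx'].
- by rewrite scaler0 [LHS](raddf0 (tens_map _ _)) [extend_map 0](raddf0 (tens_map _ _)) scaler0.
- rewrite -[X in X = _]/(extend_map (extend_scale _ _)) extend_scaleE.
  by rewrite !extend_mapE -[RHS]/(extend_scale _ _) extend_scaleE.
- rewrite scalerDr [LHS](raddfD (tens_map _ _)).
  rewrite [extend_map _](raddfD (tens_map _ _)) scalerDr.
  by congr (_ + _).
Qed.

HB.instance Definition _ := GRing.isLinear.Build R (extend h U) (extend h V)
  *:%R extend_map extend_map_is_linear.

End ExtendMap.

Lemma extend_pureZl r r' (U : lmodType S) (u : U) :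
  r *: extend_pure h r' u = extend_pure h (r * r') u.
Proof. exact: extend_scaleE. Qed.

Lemma extend_right_exact (U V W : lmodType S) (f : {linear U -> V})
    (g : {linear V -> W}) :
  (forall w, exists v, w = g v) ->
  (forall v, g v = 0 -> exists u, v = f u) ->
  forall t, extend_map g t = 0 -> exists t', t = extend_map f t'.
Proof. by move=> g_surj fg_ex t; exact: tens_right_exact. Qed.

Lemma extend_unit_bij :
  bijective (fun r : R => extend_pure h r (1 : S^o) : extend h S^o).
Proof.
pose b (r : restr h R^o) (s : S^o) : R := (r : R) * h s.
have bDl m m' n : b (m + m') n = b m n + b m' n by rewrite /b mulrDl.
have bDr m n n' : b m (n + n') = b m n + b m n' by rewrite /b rmorphD mulrDr.
have bZ a m n : b (a *: m) n = b m (a *: n).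
  by rewrite /b rmorphM -[a *: m]/(h a * m) mulrA [m * h a]mulrC.
exists (tens_lift (BalancedMap bDl bDr bZ)) => [r|t].
  by rewrite [LHS]tens_liftE /= /b rmorph1 mulr1.
elim/extend_ind: t => [|r s|x y IHx IHy].
- rewrite [X in extend_pure _ X _](raddf0 (tens_lift _)); exact: tpure0l.
- rewrite [X in extend_pure _ X _]tens_liftE /= /b mulrC extend_pureZ.
  by congr extend_pure; exact: mulr1.
- by rewrite [X in extend_pure _ X _](raddfD (tens_lift _)) extend_pureDl IHx IHy.
Qed.

End Extend.

Arguments extend_map {S R} h {U V} f t.

Section ScaleRight.
Variables (S R : comPzRingType) (h : {rmorphism S -> R}) (N : lmodType R).
Variable x : N.

Definition scale_right (r : restr h R^o) : restr h N := (r : R) *: x.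

Lemma scale_right_is_linear : linear scale_right.
Proof.
move=> a r r'; rewrite /scale_right -[a *: r]/(h a * r) scalerDl.
by rewrite -scalerA.
Qed.

HB.instance Definition _ := GRing.isLinear.Build S (restr h R^o) (restr h N)
  *:%R scale_right scale_right_is_linear.

Variable U : lmodType S.

(** Tensors with [U] the map from [R] to [N] given by the element [x]; linear combinations of
    elements of [N] with tensor coefficients are built from it. *)
Definition extend_act (t : extend h U) : tens (restr h N) U :=
  tens_map scale_right (idfun : {linear U -> U}) t.

Lemma extend_act_is_additive : zmod_morphism extend_act.
Proof. exact: (raddfB (tens_map scale_right (idfun : {linear U -> U}))). Qed.

HB.instance Definition _ := GRing.isZmodMorphism.Build (extend h U)
  (tens (restr h N) U) extend_act extend_act_is_additive.

Lemma extend_actE r u :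
  extend_act (extend_pure h r u) = (r *: x : restr h N) \ox u.
Proof. exact: tens_mapE. Qed.

End ScaleRight.

(* I |-> R (x)_S I as an abstract functor: unification would otherwise keep     *)
(* unfolding the quotient that defines the tensor product.                      *)
Record tensor_functor (S R : comPzRingType) (h : {rmorphism S -> R}) :=
  TensorFunctor {
    tf :> lmodType S -> lmodType R;
    tf_map : forall U V : lmodType S, {linear U -> V} -> {linear tf U -> tf V};
    tf_pure : forall U : lmodType S, R -> U -> tf U;
    tf_pureDl : forall (U : lmodType S) r r' (u : U),
      tf_pure (r + r') u = tf_pure r u + tf_pure r' u;
    tf_pureDr : forall (U : lmodType S) r (u u' : U),
      tf_pure r (u + u') = tf_pure r u + tf_pure r u';
    tf_pureZ : forall (U : lmodType S) a r (u : U), tf_pure (h a * r) u = tf_pure r (a *: u);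
    tf_pureZl : forall (U : lmodType S) r r' (u : U), r *: tf_pure r' u = tf_pure (r * r') u;
    tf_ind : forall (U : lmodType S) (P : tf U -> Prop), P 0 -> (forall r u, P (tf_pure r u)) ->
      (forall x y, P x -> P y -> P (x + y)) -> forall x, P x;
    tf_mapE : forall (U V : lmodType S) (f : {linear U -> V}) r u,
      tf_map f (tf_pure r u) = tf_pure r (f u);
    tf_right_exact : forall (U V W : lmodType S) (f : {linear U -> V})
      (g : {linear V -> W}), (forall w, exists v, w = g v) ->
      (forall v, g v = 0 -> exists u, v = f u) ->
      forall t, tf_map g t = 0 -> exists t', t = tf_map f t';
    tf_act : forall (U : lmodType S) (N : lmodType R),
      N -> {additive tf U -> tens (restr h N) U};
    tf_actE : forall (U : lmodType S) (N : lmodType R) (x : N) r u,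
      tf_act U x (tf_pure r u) = (r *: x : restr h N) \ox (u : U);
    tf_unit_bij : bijective (fun r : R => tf_pure r (1 : S^o)) }.

Arguments tf_map {S R h} T {U V} f : rename.
Arguments tf_pure {S R h} T {U} r u : rename.
Arguments tf_act {S R h} T {U N} x : rename.

Definition flat_functor (S R : comPzRingType) (h : {rmorphism S -> R})
    (T : tensor_functor h) :=
  forall (U V : lmodType S) (f : {linear U -> V}),
    injective f -> injective (tf_map T f).

Definition extend_functor (S R : comPzRingType) (h : {rmorphism S -> R}) :
    tensor_functor h :=
  @TensorFunctor S R h (fun U => extend h U)
    (fun U V f => extend_map h f : {linear extend h U -> extend h V})
    (fun U => @extend_pure S R h U)
    (fun U => @extend_pureDl S R h U) (fun U => @extend_pureDr S R h U)
    (fun U a r u => @extend_pureZ S R h U a r u)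
    (fun U r r' u => @extend_pureZl S R h r r' U u)
    (fun U => @extend_ind S R h U) (fun U V f => @extend_mapE S R h U V f)
    (@extend_right_exact S R h)
    (fun U N x => @extend_act S R h N x U : {additive extend h U -> tens (restr h N) U})
    (fun U N x r u => @extend_actE S R h N x U r u)
    (@extend_unit_bij S R h).

Lemma extend_functor_flat (S R : comPzRingType) (h : {rmorphism S -> R}) :
  flat_hom h -> flat_functor (extend_functor h).
Proof. by []. Qed.

Section TensorFunctor.
Variables (S R : comPzRingType) (h : {rmorphism S -> R}) (T : tensor_functor h).
Lemma tf_pure0l (U : lmodType S) (u : U) : tf_pure T 0 u = 0.
Proof. by apply: (addIr (tf_pure T 0 u)); rewrite -tf_pureDl !add0r. Qed.

Lemma tf_pure0r (U : lmodType S) r : tf_pure T r (0 : U) = 0.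
Proof. by apply: (addIr (tf_pure T r 0)); rewrite -tf_pureDr !add0r. Qed.

Lemma tf_map_comp (U V W : lmodType S) (f : {linear U -> V}) (g : {linear V -> W}) t :
  tf_map T g (tf_map T f t) = tf_map T (g \o f) t.
Proof.
elim/tf_ind: t => [|r u|x y IHx IHy]; first by rewrite !linear0.
  by rewrite !tf_mapE.
by rewrite !linearD /= IHx IHy.
Qed.

Lemma tf_map_eq0 (U V : lmodType S) (f : {linear U -> V}) t :
  (forall u, f u = 0) -> tf_map T f t = 0.
Proof.
move=> f0; elim/tf_ind: t => [|r u|x y IHx IHy]; first by rewrite linear0.
  by rewrite tf_mapE f0 tf_pure0r.
by rewrite linearD /= IHx IHy addr0.
Qed.

Lemma tf_map_surj (V W : lmodType S) (g : {linear V -> W}) :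
  (forall w, exists v, w = g v) -> forall t, exists t', t = tf_map T g t'.
Proof.
move=> g_surj t; elim/tf_ind: t => [|r w|x y [x' ->] [y' ->]].
- by exists 0; rewrite linear0.
- by have [v ->] := g_surj w; exists (tf_pure T r v); rewrite tf_mapE.
- by exists (x' + y'); rewrite linearD.
Qed.

Definition tf_unit (r : R^o) : T S^o := tf_pure T (r : R) (1 : S^o).

Lemma tf_unit_is_linear : linear tf_unit.
Proof. by move=> a x y; rewrite /tf_unit tf_pureDl [in RHS]tf_pureZl. Qed.

HB.instance Definition _ := GRing.isLinear.Build R R^o (T S^o) *:%R tf_unit
  tf_unit_is_linear.

End TensorFunctor.

(** * Devissage and shifting *)

Section ScaleBy.
Variables (A : comPzRingType) (V : lmodType A) (v : V).

Definition scale_by (a : A^o) : V := (a : A) *: v.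

Lemma scale_by_is_linear : linear scale_by.
Proof. by move=> a b c; rewrite /scale_by scalerDl scalerA. Qed.

HB.instance Definition _ := GRing.isLinear.Build A A^o V *:%R scale_by
  scale_by_is_linear.

End ScaleBy.

Section Submod.
Variables (A : comPzRingType) (V : lmodType A) (W : submodule V).

Definition incl (x : submod W) : V := \val x.

Lemma incl_is_linear : linear incl.
Proof. by move=> a x y; rewrite /incl linearP. Qed.

HB.instance Definition _ := GRing.isLinear.Build A (submod W) V *:%R incl
  incl_is_linear.

Lemma incl_inj : injective incl. Proof. exact: val_inj. Qed.

Lemma inclP x : x \in W -> exists y, x = incl y.
Proof. by move=> xW; exists (Sub x xW); rewrite /incl SubK. Qed.

Lemma incl_in y : incl y \in W. Proof. exact: valP y. Qed.

Lemma quot_proj_surj (y : quotmod W) : exists x, y = quot_proj W x.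
Proof. exact: quot_projP. Qed.

Lemma quot_proj_eq0 x : quot_proj W x = 0 <-> x \in W.
Proof. by rewrite -(linear0 (quot_proj W)) quot_proj_eqP subr0. Qed.

Lemma quot_proj_ker x : quot_proj W x = 0 -> exists y, x = incl y.
Proof. by move/quot_proj_eq0/inclP. Qed.

End Submod.

Section PureFamily.
Variables (S R : comPzRingType) (h : {rmorphism S -> R}) (T : tensor_functor h).

Definition pure_family (I : lmodType S) p (c : 'I_p -> R^o) (x : I) : 'I_p -> T I :=
  fun i => tf_pure T (c i : R) x.

Lemma family_ind (I : lmodType S) p (P : ('I_p -> T I) -> Prop) :
  P 0 -> (forall c x, P (pure_family c x)) ->
  (forall v w, P v -> P w -> P (v + w)) -> forall v, P v.
Proof.
move=> P0 Pp PD v; pose single l t : 'I_p -> T I := fun i => if i == l then t else 0.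
have -> : v = \sum_l single l (v l).
  apply/funext => i; rewrite fct_sumE (bigD1 i) //= big1 /single ?eqxx ?addr0 //.
  by move=> l; rewrite eq_sym => /negbTE ->.
elim/big_rec: _ => // l w _ Pw; apply: (PD _ _) => //.
elim/tf_ind: (v l) => [|r x|x y IHx IHy].
- by rewrite (_ : single l 0 = 0) //; apply/funext => i; rewrite /single if_same.
- rewrite (_ : single l _ = pure_family (fun i => if i == l then r else 0) x) //.
  apply/funext => i; rewrite /single /pure_family; case: eqP => // _.
  exact/esym/tf_pure0l.
- rewrite (_ : single l _ = single l x + single l y); first exact: PD.
  apply/funext => i; rewrite /single.
  by rewrite -[RHS]/((if _ then _ else _) + (if _ then _ else _)); case: eqP;
    rewrite ?addr0.
Qed.

Lemma mxact_pure_family (I : lmodType S) m n (D : 'M[R]_(m, n)) c (x : I) :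
  mxact D (pure_family c x) = pure_family (mxact D c) x.
Proof.
apply/funext => i; rewrite /mxact /pure_family.
under eq_bigr do rewrite tf_pureZl.
rewrite -[RHS]/(tf_pure T (\sum_j D i j * c j : R) x).
elim: (index_enum _) => [|j s IHs]; first by rewrite !big_nil tf_pure0l.
by rewrite !big_cons tf_pureDl IHs.
Qed.

End PureFamily.

Section Devissage.
Variables (S R : comPzRingType) (h : {rmorphism S -> R}).
Variable T : tensor_functor h.
Hypothesis T_flat : flat_functor T.

Lemma tf_sum (I : lmodType S) (t : T I) :
  exists s : seq (R * I), t = \sum_(x <- s) tf_pure T x.1 x.2.
Proof.
elim/tf_ind: t => [|r u|x y [s ->] [s' ->]].
- by exists [::]; rewrite big_nil.
- by exists [:: (r, u)]; rewrite big_seq1.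
- by exists (s ++ s'); rewrite big_cat.
Qed.

(** Finitely many tensors involve only finitely many elements of [I]. *)
Lemma family_fin_gen (I : lmodType S) m (v : 'I_m -> T I) :
  exists k (u : 'I_k -> I) (v' : 'I_m -> T (submod (im (lincomb u)))),
    v = tf_map T (@incl _ _ _) \o v'.
Proof.
pose s i := projT1 (cid (tf_sum (v i))).
have vE i : v i = \sum_(x <- s i) tf_pure T x.1 x.2 by rewrite /s; case: cid.
pose us := flatten [seq [seq x.2 | x <- s i] | i <- enum 'I_m].
pose u (j : 'I_(size us)) := us`_j; exists (size us), u.
pose W := im (lincomb u).
have usW i x : x \in s i -> x.2 \in submodule_pred W.
  move=> xs; have us_x : x.2 \in us.
    apply/flattenP; exists [seq x.2 | x <- s i]; last exact: map_f.
    by apply: map_f; rewrite mem_enum.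
  apply/imP; have lt_x : (index x.2 us < size us)%N by rewrite index_mem.
  by exists (delta (Ordinal lt_x)); rewrite /= lincomb_delta /u nth_index.
exists (fun i => \sum_(x <- s i) tf_pure T x.1 (insubd (0 : submod W) x.2)).
apply/funext => i; rewrite /= linear_sum vE !big_seq.
apply: eq_bigr => x xs; rewrite [RHS]tf_mapE; congr tf_pure.
by symmetry; apply: insubdK; exact: usW xs.
Qed.

Lemma family_lift (U V : lmodType S) (f : {linear U -> V}) m (v : 'I_m -> T V) :
  (forall y, exists x, y = f x) -> exists v', v = tf_map T f \o v'.
Proof.
move=> f_surj; have lift i := cid (tf_map_surj f_surj (v i)).
by exists (fun i => projT1 (lift i)); apply/funext => i /=; case: (lift i).
Qed.

Section Complex.
Variables (m k l : nat) (D : 'M[R]_(m, k)) (E : 'M[R]_(l, m)).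
Hypothesis ED0 : E *m D = 0.

Section HalfExact.
Variables (U V W : lmodType S) (f : {linear U -> V}) (g : {linear V -> W}).
Hypothesis f_inj : injective f.
Hypothesis g_surj : forall w, exists v, w = g v.
Hypothesis fg_ex : forall v, g v = 0 -> exists u, v = f u.

(** Over [W] the cocycle bounds; lift the bounding family to [w] over [V]. Then [v - D w] comes from
    [U], and it is a cocycle there because [T] keeps [f] injective. *)
Lemma cocycle_lift (v : 'I_m -> T V) : exact_at (T W) D E -> mxact E v = 0 ->
  exists (z : 'I_m -> T U) (w : 'I_k -> T V),
    mxact E z = 0 /\ v = (tf_map T f \o z) + mxact D w.
Proof.
move=> exW Ev; have [|w' gv] := exW (tf_map T g \o v).
  by rewrite -linear_mxact Ev; apply/funext => i /=; rewrite linear0.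
have [w w'E] := family_lift w' g_surj; rewrite {}w'E -linear_mxact in gv.
have lift i : exists z, v i - mxact D w i = tf_map T f z.
  apply: (tf_right_exact g_surj fg_ex).
  by rewrite linearB /=; apply/eqP; rewrite subr_eq0; apply/eqP/(congr1 (fun F => F i) gv).
pose z i := projT1 (cid (lift i)).
have zE : v = (tf_map T f \o z) + mxact D w.
  apply/funext => i; rewrite -[RHS]/(tf_map T f (z i) + mxact D w i).
  by rewrite /z; case: cid => /= z' <-; rewrite subrK.
exists z, w; split=> //; apply/funext => i.
apply: (inj_raddf0 (T_flat f_inj)).
have : mxact E (tf_map T f \o z) = 0.
  by move: Ev; rewrite zE linearD /= mulmx0_mxact // addr0.
by rewrite -linear_mxact => /(congr1 (fun F => F i)).
Qed.

Lemma exact_at_extension :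
  exact_at (T U) D E -> exact_at (T W) D E -> exact_at (T V) D E.
Proof.
move=> exU exW v Ev; have [z [w [/exU[w' ->] ->]]] := cocycle_lift exW Ev.
by exists ((tf_map T f \o w') + w); rewrite linearD linear_mxact.
Qed.

End HalfExact.

Lemma exact_at_fin_gen (I : lmodType S) :
  (forall n (u : 'I_n -> I), exact_at (T (submod (im (lincomb u)))) D E) ->
  exact_at (T I) D E.
Proof.
move=> exI v; have [n [u [v' ->]]] := family_fin_gen v.
rewrite -linear_mxact => Ev'; have [|w ->] := exI n u v'.
  apply/funext => i; apply: (inj_raddf0 (T_flat (@incl_inj _ _ _))).
  exact: (congr1 (fun F => F i) Ev').
by exists (tf_map T (@incl _ _ _) \o w); rewrite linear_mxact.
Qed.

(** A finitely generated module is handled by induction on the number of generators, as an extension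
    of a module with one generator fewer by the cyclic submodule of the first generator. *)
Lemma exact_at_devissage :
  (forall (I : lmodType S) u, (forall x : I, exists a : S, x = a *: u) ->
     exact_at (T I) D E) ->
  forall I : lmodType S, exact_at (T I) D E.
Proof.
move=> cyc.
suff gen n (I : lmodType S) (u : 'I_n -> I) :
    (forall x, exists c, x = lincomb u c) -> exact_at (T I) D E.
  move=> I; apply: exact_at_fin_gen => n u.
  have u_in j : u j \in im (lincomb u).
    by apply/imP; exists (delta j); rewrite /= lincomb_delta.
  apply: (gen n _ (fun j => Sub (u j) (u_in j) : submod (im (lincomb u)))) => x.
  have /imP[c xc] := incl_in x; exists c; apply: incl_inj.
  rewrite linear_lincomb xc; apply: eq_bigr => j _.
  by rewrite /= /incl SubK.
elim: n I u => [|n IHn] I u gen.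
  apply: (cyc I 0) => x; exists 0; have [c ->] := gen x.
  by rewrite scaler0 /lincomb big_ord0.
pose W := im (scale_by (u ord0)).
have u0W : u ord0 \in W by apply/imP; exists 1; rewrite /= /scale_by scale1r.
apply: (@exact_at_extension _ _ _ (@incl _ _ W) (quot_proj W)).
- exact: incl_inj.
- exact: quot_proj_surj.
- exact: quot_proj_ker.
- apply: (cyc _ (Sub (u ord0) u0W : submod W)) => x.
  have /imP[a xa] := incl_in x; exists a; apply: incl_inj.
  by rewrite linearZ /= xa /incl SubK.
- apply: (IHn _ (fun j => quot_proj W (u (lift ord0 j)))) => x.
  have [y ->] := quot_proj_surj x; have [c ->] := gen y.
  exists (fun j => c (lift ord0 j)).
  rewrite /lincomb big_ord_recl linearD linear_sum /= linearZ /=.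
  have -> : quot_proj W (u ord0) = 0 by apply/quot_proj_eq0.
  by rewrite scaler0 add0r; apply: eq_bigr => j _; rewrite linearZ.
Qed.

(* For cyclic I apply the functor to 0 -> J -> S -> I -> 0 and chase the diagram.   *)
Lemma exact_at_shift :
  exact_at R^o D E ->
  (forall (J : submodule (S^o : lmodType S)) (z : 'I_l -> T (submod J))
      (y : 'I_m -> T S^o), tf_map T (@incl _ _ J) \o z = mxact E y ->
    exists b, z = mxact E b) ->
  forall I : lmodType S, exact_at (T I) D E.
Proof.
move=> exR exJ; have exS : exact_at (T S^o) D E.
  exact: (exact_at_iso (f := tf_unit T)) (tf_unit_bij T) exR.
apply: exact_at_devissage => I u u_gen v Ev.
pose J := ker (scale_by u).
have J_ker s : scale_by u s = 0 -> exists t, s = @incl _ _ J t.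
  by move=> su; apply: inclP; rewrite inE; apply/eqP.
have u_surj (x : I) : exists a, x = scale_by u a by exact: u_gen.
have [y vy] := family_lift v u_surj.
have lift i : exists z, mxact E y i = tf_map T (@incl _ _ J) z.
  apply: (tf_right_exact u_surj J_ker).
  by move: Ev; rewrite vy -linear_mxact => /(congr1 (fun F => F i)).
pose z i := projT1 (cid (lift i)).
have zE : tf_map T (@incl _ _ J) \o z = mxact E y.
  by apply/funext => i; rewrite /z /=; case: cid.
have [b zb] := exJ J z y zE.
(* The corrected family is a cocycle over [S], and it still maps to [v] because [J] goes to zero in
   [I]. *)
have [|w yw] := exS (y - (tf_map T (@incl _ _ J) \o b)).
  by rewrite linearB /= -linear_mxact -zb zE subrr.
exists (tf_map T (scale_by u) \o w); rewrite -linear_mxact -yw vy.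
apply/funext => i /=.
rewrite -[RHS]/(tf_map T (scale_by u) (y i - tf_map T (@incl _ _ J) (b i))).
rewrite linearB /= [X in _ - X](_ : _ = 0) ?subr0 // tf_map_comp.
by apply: tf_map_eq0 => t; have := incl_in t; rewrite inE => /eqP.
Qed.

(** A family over [J] that becomes [E y] over [S] is killed by [F], because [F E = 0] and [T J]
    embeds in [T S]. Exactness at the next spot then writes it as [E b] over [J]. *)
Lemma exact_at_shift_flat p (F : 'M[R]_(p, l)) :
  F *m E = 0 -> exact_at R^o D E ->
  (forall I : lmodType S, exact_at (T I) E F) ->
  forall I : lmodType S, exact_at (T I) D E.
Proof.
move=> FE0 exR exF; apply: exact_at_shift => // J z y zy; apply: exF.
apply/funext => i; apply: (inj_raddf0 (T_flat (@incl_inj _ _ J))).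
rewrite -[LHS]/((tf_map T (@incl _ _ J) \o mxact F z) i).
by rewrite linear_mxact zy mulmx0_mxact.
Qed.

End Complex.
End Devissage.

(** * Presentations and base change *)

Section TensorCombination.
Variables (S R : comPzRingType) (h : {rmorphism S -> R}) (T : tensor_functor h).

Section Comb.
Variables (N : lmodType R) (p : nat) (e : 'I_p -> N) (I : lmodType S).

Definition tens_comb (v : 'I_p -> T I) : tens (restr h N) I :=
  \sum_l tf_act T (e l) (v l).

Lemma tens_combD v w : tens_comb (v + w) = tens_comb v + tens_comb w.
Proof.
by rewrite /tens_comb -big_split; apply: eq_bigr => l _; exact: raddfD.
Qed.

Lemma tens_comb0 : tens_comb 0 = 0.
Proof. by apply: (addIr (tens_comb 0)); rewrite -tens_combD !add0r. Qed.

Lemma tens_comb_pure c x :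
  tens_comb (pure_family T c x) = (lincomb e c : restr h N) \ox x.
Proof.
rewrite /tens_comb /lincomb.
elim: (index_enum _) => [|l s IHs]; first by rewrite !big_nil tpure0l.
rewrite !big_cons tpureDl IHs; congr (_ + _); exact: tf_actE.
Qed.

End Comb.

Lemma tens_comb_map (N : lmodType R) p (e : 'I_p -> N) (I I' : lmodType S)
    (f : {linear I -> I'}) v :
  tens_map (idfun : {linear restr h N -> restr h N}) f (tens_comb e v)
  = tens_comb e (tf_map T f \o v).
Proof.
elim/family_ind: v => [|c x|v w IHv IHw].
- rewrite (_ : _ \o 0 = 0); last by apply/funext => i /=; rewrite linear0.
  by rewrite !tens_comb0 raddf0.
- rewrite (_ : _ \o _ = pure_family T c (f x)).
    by rewrite !tens_comb_pure tens_mapE.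
  by apply/funext => i; exact: tf_mapE.
- rewrite (_ : _ \o _ = (tf_map T f \o v) + (tf_map T f \o w)).
    by rewrite !tens_combD raddfD /= IHv IHw.
  by apply/funext => i; exact: linearD.
Qed.

Section PresentedTensor.
Variables (N : lmodType R) (p q : nat) (e : 'I_p -> N) (D : 'M[R]_(p, q)).
Hypothesis N_pres : presented e D.
Variable I : lmodType S.

Lemma tens_comb_rel (w : 'I_q -> T I) : tens_comb e (mxact D w) = 0.
Proof.
elim/family_ind: w => [|c x|v w IHv IHw].
- by rewrite (linear0 (mxact D)) tens_comb0.
- rewrite mxact_pure_family tens_comb_pure; have [_ rel] := N_pres.
  by have /rel -> : exists w, mxact D c = mxact D w; [exists c|rewrite tpure0l].
- by rewrite (linearD (mxact D)) tens_combD IHv IHw addr0.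
Qed.

Lemma tens_comb_surj (t : tens (restr h N) I) : exists v, t = tens_comb e v.
Proof.
have [gen _] := N_pres.
elim/tens_ind: t => [|n x|x y [v ->] [w ->]].
- by exists 0; rewrite tens_comb0.
- by have [c ->] := gen n; exists (pure_family T c x); rewrite tens_comb_pure.
- by exists (v + w); rewrite tens_combD.
Qed.

(** The cokernel of [D] over [T I] is [N] tensored with [I]: the map back sends [n \ox x] to the
    class of [x] with any coefficient vector of [n]. *)
Lemma tens_comb_ker (v : 'I_p -> T I) :
  tens_comb e v = 0 -> exists w, v = mxact D w.
Proof.
have [gen rel] := N_pres.
pose W := im (mxact D : {linear ('I_q -> T I) -> ('I_p -> T I)}).
have wd c c' x : lincomb e c = lincomb e c' ->
    quot_proj W (pure_family T c x) = quot_proj W (pure_family T c' x).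
  move=> cc'; apply/quot_proj_eqP/imP.
  have /rel [d dE] : lincomb e (c - c') = 0 by rewrite linearB /= cc' subrr.
  exists (pure_family T d x); rewrite /= mxact_pure_family -dE.
  apply/funext => i; rewrite -[LHS]/(tf_pure T (c i) x - tf_pure T (c' i) x).
  rewrite /pure_family; apply/eqP; rewrite subr_eq -tf_pureDl.
  by rewrite -[(c - c') i]/(c i - c' i) subrK.
pose coord n := projT1 (cid (gen n)).
have coordP n : lincomb e (coord n) = n by rewrite /coord; case: cid.
pose b (n : restr h N) (x : I) := quot_proj W (pure_family T (coord n) x).
have bE c x : b (lincomb e c) x = quot_proj W (pure_family T c x).
  by apply: wd; rewrite coordP.
have pfD c d x : pure_family T (c + d) x = pure_family T c x + pure_family T d x :> (_ -> T I).
  by apply/funext => i; exact: tf_pureDl.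
have pfDr c x y : pure_family T c (x + y) = pure_family T c x + pure_family T c y :> (_ -> T I).
  by apply/funext => i; exact: tf_pureDr.
have bDl n n' x : b (n + n') x = b n x + b n' x.
  rewrite -{1}[n]coordP -{1}[n']coordP -[_ + _]/(lincomb e _ + lincomb e _ : N).
  by rewrite -linearD bE pfD linearD.
have bDr n x x' : b n (x + x') = b n x + b n x'.
  by rewrite /b pfDr linearD.
have bZ a n x : b (a *: n) x = b n (a *: x).
  rewrite -{1}[n]coordP -[a *: _]/(h a *: (lincomb e _ : N)) -linearZ bE /b.
  by congr (quot_proj W _); apply/funext => i; exact: tf_pureZ.
pose L := tens_lift (BalancedMap bDl bDr bZ).
have LE w : L (tens_comb e w) = quot_proj W w.
  elim/family_ind: w => [|c x|w w' IHw IHw'].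
  - by rewrite tens_comb0 linear0; exact: (raddf0 (tens_lift _)).
  - by rewrite tens_comb_pure -bE; exact: tens_liftE.
  - rewrite tens_combD [RHS]linearD /= -IHw -IHw'; exact: (raddfD (tens_lift _)).
move=> v0; have /quot_proj_eq0/imP[w ->] : quot_proj W v = 0; last by exists w.
by rewrite -LE v0; exact: (raddf0 (tens_lift _)).
Qed.

End PresentedTensor.

(** If a family over [J] becomes [D y] over [S], its class in [N] tensored with [J] dies in [N]
    tensored with [S]. It is zero by flatness of [N], so the family lies in the image of [D] over
    [J]. *)
Lemma exact_at_flat_presented (N : lmodType R) p q r (e : 'I_p -> N)
    (D : 'M[R]_(p, q)) (E : 'M[R]_(q, r)) :
  flat_functor T -> flat_module (restr h N) -> presented e D -> D *m E = 0 ->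
  exact_at R^o E D -> forall I : lmodType S, exact_at (T I) E D.
Proof.
move=> T_flat N_flat N_pres DE exE; apply: exact_at_shift => // J z y zy.
apply: (tens_comb_ker N_pres); apply: N_flat (@incl_inj _ _ J) _ _ _.
by rewrite tens_comb_map zy (tens_comb_rel N_pres) raddf0.
Qed.

End TensorCombination.

Section TensorIso.
Variables (A : comPzRingType) (M N : lmodType A) (f : {linear M -> N}).
Hypothesis f_bij : bijective f.

Lemma tens_map_bij (U : lmodType A) :
  bijective (tens_map f (idfun : {linear U -> U})).
Proof.
have [g fK gK] := linear_inverse f_bij.
by exists (tens_map g (idfun : {linear U -> U})) => t; rewrite tens_map_comp;
  apply: tens_map_id.
Qed.

Lemma flat_iso : flat_module M -> flat_module N.
Proof.
move=> M_flat U V i i_inj x y.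
have [inv _ invK] := tens_map_bij U.
rewrite -(invK x) -(invK y) => xy; congr tens_map; apply: (M_flat _ _ i i_inj).
apply: (bij_inj (tens_map_bij V)); move: xy; rewrite !tens_map_comp.
have swap t : tens_map (idfun \o f) (i \o idfun) t = tens_map (f \o idfun) (idfun \o i) t.
  exact: tens_map_ext.
by rewrite !swap.
Qed.

End TensorIso.

Section BaseChangeIso.
Variables (S R S' : comPzRingType).
Variables (h : {rmorphism S -> R}) (g : {rmorphism S -> S'}).

Lemma bc_inl_mul r (t : bc_ring h g) :
  bc_inl h g r * t = r *: (t : extend h (restr g S'^o)).
Proof.
elim/bc_ring_ind: t => [|r' u|t t' IHt IHt'].
- by rewrite mulr0 scaler0.
- rewrite -[LHS]/(bc_mul _ _) bc_mulE mul1r; exact/esym/extend_scaleE.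
- rewrite mulrDr IHt IHt'; symmetry; exact: extend_scaleDr.
Qed.

Lemma mxact_bc_inl m n (D : 'M[R]_(m, n)) (w : 'I_n -> bc_ring h g) :
  mxact (map_mx (bc_inl h g) D) (w : 'I_n -> (bc_ring h g)^o)
  = mxact D (w : 'I_n -> extend h (restr g S'^o)).
Proof.
apply/funext => i; apply: eq_bigr => j _; rewrite mxE; exact: bc_inl_mul.
Qed.

(** As an [R]-module the new ring is [R] tensored with the [S]-module [S']: this turns a change of
    rings into a change of coefficients. *)
Lemma exact_at_bc_ring m n l (D : 'M[R]_(m, n)) (E : 'M[R]_(l, m)) :
  exact_at (bc_ring h g)^o (map_mx (bc_inl h g) D) (map_mx (bc_inl h g) E) <->
  exact_at (extend h (restr g S'^o)) D E.
Proof.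
split=> ex v.
  by rewrite -mxact_bc_inl => /ex[w ->]; exists w; exact: mxact_bc_inl.
by rewrite mxact_bc_inl => /ex[w ->]; exists w; exact/esym/mxact_bc_inl.
Qed.

Lemma lincomb_base_change (N : lmodType R) p (e : 'I_p -> N)
    (c : 'I_p -> (bc_ring h g)^o) :
  lincomb (fun l => bc_pure h g (e l) (1 : S'^o) : base_change h g N) c
  = tens_comb (T := extend_functor h) e (c : 'I_p -> extend h (restr g S'^o)).
Proof.
apply: eq_bigr => l _; elim/bc_ring_ind: (c l) => [|r u|t t' IHt IHt'].
- by rewrite scale0r [RHS]raddf0.
- rewrite bc_pureZZ [RHS]tens_mapE; congr tpure; exact: mulr1.
- by rewrite scalerDl IHt IHt' [RHS](raddfD (tens_map _ _)).
Qed.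

Lemma presented_base_change (N : lmodType R) p q (e : 'I_p -> N)
    (D : 'M[R]_(p, q)) :
  presented e D ->
  presented (fun l => bc_pure h g (e l) (1 : S'^o) : base_change h g N)
    (map_mx (bc_inl h g) D).
Proof.
move=> N_pres; split=> [x|c].
  by have [v ->] := tens_comb_surj (extend_functor h) N_pres x; exists v; rewrite lincomb_base_change.
rewrite lincomb_base_change; split=> [/(tens_comb_ker N_pres)[w ->]|[w ->]].
  by exists w; rewrite mxact_bc_inl.
by rewrite mxact_bc_inl; exact: tens_comb_rel.
Qed.

Section Cancel.
Variables (M : lmodType R) (I : lmodType S').
Notation M' := (restr (bc_inr h g) (base_change h g M)).

Lemma bc_inrE u (m : M) (a : S') :
  bc_inr h g u *: (bc_pure h g m (a : S'^o) : base_change h g M)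
  = bc_pure h g m (u * a : S'^o).
Proof. by rewrite bc_pureZZ scale1r. Qed.

Definition uncancel_fun (m : restr h M) (x : restr g I) : tens M' I :=
  (bc_pure h g (m : M) (1 : S'^o) : M') \ox (x : I).

Fact uncancel_funDl m m' x :
  uncancel_fun (m + m') x = uncancel_fun m x + uncancel_fun m' x.
Proof. by rewrite /uncancel_fun bc_pureDl; exact: tpureDl. Qed.

Fact uncancel_funDr m x x' :
  uncancel_fun m (x + x') = uncancel_fun m x + uncancel_fun m x'.
Proof. exact: tpureDr. Qed.

Fact uncancel_funZ a m x : uncancel_fun (a *: m) x = uncancel_fun m (a *: x).
Proof.
rewrite /uncancel_fun -[a *: m]/(h a *: (m : M)) bc_pureZ.
rewrite -[a *: x]/(g a *: (x : I)) -tpureZ; congr tpure.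
exact/esym/bc_inrE.
Qed.

Definition uncancel : tens (restr h M) (restr g I) -> tens M' I :=
  tens_lift (BalancedMap uncancel_funDl uncancel_funDr uncancel_funZ).

HB.instance Definition _ := GRing.Additive.on uncancel.

Lemma uncancelE m x : uncancel (m \ox x) = uncancel_fun m x.
Proof. exact: tens_liftE. Qed.

Definition scale_vec (x : I) (a : restr g S'^o) : restr g I := (a : S') *: x.

Fact scale_vec_is_linear x : linear (scale_vec x).
Proof.
move=> b a a'; rewrite /scale_vec -[b *: a]/(g b * a) scalerDl.
by rewrite -scalerA.
Qed.

HB.instance Definition _ x := GRing.isLinear.Build S (restr g S'^o) (restr g I)
  *:%R (scale_vec x) (scale_vec_is_linear x).

Definition cancel_fun (t : M') (x : I) : tens (restr h M) (restr g I) :=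
  tens_map (idfun : {linear restr h M -> restr h M}) (scale_vec x) t.

Fact cancel_funDl t t' x : cancel_fun (t + t') x = cancel_fun t x + cancel_fun t' x.
Proof. exact: (raddfD (tens_map _ _)). Qed.

Fact cancel_funDr t x x' : cancel_fun t (x + x') = cancel_fun t x + cancel_fun t x'.
Proof.
elim/bc_ind: t => [|m a|t t' IHt IHt'].
- by rewrite /cancel_fun !raddf0 addr0.
- rewrite /cancel_fun !tens_mapE -tpureDr; congr tpure; exact: (@scalerDr S' I).
- by rewrite !cancel_funDl IHt IHt' addrACA.
Qed.

Fact cancel_funZ (u : S') t x : cancel_fun (u *: t) x = cancel_fun t (u *: x).
Proof.
elim/bc_ind: t => [|m a|t t' IHt IHt'].
- by rewrite scaler0 /cancel_fun !raddf0.
- rewrite [u *: _](bc_inrE u m a) /cancel_fun !tens_mapE; congr tpure.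
  by rewrite mulrC; symmetry; exact: (@scalerA S' I).
- by rewrite scalerDr !cancel_funDl IHt IHt'.
Qed.

(** Cancellation of base change: the inverse sends the tensor of [m], [a] and [x] to
    [m \ox (a *: x)]. *)
Lemma uncancel_bij : bijective uncancel.
Proof.
exists (tens_lift (BalancedMap cancel_funDl cancel_funDr cancel_funZ)).
  elim/tens_ind => [|m x|s t IHs IHt]; first by rewrite !raddf0.
    rewrite uncancelE [LHS]tens_liftE /= /cancel_fun tens_mapE; congr tpure.
    exact: (@scale1r S' I).
  by rewrite !raddfD /= IHs IHt.
elim/tens_ind => [|t x|s t IHs IHt]; [by rewrite !raddf0| |by rewrite !raddfD /= IHs IHt].
rewrite [X in uncancel X]tens_liftE /=.
elim/bc_ind: t => [|m a|t t' IHt IHt'].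
- by rewrite /cancel_fun raddf0 raddf0; exact/esym/tpure0l.
- rewrite /cancel_fun tens_mapE uncancelE /uncancel_fun /= /scale_vec -tpureZ.
  by congr tpure; rewrite [LHS]bc_inrE mulr1.
- by rewrite cancel_funDl raddfD /= IHt IHt'; exact/esym/tpureDl.
Qed.

End Cancel.

(** Under the cancellation isomorphism, tensoring [f] over [S'] with the base change of [M] is
    tensoring it over [S] with [M]. *)
Lemma flat_base_change (M : lmodType R) :
  flat_module (restr h M) -> flat_module (restr (bc_inr h g) (base_change h g M)).
Proof.
move=> M_flat U V f f_inj; apply: raddf_inj0 => x fx0.
have [inv _ invK] := uncancel_bij M U.
pose f_S : {linear restr g U -> restr g V} :=
  HB.pack (f : restr g U -> restr g V)
    (GRing.isLinear.Build S (restr g U) (restr g V) *:%R f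
      (fun a : S => linearP f (g a))).
have nat_f y : uncancel (tens_map (idfun : {linear restr h M -> restr h M}) f_S y)
    = tens_map idfun f (uncancel y).
  elim/tens_ind: y => [|m u|y z IHy IHz]; first by rewrite !raddf0.
    by rewrite tens_mapE !uncancelE [RHS]tens_mapE.
  by rewrite !raddfD /= IHy IHz.
rewrite -(invK x) (inj_raddf0 (M_flat _ _ f_S f_inj) (x := inv x)) ?raddf0 //.
by apply: (inj_raddf0 (bij_inj (uncancel_bij M V))); rewrite /= nat_f invK.
Qed.

Section Regular.
Variable I : lmodType S'.

(* The two sides carry the same scalar action but different module axioms. *)
Definition bc_regular (t : restr (bc_inr h g) (base_change h g R^o)) :
  restr (bc_inr h g) (bc_ring h g)^o := t.

Lemma bc_regular_is_linear : linear bc_regular. Proof. by []. Qed.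

Definition bc_regular_linear := linear_pack bc_regular_is_linear.

Lemma bc_regular_bij : bijective bc_regular_linear. Proof. by exists id. Qed.

Lemma flat_hom_base_change : flat_hom h -> flat_hom (bc_inr h g).
Proof.
exact: (fun h_flat => flat_iso bc_regular_bij (@flat_base_change R^o h_flat)).
Qed.

Definition extend_uncancel (t : extend h (restr g I)) :
    restr (bc_inl h g) (extend (bc_inr h g) I) :=
  tens_map bc_regular_linear (idfun : {linear I -> I}) (@uncancel R^o I t).

Lemma extend_uncancelE r (x : I) :
  extend_uncancel (extend_pure h r (x : restr g I))
  = extend_pure (bc_inr h g) (bc_inl h g r) x.
Proof. by rewrite /extend_uncancel [uncancel _]uncancelE tens_mapE. Qed.

Lemma extend_uncancelD x y :
  extend_uncancel (x + y) = extend_uncancel x + extend_uncancel y.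
Proof.
by rewrite /extend_uncancel [uncancel _](raddfD (@uncancel R^o I)) raddfD.
Qed.

Lemma extend_uncancel0 : extend_uncancel 0 = 0.
Proof. by apply: (addIr (extend_uncancel 0)); rewrite -extend_uncancelD !add0r. Qed.

Lemma extend_uncancel_is_linear : linear extend_uncancel.
Proof.
move=> a x y; rewrite extend_uncancelD; congr (_ + _).
elim/extend_ind: x => [|r u|x x' IHx IHx'].
- by rewrite scaler0 extend_uncancel0 scaler0.
- rewrite extend_pureZl !extend_uncancelE.
  rewrite -[RHS]/(bc_inl h g a *: extend_pure (bc_inr h g) _ _) extend_pureZl.
  by rewrite rmorphM.
- by rewrite scalerDr !extend_uncancelD IHx IHx' scalerDr.
Qed.

HB.instance Definition _ := GRing.isLinear.Build R (extend h (restr g I))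
  (restr (bc_inl h g) (extend (bc_inr h g) I)) *:%R extend_uncancel
  extend_uncancel_is_linear.

Lemma extend_uncancel_bij : bijective extend_uncancel.
Proof. exact: (bij_comp (tens_map_bij bc_regular_bij I) (uncancel_bij R^o I)). Qed.

Lemma exact_at_extend_bc m n l (D : 'M[R]_(m, n))
    (E : 'M[R]_(l, m)) :
  exact_at (extend (bc_inr h g) I) (map_mx (bc_inl h g) D) (map_mx (bc_inl h g) E)
  <-> exact_at (extend h (restr g I)) D E.
Proof.
by rewrite -exact_at_restr (exact_at_isoE D E extend_uncancel_bij).
Qed.

End Regular.
End BaseChangeIso.

(** * Coherence and free resolutions *)

Section Coherent.
Variable A : comPzRingType.

Definition fin_gen_relations (V : lmodType A) k (c : 'I_k -> V) :=
  exists n (r : 'I_n -> ('I_k -> A^o)),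
    forall x, lincomb c x = 0 <-> exists w, x = lincomb r w.

Lemma lincomb_lincomb (V : lmodType A) m n (c : 'I_m -> V)
    (r : 'I_n -> ('I_m -> A^o)) w :
  lincomb c (lincomb r w) = lincomb (lincomb c \o r) w.
Proof. exact: (linear_lincomb (lincomb c)). Qed.

(** The span of [c] has some finite presentation; the point is to pass from its generators to the
    given ones. *)
Lemma coherent_relations (V : lmodType A) k (c : 'I_k -> V) :
  coherent_module V -> fin_gen_relations c.
Proof.
move=> [_ coh]; pose W := im (lincomb c).
have c_in j : c j \in W by apply/imP; exists (delta j); rewrite /= lincomb_delta.
pose cW j : submod W := Sub (c j) (c_in j).
have inclcW : @incl _ _ W \o cW = c by apply/funext => j; rewrite /= /incl SubK.
have [|n [f [f_surj [N [ker_gen ker_genP]]]]] := coh W.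
  exists k, cW => x; have /imP[a xa] := incl_in x; exists a; apply: incl_inj.
  rewrite xa -[in LHS]inclcW; symmetry.
  exact: (linear_lincomb (@incl _ _ W) cW).
pose t j := projT1 (cid ((imP (lincomb c) _).1 (incl_in (f (delta_mx 0 j))))).
have tE j : incl (f (delta_mx 0 j)) = lincomb c (t j) by rewrite /t; case: cid.
pose row_fun (r : 'rV[A]_n) : 'I_n -> A^o := fun j => r 0 j.
have row_funE : linear row_fun.
  by move=> a r r'; apply/funext => j; rewrite /row_fun !mxE.
pose rowF : {linear 'rV[A]_n -> ('I_n -> A^o)} :=
  HB.pack row_fun (GRing.isLinear.Build A _ _ *:%R row_fun row_funE).
pose tau : {linear 'rV[A]_n -> ('I_k -> A^o)} := lincomb t \o rowF.
have tauE r : lincomb c (tau r) = incl (f r).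
  rewrite /tau /= lincomb_lincomb {2}[r]row_sum_delta !linear_sum.
  by apply: eq_bigr => j _; rewrite !linearZ /= tE.
pose g j := projT1 (cid (f_surj (cW j))).
have gE j : f (g j) = cW j by rewrite /g; case: cid.
(* [tau] rewrites the generators of the presentation through [c], and [g i] lifts [c i] to the
   presentation. The relations come from going there and back, and from translating the old
   relations. *)
pose r (j : 'I_(k + N)) : 'I_k -> A^o := match fintype.split j with
  | inl i => delta i - tau (g i) | inr i => tau (incl (ker_gen i)) end.
have rE w : lincomb r w = lincomb (fun i => delta i - tau (g i)) (w \o @lshift k N)
    + lincomb (fun i => tau (incl (ker_gen i))) (w \o @rshift k N).
  rewrite /lincomb big_split_ord; congr (_ + _); apply: eq_bigr => i _;
    by rewrite /r /= (unsplitK (inl _)) || rewrite /r /= (unsplitK (inr _)).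
exists (k + N)%N, r => x; split=> [cx|[w ->]].
  pose s := \sum_i (x i : A) *: g i.
  have s_ker : s \in submodule_pred (ker f).
    rewrite inE; apply/eqP; apply: incl_inj; rewrite [incl 0]linear0 -cx.
    rewrite -inclcW -linear_lincomb; congr incl.
    by rewrite linear_sum; apply: eq_bigr => i _; rewrite linearZ /= gE.
  have [y sy] := ker_genP (Sub s s_ker).
  have {}sy : s = \sum_i y i *: incl (ker_gen i).
    have := congr1 (@incl _ _ _) sy; rewrite linear_sum {1}/incl SubK => ->.
    by apply: eq_bigr => i _; rewrite linearZ.
  exists (fun j => match fintype.split j with inl i => x i | inr i => y i end).
  rewrite rE [X in lincomb _ X + _](_ : _ = x); last first.
    by apply/funext => i /=; rewrite (unsplitK (inl i)).
  rewrite [X in _ + lincomb _ X](_ : _ = y); last first.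
    by apply/funext => i /=; rewrite (unsplitK (inr i)).
  rewrite -[lincomb _ y](linear_lincomb tau) [lincomb _ y](_ : _ = s) //.
  rewrite {1}[x]family_delta /s linear_sum /lincomb -big_split.
  by apply: eq_bigr => i _; rewrite linearZ /= -scalerDr subrK.
rewrite rE linearD /= !lincomb_lincomb [X in lincomb X _ + _](_ : _ = 0).
  rewrite [X in _ + lincomb X _](_ : _ = 0).
    by rewrite /lincomb !big1 ?addr0 // => i _; exact: scaler0.
  apply/funext => i; rewrite /= tauE.
  have := incl_in (ker_gen i); rewrite inE => /eqP ->; exact: linear0.
apply/funext => i; rewrite /= linearB /= tauE gE lincomb_delta.
by rewrite /incl SubK subrr.
Qed.

Lemma lincomb_at (V : lmodType A) k m (c : 'I_k -> ('I_m -> V)) x i :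
  lincomb c x i = lincomb (fun j => c j i) x.
Proof. by rewrite /lincomb fct_sumE. Qed.

(* K is the membership predicate of a submodule of A, pulled back along c. *)
Lemma family_relations (K : A -> Prop) :
  (forall k (c : 'I_k -> A^o), exists n (r : 'I_n -> ('I_k -> A^o)),
     forall x, K (lincomb c x) <-> exists w, x = lincomb r w) ->
  forall k m (c : 'I_k -> ('I_m -> A^o)), exists n (r : 'I_n -> ('I_k -> A^o)),
     forall x, (forall i, K (lincomb c x i)) <-> exists w, x = lincomb r w.
Proof.
move=> K_fg k m; elim: m k => [|m IHm] k c.
  exists k, delta => x; split=> [_|_]; first by exists x; exact: family_delta.
  by move=> [].
have [n [r rP]] := K_fg k (fun j => c j ord0).
have [n' [r' r'P]] := IHm n (fun j i => lincomb c (r j) (lift ord0 i)).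
exists n', (lincomb r \o r') => x; split=> [cx|[w ->]].
  have /rP[w xw] : K (lincomb (fun j => c j ord0) x) by rewrite -lincomb_at.
  have /r'P[w' ww'] i : K (lincomb (fun j i => lincomb c (r j) (lift ord0 i)) w i).
    by have := cx (lift ord0 i); rewrite xw lincomb_lincomb !lincomb_at.
  by exists w'; rewrite xw ww' lincomb_lincomb.
rewrite -lincomb_lincomb => i.
have [j ->|->] := unliftP ord0 i; last by rewrite lincomb_at; apply/rP; eexists.
rewrite lincomb_lincomb lincomb_at.
have /(_ j) : forall i,
    K (lincomb (fun j i => lincomb c (r j) (lift ord0 i)) (lincomb r' w) i).
  by apply/r'P; exists w.
by rewrite lincomb_at.
Qed.

Hypothesis A_coh : coherent_ring A.

Lemma coherent_family_relations k m (c : 'I_k -> ('I_m -> A^o)) :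
  fin_gen_relations c.
Proof.
have K_fg k' (c' : 'I_k' -> A^o) := coherent_relations c' A_coh.
have [n [r rP]] := @family_relations (fun a => a = 0) K_fg k m c.
exists n, r => x; rewrite -rP; split=> [-> //|cx0].
exact/funext.
Qed.

Definition is_kernel (V : lmodType A) k n (f : ('I_k -> A^o) -> V)
    (G : 'M[A]_(k, n)) := forall x, f x = 0 <-> exists w, x = mxact G w.

Lemma relations_kernel (V : lmodType A) k (c : 'I_k -> V) :
  fin_gen_relations c -> exists n (G : 'M[A]_(k, n)), is_kernel (lincomb c) G.
Proof.
move=> [n [r rP]]; exists n, (\matrix_(i, j) r j i) => x; rewrite rP.
have E w : lincomb r w = mxact (\matrix_(i, j) r j i) w.
  by apply/funext => i; rewrite lincomb_at; apply: eq_bigr => j _; rewrite mxE; exact: mulrC.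
by split=> -[w ->]; exists w; rewrite E.
Qed.

Lemma mxact_kernel k m (D : 'M[A]_(m, k)) :
  exists n (G : 'M[A]_(k, n)), is_kernel (mxact D : _ -> ('I_m -> A^o)) G.
Proof.
have [n [G GP]] := relations_kernel
  (coherent_family_relations (fun j i => D i j : A^o)).
exists n, G => x; rewrite -GP; suff -> : lincomb (fun j i => D i j : A^o) x = mxact D x by [].
by apply/funext => i; rewrite lincomb_at; apply: eq_bigr => j _; exact: mulrC.
Qed.

Lemma is_kernel_mul k m n (D : 'M[A]_(m, k)) (G : 'M[A]_(k, n)) :
  is_kernel (mxact D : _ -> ('I_m -> A^o)) G -> D *m G = 0.
Proof.
move=> kerG; apply/matrixP => i j.
have : mxact D (mxact G (delta j)) = 0 :> (_ -> A^o) by apply/kerG; exists (delta j).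
rewrite -mxactM => /(congr1 (fun F => F i)) DG0; rewrite [RHS]mxE -[RHS]DG0.
rewrite /mxact (bigD1 j) //= /delta eqxx big1 ?addr0; first exact/esym/mulr1.
by move=> l /negbTE ->; exact: mulr0.
Qed.

(** Sizes travel with the matrix, since each kernel chooses its own number of columns. *)
Record packed_matrix := PackMatrix {
  pm_rows : nat; pm_cols : nat; pm_mx : 'M[A]_(pm_rows, pm_cols) }.

Lemma kernel_resolution (V : lmodType A) k n (f : ('I_k -> A^o) -> V)
    (G : 'M[A]_(k, n)) :
  is_kernel f G ->
  exists (p : nat -> nat) (C : 'M[A]_(k, p 0%N)) (D : forall i, 'M[A]_(p i, p i.+1)),
    [/\ is_kernel f C, is_kernel (mxact C : _ -> ('I_k -> A^o)) (D 0%N) &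
        forall i, is_kernel (mxact (D i) : _ -> ('I_(p i) -> A^o)) (D i.+1)].
Proof.
move=> kerG.
pose next x := PackMatrix (projT1 (cid (projT2 (cid (mxact_kernel (pm_mx x)))))).
pose x := nat_rect (fun=> packed_matrix) (next (PackMatrix G)) (fun=> next).
have nextP y : is_kernel (mxact (pm_mx y) : _ -> (_ -> A^o)) (pm_mx (next y)).
  exact: (projT2 (cid (projT2 (cid (mxact_kernel (pm_mx y)))))).
exists (fun i => pm_rows (x i)), G, (fun i => pm_mx (x i)); split=> [//||i].
  exact: (nextP (PackMatrix G)).
exact: (nextP (x i)).
Qed.

End Coherent.

(** * Ideals and residue fields *)

Section Ideals.
Variable A : comPzRingType.
Notation ideal := (submodule (A^o : lmodType A)).

Lemma submodule_ext (V : lmodType A) (W W' : submodule V) : W =i W' -> W = W'.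
Proof.
case: W W' => [W Wc] [W' Wc'] /= eqW.
have {}eqW : W = W' by apply/funext => x; exact: eqW.
by case: _ / eqW in Wc' *; congr Submodule; exact: Prop_irrelevance.
Qed.

Definition adjoin_pred (J : ideal) (a : A) : {pred A^o} :=
  [pred x | `[< exists r : A, (x - r * a : A^o) \in J >]].

Fact adjoin_closed J a : submod_closed (adjoin_pred J a).
Proof.
split=> [|b x y]; rewrite !inE.
  by apply/asboolP; exists 0; rewrite mul0r subr0 rpred0.
move=> /asboolP[r xr] /asboolP[t yt]; apply/asboolP; exists (b * r + t).
have -> : b *: x + y - (b * r + t) * a = b *: (x - r * a : A^o) + (y - t * a).
  rewrite -[b *: x]/(b * x) -[b *: (x - _)]/(b * (x - r * a)).
  by rewrite mulrBr mulrDl mulrA opprD addrACA.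
by apply: rpredD => //; exact: rpredZ.
Qed.

Definition adjoin J a : ideal := Submodule (adjoin_closed J a).

Lemma adjoinP (J : ideal) (a x : A) :
  (x \in adjoin J a) <-> exists r : A, (x - r * a : A^o) \in J.
Proof. by rewrite inE; split=> /asboolP. Qed.

Lemma sub_adjoin (J : ideal) (a x : A) : x \in J -> x \in adjoin J a.
Proof. by move=> xJ; apply/adjoinP; exists 0; rewrite mul0r subr0. Qed.

Lemma mem_adjoin (J : ideal) (a : A) : a \in adjoin J a.
Proof. by apply/adjoinP; exists 1; rewrite mul1r subrr rpred0. Qed.

Lemma idealMl (J : ideal) (a b : A) : b \in J -> a * b \in J.
Proof. by move=> bJ; apply: (rpredZ a). Qed.

(** Zorn's lemma; maximality is recorded as invertibility modulo [m] of everything outside [m]. *)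
Lemma maximal_ideal_ex (J : ideal) : 1 \notin J ->
  exists m : ideal, [/\ 1 \notin m, {subset J <= m} &
    forall a, a \notin m -> exists r : A, (1 - r * a : A^o) \in m].
Proof.
move=> J1; pose T := {W : ideal | 1 \notin W /\ {subset J <= W}}.
pose R (U W : T) := `[< {subset sval U <= sval W} >].
have [|||[m [m1 Jm]] m_max] := @ZL_preorder T (exist _ J (conj J1 (fun x xJ => xJ)) : T) R.
- by move=> U; exact/asboolP.
- by move=> U V W /asboolP UV /asboolP VW; apply/asboolP => x /UV/VW.
- move=> F F_total.
  have [[U0 FU0]|F0] := pselect (exists U, F U); last first.
    exists (exist _ J (conj J1 (fun x xJ => xJ)) : T) => U FU.
    by exfalso; apply: F0; exists U.
  pose P : {pred A^o} := [pred x | `[< exists2 U, F U & x \in sval U >]].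
  have P_closed : submod_closed P.
    split=> [|a x y]; rewrite !inE; first by apply/asboolP; exists U0; rewrite ?rpred0.
    move=> /asboolP[U FU xU] /asboolP[V FV yV]; apply/asboolP.
    have [/asboolP UV|/asboolP VU] := F_total _ _ FU FV.
      by exists V => //; apply: rpredD => //; apply: rpredZ; exact: UV.
    by exists U => //; apply: rpredD; [exact: rpredZ|exact: VU].
  have P_ok : 1 \notin Submodule P_closed /\ {subset J <= Submodule P_closed}.
    split; last by move=> x xJ; rewrite inE; apply/asboolP; exists U0 => //; exact: (svalP U0).2.
    by rewrite inE; apply/asboolP => -[U FU U1]; have := (svalP U).1; rewrite U1.
  exists (exist _ (Submodule P_closed) P_ok : T) => U FU; apply/asboolP => x xU /=.
  by rewrite inE; apply/asboolP; exists U.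
exists m; split=> // a am; apply: contrapT => no_r.
have am1 : 1 \notin adjoin m a by apply/negP => /adjoinP.
have Jam : {subset J <= adjoin m a} by move=> x /Jm; exact: sub_adjoin.
have /asboolP := m_max (exist _ (adjoin m a) (conj am1 Jam) : T) (introT (asboolP _) (@sub_adjoin m a)).
by move=> /(_ a (mem_adjoin m a)); apply/negP.
Qed.

Lemma spec_ext (p q : spec A) : prime_of p = prime_of q -> p = q.
Proof.
case: p q => [P p1 pP] [Q q1 qP] /= PQ; subst Q.
by congr Spec; exact: Prop_irrelevance.
Qed.

Lemma closed_point_ex (J : ideal) : 1 \notin J ->
  exists2 m : spec A, closed_point m & {subset J <= prime_of m}.
Proof.
move=> /maximal_ideal_ex[m [m1 Jm m_max]].
have m_prime (a b : A) : a * b \in m -> a \in m \/ b \in m.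
  move=> abm; have [am|/m_max[r rm]] := boolP (a \in m); [by left|right].
  have -> : b = r * (a * b) + (b * (1 - r * a)).
    by rewrite mulrBr mulr1 mulrA [r * a * b]mulrC subrKC.
  by apply: rpredD; exact: idealMl.
exists (Spec m1 m_prime) => //; exists [set a | a \in m]%classic.
apply/predeqP => q; split=> [-> //|mq].
have qm : prime_of q = m.
  apply: submodule_ext => x; apply/idP/idP => [xq|]; last exact: mq.
  apply: contrapT => /negP/m_max[r /mq rq].
  apply/negP: (prime_proper q); rewrite negbK -(subrK (r * x) 1).
  by apply: rpredD => //; exact: idealMl.
exact: spec_ext.
Qed.

(** A counterexample would start a strictly increasing sequence of ideals, while the finitely many
    generators of its union already lie in one term. *)
Lemma noetherian_ind (P : ideal -> Prop) : noetherian_ring A ->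
  (forall J : ideal, (forall J' : ideal, {subset J <= J'} -> (exists2 a, a \in J' & a \notin J) ->
     P J') -> P J) -> forall J, P J.
Proof.
move=> noeth step J0; apply: contrapT => notP0.
have [|J [_ JS]] := @dependent_choice (fun=> {J : ideal | ~ P J})
  (fun _ J J' => {subset sval J <= sval J'} /\ exists2 a, a \in sval J' & a \notin sval J)
  (exist _ J0 notP0).
  move=> _ [J notP]; apply: contrapT => no_next; apply: (notP); apply: step => J' JJ' neq.
  by apply: contrapT => notP'; apply: no_next; exists (exist _ J' notP').
have J_mono i j : (i <= j)%N -> {subset sval (J i) <= sval (J j)}.
  elim: j => [|j IHj]; first by rewrite leqn0 => /eqP ->.
  rewrite leq_eqVlt => /predU1P[-> //|/IHj ij] x /ij; exact: (JS j).1.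
pose U : {pred A^o} := [pred x | `[< exists i, x \in sval (J i) >]].
have U_closed : submod_closed U.
  split=> [|a x y]; rewrite !inE; first by apply/asboolP; exists 0%N; rewrite rpred0.
  move=> /asboolP[i xi] /asboolP[j yj]; apply/asboolP; exists (maxn i j).
  apply: rpredD; last exact: J_mono (leq_maxr _ _) _ yj.
  by apply: rpredZ; exact: J_mono (leq_maxl _ _) _ xi.
have [n [v v_gen]] := noeth (Submodule U_closed).
have v_in j : exists i, incl (v j) \in sval (J i).
  by have := incl_in (v j); rewrite inE => /asboolP.
pose bound := \max_j projT1 (cid (v_in j)).
have v_bound j : incl (v j) \in sval (J bound).
  by apply: (J_mono (projT1 (cid (v_in j)))); [exact: leq_bigmax | case: cid].
have [_ [a aS /negP]] := JS bound; apply.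
have aU : a \in Submodule U_closed by rewrite inE; apply/asboolP; exists bound.+1.
have [c] := v_gen (Sub a aU); move=> /(congr1 (@incl _ _ _)).
rewrite {1}/incl SubK linear_sum => ->; apply: rpred_sum => j _.
rewrite linearZ; apply: rpredZ; exact: v_bound.
Qed.

End Ideals.

Lemma fraction_quotient (D : idomainType) (y : {fraction D}) :
  exists n d : D, d != 0 /\ tofrac d * y = tofrac n.
Proof.
elim/quotW: y => x; exists x.1, x.2; split; first exact: denom_ratioP.
unlock FracField.tofrac; rewrite -[LHS]FracField.pi_mul; apply/eqmodP => /=.
rewrite FracField.equivfE /FracField.mulf !numden_Ratio ?oner_eq0 ?mul1r ?denom_ratioP //.
by rewrite mulr1.
Qed.

Section ResidueField.
Variables (A : comPzRingType) (s : spec A).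

Lemma residue_map_eq0 (a : A) : residue_map s a = 0 <-> a \in prime_of s.
Proof.
rewrite -quot_ring_proj_eq0.
rewrite -[residue_map s a]/(@tofrac (residue_domain s) (quot_ring_proj (prime_of s) a)).
split=> [/eqP|->]; first by rewrite tofrac_eq0 => /eqP.
exact: (tofrac0 (residue_domain s)).
Qed.

Lemma residue_field_frac (y : residue_field s) :
  exists a b : A, a \notin prime_of s /\ residue_map s a * y = residue_map s b.
Proof.
have [n [d [d0 yd]]] := fraction_quotient y.
have [a da] := quot_ring_projP d; have [b nb] := quot_ring_projP n.
exists a, b; split; last by move: yd; rewrite da nb.
apply/negP => /quot_ring_proj_eq0 a0; move: d0.
by rewrite da -[X in X != _]/(quot_ring_proj (prime_of s) a) a0 eqxx.
Qed.

End ResidueField.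

(** * Exactness from fibres *)

Section Cyclic.
Variables (S R : comPzRingType) (h : {rmorphism S -> R}).
Hypotheses (S_noeth : noetherian_ring S) (R_coh : coherent_ring R).
Variable T : tensor_functor h.

Lemma pure_familyD (I : lmodType S) p (c d : 'I_p -> R^o) (x : I) :
  pure_family T (c + d) x = pure_family T c x + pure_family T d x.
Proof. by apply/funext => i; exact: tf_pureDl. Qed.

Lemma pure_familyZ (I : lmodType S) p (a : R) (c : 'I_p -> R^o) (x : I) :
  pure_family T (a *: c) x = a *: pure_family T c x.
Proof. by apply/funext => i; exact/esym/tf_pureZl. Qed.

Lemma pure_familyB (I : lmodType S) p (c d : 'I_p -> R^o) (x : I) :
  pure_family T (c - d) x = pure_family T c x - pure_family T d x.
Proof. by rewrite -[in RHS]scaleN1r -pure_familyZ -pure_familyD scaleN1r. Qed.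

Lemma pure_family_scale (I : lmodType S) p (a : S) (c : 'I_p -> R^o) (x : I) :
  pure_family T (h a *: c) x = pure_family T c (a *: x).
Proof. by apply/funext => i; exact: tf_pureZ. Qed.

Lemma pure_family0r (I : lmodType S) p (c : 'I_p -> R^o) :
  pure_family T c (0 : I) = 0.
Proof. by apply/funext => i; exact: tf_pure0r. Qed.

Variables (I : lmodType S) (u : I).
Hypothesis u_gen : forall x : I, exists a : S, x = a *: u.

Lemma cyclic_family p (v : 'I_p -> T I) : exists c, v = pure_family T c u.
Proof.
elim/family_ind: v => [|c x|v w [c ->] [d ->]].
- by exists 0; apply/funext => i; exact/esym/tf_pure0l.
- by have [a ->] := u_gen x; exists (h a *: c); rewrite pure_family_scale.
- by exists (c + d); rewrite pure_familyD.
Qed.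

(** By right exactness this kernel is the ideal of [R] generated by the image of the annihilator of
    [u], which is finitely generated. *)
Lemma cyclic_kernel_fin_gen : exists k (d : 'I_k -> R^o),
  forall r : R, tf_pure T r u = 0 <-> exists w, r = lincomb d w.
Proof.
pose J := ker (scale_by u).
have [k [j j_gen]] := S_noeth J; exists k, (fun i => h (incl (j i))) => r.
have j_ann i : incl (j i) *: u = 0.
  by have := incl_in (j i); rewrite inE => /eqP.
split=> [ru0|[w ->]]; last first.
  rewrite /lincomb [X in tf_pure _ X](_ : _ = \sum_i h (incl (j i)) * (w i : R)).
    elim: (index_enum _) => [|i s IHs]; first by rewrite big_nil; exact: tf_pure0l.
    rewrite big_cons tf_pureDl IHs addr0 tf_pureZ j_ann; exact: tf_pure0r.
  by apply: eq_bigr => i _; exact: mulrC.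
have J_ker s : scale_by u s = 0 -> exists t, s = @incl _ _ J t.
  by move=> su; apply: inclP; rewrite inE; apply/eqP.
have u_surj (x : I) : exists a, x = scale_by u a by exact: u_gen.
have [|t rt] := tf_right_exact (t0 := T) u_surj J_ker (t := tf_unit T r).
  by rewrite tf_mapE -[X in tf_pure _ _ X]/(1 *: u) scale1r.
have : exists w, tf_map T (@incl _ _ J) t
    = tf_unit T (lincomb (fun i => h (incl (j i)) : R^o) w).
  elim/tf_ind: t {rt} => [|b x|x y [w xw] [w' yw']].
  - by exists 0; rewrite !linear0.
  - have [c ->] := j_gen x; exists (fun i => b * h (c i)); rewrite tf_mapE.
    rewrite (linear_sum (@incl _ _ J)) /lincomb (linear_sum (tf_unit T)) /=.
    elim: (index_enum _) => [|i s IHs]; first by rewrite !big_nil; exact: tf_pure0r.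
    rewrite !big_cons tf_pureDr IHs; congr (_ + _); rewrite /tf_unit linearZ /=.
    rewrite -tf_pureZ -[X in _ = tf_pure _ (X : R) _]/(b * h (c i) * h (incl (j i))).
    rewrite -[incl (j i) in LHS]mulr1 -[in LHS]/(incl (j i) *: (1 : S^o)) -tf_pureZ.
    by congr tf_pure; rewrite mulrC [h _ * b]mulrC.
  - by exists (w + w'); rewrite !linearD /= xw yw'.
by move=> [w tw]; exists w; apply: (bij_inj (tf_unit_bij T : bijective (tf_unit T))); rewrite -tw -rt.
Qed.

(** The condition says that each coordinate of [E x] lies in the finitely generated ideal killing
    [u]; coherence of [R] makes the solutions finitely generated. *)
Lemma cocycles_fin_gen l m (E : 'M[R]_(l, m)) : exists n (z : 'I_n -> ('I_m -> R^o)),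
  forall x, mxact E (pure_family T x u) = 0 <-> exists w, x = lincomb z w.
Proof.
have [k [d dP]] := cyclic_kernel_fin_gen.
pose K r := tf_pure T r u = 0.
have K_fg p (c : 'I_p -> R^o) : exists n (r : 'I_n -> ('I_p -> R^o)),
    forall x, K (lincomb c x) <-> exists w, x = lincomb r w.
  (* A combination of [c] lies in the ideal spanned by [d] exactly when it extends to a relation
     between [c] and [d] together; keep the first [p] coordinates of those relations. *)
  pose cd (i : 'I_(p + k)) := match fintype.split i with inl j => c j | inr j => d j end.
  have cdE x : lincomb cd x = lincomb c (x \o @lshift p k) + lincomb d (x \o @rshift p k).
    rewrite /lincomb big_split_ord; congr (_ + _); apply: eq_bigr => i _;
      by rewrite /cd /= (unsplitK (inl _)) || rewrite /cd /= (unsplitK (inr _)).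
  have [n [r rP]] := coherent_relations cd R_coh.
  exists n, (fun j => r j \o @lshift p k) => x.
  have rlE w : lincomb (fun j => r j \o @lshift p k) w = lincomb r w \o @lshift p k.
    by apply/funext => i; rewrite /= !lincomb_at.
  rewrite /K dP; split=> [[w xw]|[w ->]].
    pose y (i : 'I_(p + k)) := match fintype.split i with inl j => x j | inr j => - w j end.
    have [|v yv] := (rP y).1.
      rewrite cdE [X in lincomb c X + _](_ : _ = x); last first.
        by apply/funext => i /=; rewrite /y (unsplitK (inl i)).
      rewrite [X in _ + lincomb d X](_ : _ = - w); last first.
        by apply/funext => i /=; rewrite /y (unsplitK (inr i)).
      by rewrite [lincomb d (- w)]linearN /= -xw subrr.
    exists v; rewrite rlE -yv.
    by apply/funext => i /=; rewrite /y (unsplitK (inl i)).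
  rewrite rlE; exists (- (lincomb r w \o @rshift p k)); rewrite [RHS]linearN.
  by apply/eqP; rewrite -addr_eq0 -cdE; apply/eqP/rP; exists w.
have [n [z zP]] := family_relations K_fg (fun j i => E i j : R^o).
exists n, z => x; rewrite -zP mxact_pure_family.
have -> : lincomb (fun j i => E i j : R^o) x = mxact E x.
  by apply/funext => i; rewrite lincomb_at; apply: eq_bigr => j _; exact: mulrC.
split=> [Ex i|Ex]; last by apply/funext => i; exact: Ex.
exact: (congr1 (fun F => F i) Ex).
Qed.

End Cyclic.

Section FibreCriterion.
Variables (S R : comPzRingType) (h : {rmorphism S -> R}).
Hypotheses (S_noeth : noetherian_ring S) (R_coh : coherent_ring R).
Variable T : tensor_functor h.
Hypothesis T_flat : flat_functor T.
Variables (m k l : nat) (D : 'M[R]_(m, k)) (E : 'M[R]_(l, m)).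
Hypothesis ED0 : E *m D = 0.
Notation kappa s := (restr (residue_map s) (residue_field s : comPzRingType)^o).
Hypothesis fibre_ex : forall s : spec S,
  (spec_map h @` @closed_point R)%classic s -> exact_at (T (kappa s)) D E.

Section Denominators.
Variables (s : spec S) (I K : lmodType S) (f : {linear I -> K}).
Hypothesis f_dense : forall y : K, exists (a : S) x,
  a \notin prime_of s /\ a *: y = f x.

Lemma residue_mem (a b : S) : a \notin prime_of s -> b \notin prime_of s ->
  a * b \notin prime_of s.
Proof.
by move=> /negP a_s /negP b_s; apply/negP => /prime_mem[].
Qed.

(** A tensor is a finite sum, and products of elements outside the prime [s] stay outside, so a
    common denominator exists. *)
Lemma clear_denominator (t : T K) :
  exists (a : S) (t' : T I), a \notin prime_of s /\ h a *: t = tf_map T f t'.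
Proof.
elim/tf_ind: t => [|r y|x y [a [x' [a_s xE]]] [b [y' [b_s yE]]]].
- by exists 1, 0; rewrite prime_proper scaler0 linear0.
- have [a [x [a_s ay]]] := f_dense y; exists a, (tf_pure T r x); split=> //.
  by rewrite tf_pureZl tf_pureZ tf_mapE ay.
- exists (a * b), (h b *: x' + h a *: y'); split; first exact: residue_mem.
  rewrite [RHS]linearD /= !linearZ /= -xE -yE !scalerA -!rmorphM [b * a]mulrC.
  exact: scalerDr.
Qed.

Lemma clear_denominators p (v : 'I_p -> T K) :
  exists (a : S) (w : 'I_p -> T I),
    a \notin prime_of s /\ h a *: v = tf_map T f \o w.
Proof.
elim: p v => [|p IHp] v.
  by exists 1, 0; rewrite prime_proper; split=> //; apply/funext => -[].
have [a [w [a_s vw]]] := IHp (fun i => v (lift ord0 i)).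
have [b [t [b_s v0t]]] := clear_denominator (v ord0).
exists (a * b), (fun i => if unlift ord0 i is Some j then h b *: w j else h a *: t).
split; first exact: residue_mem.
apply/funext => i /=; rewrite -[LHS]/(h (a * b) *: v i) rmorphM.
case: unliftP => [j ->|->]; rewrite linearZ /=; last by rewrite -v0t scalerA.
by rewrite -[tf_map _ _ _](congr1 (fun F => F j) vw) scalerA mulrC.
Qed.

End Denominators.

Section Core.
Variables (I : lmodType S) (u : I).
Hypothesis u_gen : forall x : I, exists a : S, x = a *: u.
Hypothesis u_prime : forall a b : S,
  (a * b) *: u = 0 -> a *: u = 0 \/ b *: u = 0.
Hypothesis quot_ex : forall a : S, a *: u != 0 ->
  exact_at (T (quotmod (im (scale_by (a *: u))))) D E.

Definition coboundary (x : 'I_m -> R^o) :=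
  exists w, pure_family T x u = mxact D w.

(** Multiplication by [a] is injective on [I] since the annihilator of [u] is prime, and its
    cokernel has no cohomology by [quot_ex]. So [a] acts surjectively on the cohomology over [I]. *)
Lemma divide_cocycle (a : S) (x : 'I_m -> R^o) :
  a *: u != 0 -> mxact E (pure_family T x u) = 0 ->
  exists y, mxact E (pure_family T y u) = 0 /\ coboundary (x - h a *: y).
Proof.
move=> au Ex.
pose f : {linear I -> I} := a \*: (idfun : {linear I -> I}).
have f_inj : injective f.
  apply: raddf_inj0 => y; have [b ->] := u_gen y.
  by rewrite /= scalerA => /u_prime[] // au0; rewrite au0 eqxx in au.
pose W := im (scale_by (a *: u)).
have f_ex y : quot_proj W y = 0 -> exists x, y = f x.
  move=> /quot_proj_eq0/imP[b ->]; exists (b *: u).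
  by rewrite /= /scale_by !scalerA mulrC.
have [z [w [Ez xz]]] :=
  cocycle_lift T_flat ED0 f_inj (@quot_proj_surj _ _ W) f_ex (quot_ex au) Ex.
have [y zy] := cyclic_family u_gen z; exists y; split; first by rewrite -zy.
exists w; rewrite pure_familyB pure_familyZ xz.
have -> : tf_map T f \o z = h a *: pure_family T y u; last first.
  by rewrite addrC addKr.
apply/funext => i; rewrite zy -[RHS]/(h a *: tf_pure T (y i) u) /= tf_mapE.
by rewrite tf_pureZl tf_pureZ.
Qed.

(* If z is not in Y, let n be a maximal ideal containing (Y : z). The elements   *)
(* of ann u kill z up to coboundaries, so h maps them into n; the other         *)
(* elements divide every cocycle up to coboundaries, so h maps them outside n.  *)
(* Thus n lies over ann u, where exactness of the fibre gives an a outside      *)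
(* ann u such that h a *: z is a coboundary.                                    *)
Lemma cocycle_mem (Y : submodule ('I_m -> R^o)) (z : 'I_m -> R^o) :
  (forall x, coboundary x -> x \in Y) ->
  mxact E (pure_family T z u) = 0 ->
  (forall x, mxact E (pure_family T x u) = 0 -> exists r : R, x - r *: z \in Y) ->
  z \in Y.
Proof.
move=> cobY Ez cocY; apply: contrapT => /negP zY.
pose Q_pred : {pred R^o} := [pred r : R | r *: z \in Y].
have Q_closed : submod_closed Q_pred.
  split=> [|a x y]; rewrite !inE; first by rewrite scale0r rpred0.
  by move=> xQ yQ; rewrite scalerDl -scalerA rpredD // rpredZ.
have Q1 : 1 \notin Submodule Q_closed by rewrite inE scale1r.
have [n n_closed Qn] := closed_point_ex Q1.
have inQ r : r *: z \in Y -> r \in prime_of n by move=> rz; apply: Qn; rewrite inE.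
pose s := spec_map h n.
have sE a : (a \in prime_of s) = (h a \in prime_of n) by [].
have ann_s a : a *: u = 0 -> a \in prime_of s.
  move=> au; rewrite sE; apply/inQ/cobY; exists 0.
  by rewrite pure_family_scale au pure_family0r linear0.
have s_ann a : a \in prime_of s -> a *: u = 0.
  rewrite sE => a_n; apply/eqP; apply: contrapT => /negP au.
  have [y [Ey cob]] := divide_cocycle au Ez; have [r yr] := cocY y Ey.
  have : (1 - h a * r) \in prime_of n.
    apply: inQ; rewrite scalerBl scale1r -scalerA.
    have -> : z - h a *: (r *: z) = (z - h a *: y) + h a *: (y - r *: z).
      by rewrite scalerBr addrA subrK.
    by apply: rpredD; [exact: cobY | exact: rpredZ].
  move=> har; apply/negP: (prime_proper n); rewrite negbK.
  rewrite -(subrK (h a * r) 1); apply: rpredD => //.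
  by rewrite mulrC; exact: idealMl.
have [coef coefP] : exists coef : I -> S, forall x, x = coef x *: u.
  by exists (fun x => projT1 (cid (u_gen x))) => x; case: cid.
have coef_wd a b : a *: u = b *: u -> residue_map s a = residue_map s b.
  move=> ab; apply/eqP; rewrite -subr_eq0 -rmorphB; apply/eqP/residue_map_eq0/ann_s.
  by rewrite scalerBl ab subrr.
(* [I] is now [S] modulo the prime [s], and [f] embeds it in the residue field, sending [u] to 1. *)
pose f x : kappa s := residue_map s (coef x).
have f_lin : linear f.
  move=> a x y; rewrite -[a *: f x]/(residue_map s a * residue_map s (coef x)).
  rewrite /f -rmorphM -rmorphD; apply: coef_wd.
  by rewrite -coefP scalerDl -scalerA -!coefP.
pose F : {linear I -> kappa s} := HB.pack f (GRing.isLinear.Build _ _ _ *:%R f f_lin).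
have F_inj : injective F.
  apply: raddf_inj0 => x /residue_map_eq0/s_ann; by rewrite -coefP.
have F_dense (y : kappa s) : exists (a : S) x, a \notin prime_of s /\ a *: y = F x.
  have [a [b [a_s ab]]] := residue_field_frac y; exists a, (b *: u); split=> //.
  by apply: etrans ab _; apply: coef_wd; rewrite -coefP.
have exK : exact_at (T (kappa s)) D E by apply: fibre_ex; exists n.
have [|w vw] := exK (tf_map T F \o pure_family T z u).
  by rewrite -linear_mxact Ez; apply/funext => i /=; rewrite linear0.
have [a [w' [a_s aw]]] := clear_denominators F_dense w.
(* Since [F] stays injective after applying [T], the identity found over the residue field already
   holds over [I]. *)
move/negP: a_s; apply; rewrite sE; apply/inQ/cobY; exists w'.
have Fw : tf_map T F \o (h a *: pure_family T z u) = tf_map T F \o mxact D w'.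
  rewrite linear_mxact -aw (linearZZ (mxact D)) /= -vw; apply/funext => i; exact: linearZZ.
rewrite pure_familyZ; apply/funext => i; apply: (T_flat F_inj).
exact: (congr1 (fun G => G i) Fw).
Qed.

Lemma exact_at_cyclic_prime : exact_at (T I) D E.
Proof.
have [n [z zP]] := cocycles_fin_gen S_noeth R_coh T u_gen E.
have z_coc j : mxact E (pure_family T (z j) u) = 0.
  by apply/zP; exists (delta j); rewrite lincomb_delta.
have cob0 : coboundary 0.
  by exists 0; rewrite linear0; apply/funext => i; exact: tf_pure0l.
have cobD a x y : coboundary x -> coboundary y -> coboundary (a *: x + y).
  move=> [w xw] [w' yw]; exists (a *: w + w').
  by rewrite pure_familyD pure_familyZ xw yw linearP.
pose Y_pred (js : seq 'I_n) : {pred 'I_m -> R^o} := [pred x |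
  `[< exists b (c : 'I_n -> R), coboundary b /\ x = b + \sum_(j <- js) c j *: z j >]].
have Y_closed js : submod_closed (Y_pred js).
  split=> [|a x y]; rewrite !inE.
    apply/asboolP; exists 0, (fun=> 0); split=> //.
    by rewrite big1 ?addr0 // => j _; rewrite scale0r.
  move=> /asboolP[b [c [bC ->]]] /asboolP[b' [c' [bC' ->]]]; apply/asboolP.
  exists (a *: b + b'), (fun j => a * c j + c' j); split; first exact: cobD.
  rewrite scalerDr addrACA scaler_sumr -big_split; congr (_ + _).
  by apply: eq_bigr => j _; rewrite scalerDl scalerA.
pose Y js := Submodule (Y_closed js).
have YP js x : x \in Y js <-> exists b (c : 'I_n -> R),
    coboundary b /\ x = b + \sum_(j <- js) c j *: z j.
  by rewrite inE; split=> /asboolP.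
have cobY js x : coboundary x -> x \in Y js.
  move=> xC; apply/YP; exists x, (fun=> 0); split=> //.
  by rewrite big1 ?addr0 // => j _; rewrite scale0r.
have claim js : (forall x, mxact E (pure_family T x u) = 0 -> x \in Y js) ->
    forall x, mxact E (pure_family T x u) = 0 -> x \in Y [::].
  elim: js => [//|j js IHjs] coc; apply: IHjs.
  have sub x : mxact E (pure_family T x u) = 0 -> exists r : R, x - r *: z j \in Y js.
    move=> /coc/YP[b [c [bC ->]]]; exists (c j); apply/YP; exists b, c; split=> //.
    by rewrite big_cons addrCA [X in X - _]addrC addrK.
  have zY : z j \in Y js by apply: cocycle_mem (z_coc j) sub => x; exact: cobY.
  move=> x /sub[r xr]; rewrite -(subrK (r *: z j) x); apply: rpredD => //.
  exact: rpredZ.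
move=> v; have [x ->] := cyclic_family u_gen v => Ex.
have /YP[b [c [[w bw] ->]]] : x \in Y [::].
  apply: (claim (index_enum 'I_n)) Ex => y /zP[c ->]; apply/YP; exists 0, c.
  by rewrite add0r.
by exists w; rewrite big_nil addr0.
Qed.

End Core.

(** Devissage to cyclic modules, then noetherian induction on the annihilator of the generator: all
    cyclic modules with a strictly larger annihilator are already settled. *)
Lemma fibrewise_exact (I : lmodType S) : exact_at (T I) D E.
Proof.
apply: exact_at_devissage => // {}I u u_gen.
have [J JE] : exists J, J = ker (scale_by u) by exists (ker (scale_by u)).
have annP (V : lmodType S) (v : V) a : a \in ker (scale_by v) <-> a *: v = 0.
  by rewrite inE; split=> /eqP.
elim/noetherian_ind: J => [//|J IH] in I u u_gen JE *.
have IHa (V : lmodType S) (v : V) : (forall x : V, exists a : S, x = a *: v) ->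
    (forall a, a *: u = 0 -> a *: v = 0) ->
    (exists2 a, a *: v = 0 & a *: u != 0) -> exact_at (T V) D E.
  move=> v_gen uv [a av au]; apply: (IH (ker (scale_by v)) _ _ _ v) => //.
    by move=> b; rewrite JE => /annP/uv/annP.
  by exists a; [exact/annP | rewrite JE; apply: contra au => /annP ->].
have quot_gen W (y : quotmod W) : exists a : S, y = a *: quot_proj W u.
  have [x ->] := quot_proj_surj y; have [a ->] := u_gen x.
  by exists a; rewrite linearZ.
have quot_ex a : a *: u != 0 -> exact_at (T (quotmod (im (scale_by (a *: u))))) D E.
  move=> au; apply: (IHa _ (quot_proj _ u) (quot_gen _)) => [b bu|].
    by rewrite -linearZ /= bu linear0.
  exists a => //; rewrite -linearZ /=; apply/quot_proj_eq0/imP; exists 1.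
  by rewrite /= /scale_by scale1r.
have [u_prime|] := pselect (forall a b : S,
  (a * b) *: u = 0 -> a *: u = 0 \/ b *: u = 0).
  exact: exact_at_cyclic_prime.
(* Here [a] kills the submodule generated by [b *: u] and [b] kills the quotient by it, while
   neither kills [u]; both ends of the extension have larger annihilators. *)
move=> /existsNP[a /existsNP[b /not_implyP[abu /not_orP[/eqP au /eqP bu]]]].
pose W := im (scale_by (b *: u)).
have bW : b *: u \in W by apply/imP; exists 1; rewrite /= /scale_by scale1r.
apply: (exact_at_extension T_flat ED0 (@incl_inj _ _ W)
  (@quot_proj_surj _ _ W) (@quot_proj_ker _ _ W)); last exact: quot_ex.
apply: (IHa _ (Sub (b *: u) bW : submod W)) => [x|c cu|].
- have /imP[c xc] := incl_in x; exists c; apply: incl_inj.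
  by rewrite linearZ /= xc /incl SubK.
- by apply: incl_inj; rewrite linearZ linear0 /= /incl SubK scalerA mulrC -scalerA cu scaler0.
- by exists a => //; apply: incl_inj; rewrite linearZ linear0 /= /incl SubK scalerA.
Qed.

End FibreCriterion.

(** * Universal exactness of the glued complex *)

Section MapGlued.
Variables (A B : comPzRingType) (k : {rmorphism A -> B}).
Variables (T : glued A) (V : lmodType B) (W : lmodType A).

Lemma is_complex_map : is_complex T -> is_complex (map_glued k T).
Proof.
move=> [DD EE CE DC]; split=> [i|i||] /=.
- by rewrite -map_mxM DD map_mx0.
- by rewrite -map_mxM EE map_mx0.
- by rewrite -map_mxM CE map_mx0.
- by rewrite map_trmx -map_mxM DC map_mx0.
Qed.

Hypothesis VW : forall m n l (D : 'M[A]_(m, n)) (E : 'M[A]_(l, m)),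
  exact_at V (map_mx k D) (map_mx k E) <-> exact_at W D E.

Lemma resolving_map : resolving V (map_glued k T) <-> resolving W T.
Proof.
split=> -[exD exE exE0 exC].
  split=> [i|i||]; apply/VW; [exact: exD|exact: exE|exact: exE0|].
  by rewrite -map_trmx.
split=> [i|i||] /=; [exact/VW/exD|exact/VW/exE|exact/VW|].
by rewrite map_trmx; exact/VW.
Qed.

Lemma coresolving_map n : coresolving n V (map_glued k T) <-> coresolving n W T.
Proof.
split=> -[exD exE exC exD0].
  split=> [i lt_in|i lt_in||]; apply/VW; rewrite -?map_trmx;
    [exact: exD|exact: exE|exact: exC|exact: exD0].
split=> [i lt_in|i lt_in||]; rewrite /= ?map_trmx;
  [exact/VW/exD|exact/VW/exE|exact/VW|exact/VW].
Qed.

End MapGlued.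

Lemma resolving_base_change (S R S' : comPzRingType) (h : {rmorphism S -> R})
    (T : glued R) (g : {rmorphism S -> S'}) :
  (forall I : lmodType S, resolving (extend_functor h I) T) ->
  resolving (bc_ring h g)^o (map_glued (bc_inl h g) T).
Proof.
move=> T_res.
exact/(resolving_map T (fun m n l D E => exact_at_bc_ring h g D E))/T_res.
Qed.

Section GluedData.
Variable R : comPzRingType.
Hypothesis R_coh : coherent_ring R.

Lemma is_kernel_exact m k l (D : 'M[R]_(m, k)) (E : 'M[R]_(l, m)) :
  is_kernel (mxact E : _ -> ('I_l -> R^o)) D -> exact_at R^o D E.
Proof. by move=> kerD v /kerD. Qed.

Lemma glued_data (M : lmodType R) : coherent_module M ->
  exists (T : glued R) (e : 'I_(gp T 0) -> M),
    [/\ presented e (gD T 0), is_complex T & resolving R^o T].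
Proof.
move=> M_coh; have [a [e e_gen]] := M_coh.1.
have [n [G kerG]] := relations_kernel (coherent_relations e M_coh).
have [p [D0 [D [kerD0 kerD1 kerD]]]] := kernel_resolution R_coh kerG.
have [n' [G' kerG']] := mxact_kernel R_coh D0^T.
have [q [C [E [kerC kerE0 kerE]]]] := kernel_resolution R_coh kerG'.
pose P i := if i is j.+1 then p j else a.
pose DD i : 'M[R]_(P i, P i.+1) :=
  match i with 0 => D0 | j.+1 => D j end.
have kerDD i : is_kernel (mxact (DD i) : _ -> ('I_(P i) -> R^o)) (DD i.+1).
  by case: i.
exists (@Glued R P q DD E C), e; split=> [|//|].
- by split=> [x|]; [exact: e_gen|exact: kerD0].
- by split=> [i|i||]; apply: is_kernel_mul.
- by split=> [i|i||]; apply: is_kernel_exact.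
Qed.

End GluedData.

Section Main.
Variables (S R : comPzRingType) (h : {rmorphism S -> R}) (M : lmodType R).
Variable n : nat.
Hypotheses (h_flat : flat_hom h) (M_flat : flat_module (restr h M)).
Hypotheses (S_noeth : noetherian_ring S) (R_coh : coherent_ring R).
Hypothesis n_gt1 : (1 < n)%N.
Variables (T : glued R) (e : 'I_(gp T 0) -> M).
Hypotheses (M_pres : presented e (gD T 0)) (T_complex : is_complex T).
Hypothesis T_res : resolving R^o T.
Notation X := (extend_functor h).

(** Flatness of [M] gives the first spot, and each spot gives the preceding one in the complex by
    shifting. *)
Lemma universally_resolving_D i (I : lmodType S) :
  exact_at (X I) (gD T i.+1) (gD T i).
Proof.
have [exD _ _ _] := T_res; have [DD _ _ _] := T_complex.
elim: i I => [|i IHi] I.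
  exact: (exact_at_flat_presented (extend_functor_flat h_flat) M_flat M_pres).
exact: (exact_at_shift_flat (extend_functor_flat h_flat) (DD i.+1) (DD i)).
Qed.

Hypothesis M_refl : forall s : spec S,
  (spec_map h @` @closed_point R)%classic s ->
  stably_reflexive n (base_change h (residue_map s) M).

(** Only Ext of the fibres of [M] enters, and [D] alone computes it; at this stage [E] is not yet
    known to stay exact on the fibres. *)
Lemma universally_coresolving_D i (I : lmodType S) : (i.+1 < n)%N ->
  exact_at (X I) (gD T i)^T (gD T i.+1)^T.
Proof.
move=> lt_in; have [DD _ _ _] := T_complex.
apply: (fibrewise_exact S_noeth R_coh (extend_functor_flat h_flat)) => [|s s_closed].
  by rewrite -trmx_mul DD trmx0.
have [_ /(_ i.+1 lt_in)[ext _]] := M_refl s_closed.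
pose k := bc_inl h (residue_map s).
have exD j : exact_at (bc_ring h (residue_map s))^o
    (map_mx k (gD T j.+1)) (map_mx k (gD T j)).
  by apply/exact_at_bc_ring; exact: universally_resolving_D.
have DDk j : map_mx k (gD T j) *m map_mx k (gD T j.+1) = 0.
  by rewrite -map_mxM DD map_mx0.
apply/exact_at_bc_ring; rewrite -!map_trmx.
exact: ((Ext_matrixP (presented_base_change h (residue_map s) M_pres) exD DDk _ i).1 ext).
Qed.

(** As [n > 1], the transposes of the first two matrices of [D] are exact at their common spot for
    every [I]; shifting from there passes through [C] and down all of [E]. *)
Lemma universally_resolving (I : lmodType S) : resolving (X I) T.
Proof.
have [_ exE exE0 exC] := T_res; have [DD EE CE DC] := T_complex.
have X_flat := extend_functor_flat h_flat.
have DDt : (gD T 1)^T *m (gD T 0)^T = 0 by rewrite -trmx_mul DD trmx0.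
have uC J : exact_at (X J) (gC T) (gD T 0)^T.
  apply: (exact_at_shift_flat X_flat DC DDt exC) => J'.
  exact: universally_coresolving_D.
have uE0 J : exact_at (X J) (gE T 0) (gC T).
  exact: (exact_at_shift_flat X_flat CE DC exE0).
have uE i J : exact_at (X J) (gE T i.+1) (gE T i).
  elim: i J => [|i IHi] J.
    exact: (exact_at_shift_flat X_flat (EE 0%N) CE (exE 0%N)).
  exact: (exact_at_shift_flat X_flat (EE i.+1) (EE i) (exE i.+1)).
by split=> // i; exact: universally_resolving_D.
Qed.

(** The glued data now stay resolving on every fibre, so the full criterion applies to the fibres,
    and [fibrewise_exact] treats each spot separately. *)
Lemma universally_coresolving (I : lmodType S) : coresolving n (X I) T.
Proof.
have [DD EE CE DC] := T_complex; have X_flat := extend_functor_flat h_flat.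
have fibre s : (spec_map h @` @closed_point R)%classic s ->
    coresolving n (X (restr (residue_map s) (residue_field s : comPzRingType)^o)) T.
  move=> s_closed.
  apply/(coresolving_map T (fun m n l D E => exact_at_bc_ring h (residue_map s) D E)).
  apply: (stably_reflexive_glued
    (presented_base_change h (residue_map s) M_pres : presented (_ : 'I_(gp (map_glued _ T) 0) -> _) _)
    _ (resolving_base_change _ universally_resolving) n).1; last exact: M_refl.
  exact: is_complex_map.
split=> [i lt_in|i lt_in||].
- exact: universally_coresolving_D.
- apply: (fibrewise_exact S_noeth R_coh X_flat) => [|s /fibre[_ exE _ _]].
    by rewrite -trmx_mul EE trmx0.
  exact: exE.
- apply: (fibrewise_exact S_noeth R_coh X_flat) => [|s /fibre[_ _ exE _] //].
  by rewrite -trmx_mul CE trmx0.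
- apply: (fibrewise_exact S_noeth R_coh X_flat) => [|s /fibre[_ _ _ exD] //].
  by rewrite -[gD T 0]trmxK -trmx_mul DC trmx0.
Qed.

End Main.

(** * Stability under base change, the dual, and the base change map *)

Section Consequences.
Variables (S R : comPzRingType) (h : {rmorphism S -> R}) (n : nat).
Notation X := (extend_functor h).

Section BaseChange.
Variables (M : lmodType R) (T : glued R) (e : 'I_(gp T 0) -> M).
Hypotheses (M_pres : presented e (gD T 0)) (T_complex : is_complex T).
Hypothesis T_res : forall I : lmodType S, resolving (X I) T.
Variables (S' : comPzRingType) (g : {rmorphism S -> S'}).

Lemma Ext_base_change_eq0 (I : lmodType S') i :
  coresolving n (X (restr g I)) T -> (0 < i < n)%N ->
  zero_module (Ext (base_change h g M) (extend (bc_inr h g) I) i).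
Proof.
case: i => // i [exD _ _ _] lt_in.
apply/(Ext_glued (T := map_glued (bc_inl h g) T) (presented_base_change h g M_pres)
  (is_complex_map _ T_complex) (resolving_base_change g T_res)).
by rewrite /= !map_trmx; apply/exact_at_extend_bc; exact: exD.
Qed.

Hypothesis T_cores : forall I : lmodType S, coresolving n (X I) T.

Lemma stably_reflexive_base_change : stably_reflexive n (base_change h g M).
Proof.
apply/(stably_reflexive_glued (T := map_glued (bc_inl h g) T)
  (presented_base_change h g M_pres)
  (is_complex_map _ T_complex) (resolving_base_change g T_res)).
exact/(coresolving_map T (fun m n l D E => exact_at_bc_ring h g D E))/T_cores.
Qed.

(** With [S''] a residue field of [S'], this treats the fibres of the base change of [M]: two
    cancellations bring the coefficients back to an [S]-module. *)
Lemma stably_reflexive_base_change2 (S'' : comPzRingType)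
    (g' : {rmorphism S' -> S''}) :
  stably_reflexive n (base_change (bc_inr h g) g' (base_change h g M)).
Proof.
set k := bc_inl h g; set k' := bc_inl (bc_inr h g) g'.
have exE1 m r l (D : 'M[bc_ring h g]_(m, r)) (E : 'M[bc_ring h g]_(l, m)) :=
  exact_at_bc_ring (bc_inr h g) g' D E.
have pres := presented_base_change (bc_inr h g) g' (presented_base_change h g M_pres).
have cpx := is_complex_map k' (is_complex_map k T_complex).
have VW m r l (D : 'M[R]_(m, r)) (E : 'M[R]_(l, m)) :=
  exact_at_extend_bc h g (restr g' S''^o) D E.
apply/(stably_reflexive_glued (T := map_glued k' (map_glued k T)) pres cpx).
  exact/(resolving_map _ exE1)/(resolving_map _ VW)/T_res.
exact/(coresolving_map _ exE1)/(coresolving_map _ VW)/T_cores.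
Qed.

End BaseChange.

Lemma stably_reflexive_wrt_base_change (M : lmodType R) (T : glued R)
    (e : 'I_(gp T 0) -> M) (S' : comPzRingType) (g : {rmorphism S -> S'}) :
  presented e (gD T 0) -> is_complex T ->
  (forall I : lmodType S, resolving (X I) T) ->
  (forall I : lmodType S, coresolving n (X I) T) ->
  flat_hom h -> flat_module (restr h M) ->
  stably_reflexive_wrt (bc_inr h g) n (base_change h g M).
Proof.
move=> M_pres T_complex T_res T_cores h_flat M_flat; split.
- exact: flat_hom_base_change.
- exact: flat_base_change.
- by move=> s' _; exact: (stably_reflexive_base_change2 M_pres).
Qed.

Section Dual.
Variables (M : lmodType R) (T : glued R) (e : 'I_(gp T 0) -> M).
Hypotheses (M_pres : presented e (gD T 0)).
Hypothesis T_res : forall I : lmodType S, resolving (X I) T.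
Variable c : 'I_(gq T 0) -> dual M.
Hypothesis cC : forall l k, (c l : {linear M -> R^o}) (e k) = gC T k l.
Hypothesis c_pres : presented c (gE T 0).

Section Evaluation.
Variables (m : M) (I : lmodType S).

Definition dual_eval (f : restr h (dual M)) : restr h R^o :=
  (f : {linear M -> R^o}) m.

Lemma dual_eval_is_linear : linear dual_eval.
Proof. by []. Qed.

Definition tens_dual_eval (t : tens (restr h (dual M)) I) : X I :=
  tens_map (linear_pack dual_eval_is_linear) (idfun : {linear I -> I}) t.

Lemma tens_dual_evalD s t :
  tens_dual_eval (s + t) = tens_dual_eval s + tens_dual_eval t.
Proof. exact: (raddfD (tens_map _ _)). Qed.

Lemma tens_dual_eval0 : tens_dual_eval 0 = 0.
Proof. exact: (raddf0 (tens_map _ _)). Qed.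

Lemma tens_dual_evalE (f : dual M) (x : I) :
  tens_dual_eval ((f : restr h (dual M)) \ox x)
  = tf_pure X ((f : {linear M -> R^o}) m : R) x.
Proof. exact: tens_mapE. Qed.

End Evaluation.

Lemma tens_dual_eval_act (I : lmodType S) (m : M) (f : dual M) (t : X I) :
  tens_dual_eval m (tf_act X f t) = (f : {linear M -> R^o}) m *: t.
Proof.
elim/tf_ind: t => [|r x|s t IHs IHt].
- by rewrite raddf0 tens_dual_eval0 scaler0.
- rewrite tf_actE tens_dual_evalE; symmetry; apply: etrans (tf_pureZl _ _ _ _) _.
  by rewrite mulrC.
- by rewrite raddfD tens_dual_evalD IHs IHt scalerDr.
Qed.

Lemma tens_dual_eval_comb (I : lmodType S) (v : 'I_(gq T 0) -> X I) k :
  tens_dual_eval (e k) (tens_comb c v) = mxact (gC T) v k.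
Proof.
rewrite /tens_comb /mxact; elim: (index_enum _) => [|l s IHs].
  by rewrite !big_nil tens_dual_eval0.
by rewrite !big_cons tens_dual_evalD tens_dual_eval_act cC IHs.
Qed.

(** The dual tensored with [I] is the cokernel of [gE T 0] over [X I], and evaluation at the
    generators [e] is the map induced by [C]; it is injective by exactness at that spot. *)
Lemma tens_dual_eval_inj (I : lmodType S) (t : tens (restr h (dual M)) I) :
  (forall k, tens_dual_eval (e k) t = 0) -> t = 0.
Proof.
have [v ->] := tens_comb_surj X c_pres t => Cv.
have [_ _ exE _] := T_res I; have [|w ->] := exE v.
  by apply/funext => k; rewrite -tens_dual_eval_comb.
exact: tens_comb_rel.
Qed.

(** Evaluations at the [e k] jointly embed the dual tensored with [U] in a power of [X U], naturally
    in [U], and [X] preserves injections. *)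
Lemma flat_dual : flat_hom h -> flat_module (restr h (dual M)).
Proof.
move=> h_flat U V f f_inj; apply: raddf_inj0 => t ft.
apply: tens_dual_eval_inj => k.
apply: (inj_raddf0 (extend_functor_flat h_flat f_inj)).
have [v tv] := tens_comb_surj X c_pres t; move: ft; rewrite tv /= tens_comb_map => fv.
rewrite tens_dual_eval_comb.
rewrite -[LHS]/((tf_map X f \o mxact (gC T) v) k) linear_mxact.
by rewrite -tens_dual_eval_comb fv tens_dual_eval0.
Qed.

Lemma bc_map_gen (S' : comPzRingType) (g : {rmorphism S -> S'}) (I : lmodType S')
    (t : bc_mod h g (dual M) I) k :
  bc_map h g M I t (bc_pure h g (e k) (1 : S'^o))
  = extend_uncancel (tens_dual_eval (e k) (t : tens _ (restr g I))).
Proof.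
elim/bc_ind: t => [|f x|s t IHs IHt].
- by rewrite bc_map0 tens_dual_eval0 extend_uncancel0.
- by rewrite bc_mapE scale1r [tens_dual_eval _ _]tens_dual_evalE extend_uncancelE.
- rewrite bc_mapD tens_dual_evalD extend_uncancelD -IHs -IHt; exact: erefl.
Qed.

(** A map [F] on the base change of [M] is given by its values on the generators, a family killed by
    the transpose of [gD T 0]. By exactness at [C] this family is [C] applied to some [w], which
    supplies a preimage of [F]; injectivity is [tens_dual_eval_inj]. *)
Lemma bc_map_bij (S' : comPzRingType) (g : {rmorphism S -> S'}) (I : lmodType S') :
  bijective (bc_map h g M I).
Proof.
have u_bij := @extend_uncancel_bij S R S' h g I.
have pres := presented_base_change h g M_pres.
apply: inj_surj_bijective.
  apply: raddf_inj0 => t t0; apply: tens_dual_eval_inj => k.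
  apply: (inj_raddf0 (bij_inj u_bij)).
  by rewrite -[LHS]bc_map_gen t0.
move=> F; have [_ _ _ exC] := T_res (restr g I).
move/exact_at_extend_bc: exC.
rewrite -map_trmx => /(_ (F \o (fun k => bc_pure h g (e k) (1 : S'^o)))) [|w Fw].
  rewrite -linear_mxact presented_rel //.
  by apply/funext => i /=; rewrite linear0.
have [inv _ invK] := u_bij; pose v l := inv (w l).
exists (tens_comb (T := X) c v); apply: (presented_ext pres) => k.
pose u : {linear extend h (restr g I) -> restr (bc_inl h g) (extend (bc_inr h g) I)} :=
  @extend_uncancel S R S' h g I.
have uv : u \o v = w by apply/funext => l; exact: invK.
rewrite bc_map_gen tens_dual_eval_comb.
rewrite -[RHS]/((u \o mxact (gC T) v) k) linear_mxact uv.
rewrite -[LHS]/((F \o (fun k => bc_pure h g (e k) (1 : S'^o))) k) Fw.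
by apply: eq_bigr => l _; rewrite mxE.
Qed.

End Dual.
End Consequences.

Theorem proposition3p5 (S R : comPzRingType) (h : {rmorphism S -> R})
    (M : lmodType R) (n : nat)
    (h_flat : flat_hom h) (M_flat : flat_module (restr h M))
    (M_coh : coherent_module M) (S_noeth : noetherian_ring S)
    (R_coh : coherent_ring R) (n_gt1 : (1 < n)%N)
    (M_refl : stably_reflexive_wrt h n M) :
  (forall (S' : comPzRingType) (g : {rmorphism S -> S'}),
     stably_reflexive_wrt (bc_inr h g) n (base_change h g M) /\
     stably_reflexive n (base_change h g M)) /\
  stably_reflexive_wrt h n (dual M) /\
  (forall (S' : comPzRingType) (g : {rmorphism S -> S'}) (I' : lmodType S'),
     bijective (bc_map h g M I') /\
     forall i : nat, (0 < i < n)%N ->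
       zero_module (Ext (base_change h g M) (extend (bc_inr h g) I') i)).
Proof.
have [T [e [M_pres T_complex T_res]]] := glued_data R_coh M_coh.
have [_ _ M_fib] := M_refl.
have Xres := universally_resolving h_flat M_flat S_noeth R_coh n_gt1 M_pres
  T_complex T_res M_fib.
have Xcores := universally_coresolving h_flat M_flat S_noeth R_coh n_gt1 M_pres
  T_complex T_res M_fib.
have [c [cC c_pres]] := glued_dual M_pres T_complex T_res.
split=> [S' g|].
  split; first exact: (stably_reflexive_wrt_base_change g M_pres).
  exact: (stably_reflexive_base_change M_pres).
split.
  split=> [//||s _]; first exact: (flat_dual Xres cC c_pres).
  (* The swapped data present the dual of [M], and what was coresolving supplies the two resolving
     spots around the transpose of [C]. *)
  apply: (stably_reflexive_base_change (T := swap T) c_pres) => [|I|I].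
  - exact: is_complex_swap.
  - exact: (resolving_swap (Xres I) (Xcores I)).
  - exact: (coresolving_swap (Xres I) (Xcores I)).
move=> S' g I'; split; first exact: (bc_map_bij M_pres Xres cC c_pres).
move=> i lt_in; exact: (Ext_base_change_eq0 M_pres T_complex Xres (Xcores _) lt_in).
Qed.
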